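(* Let the weighted graph class $\mathcal{A},\tau$ be well-behaved, where $\tau=(\lambda,\nu)$, and let $\rho=\rho(\mathcal{A},\tau)$. Let $\mathcal{F}_{\mathcal{A}}$ be the class of graphs freely addable to $\mathcal{A}$, with exponential generating function $F_{\mathcal{A}}$, and let $\mathcal{D}$ be the class of connected graphs in $\mathcal{F}_{\mathcal{A}}$, with exponential generating function $D$. Then $0<\rho<\infty$ and $F_{\mathcal{A}}(\rho,\tau)$ is finite; and for $R_n\in_\tau\mathcal{A}$, the random unlabelled graph $F_n$ corresponding to $\mathrm{Frag}(R_n)$ converges in total variation to $R$, where $R$ is the random unlabelled graph taking values in $\mathcal{U}\mathcal{F}_{\mathcal{A}}$ with $\Pr[R=H]=\mu(H)/F_{\mathcal{A}}(\rho,\tau)$, $\mu(H)=\rho^{v(H)}\lambda^{e(H)}\nu^{\kappa(H)}/\mathrm{aut}(H)$. Further, $\mathbb{E}[v(R)]=\rho D'(\rho,\tau)<\infty$, where $D'$ is the derivative with respect to the first variable.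
   Context: Graph classes are closed under isomorphism; $\mathcal{A}_n$ is the set of graphs in $\mathcal{A}$ on vertex set $[n]=\{1,\dots,n\}$. A weighting is $\tau=(\lambda,\nu)$ with $\lambda,\nu>0$; for a graph $G$, $\tau(G)=\lambda^{e(G)}\nu^{\kappa(G)}$ where $e(G)$ is the number of edges and $\kappa(G)$ the number of components; $\tau(\mathcal{B})=\sum_{G\in\mathcal{B}}\tau(G)$ for finite $\mathcal{B}$. $R_n\in_\tau\mathcal{A}$ means $\Pr(R_n=H)=\tau(H)/\tau(\mathcal{A}_n)$ for $H\in\mathcal{A}_n$. The exponential generating function of a class $\mathcal{B}$ is $B(x,\tau)=\sum_n\tau(\mathcal{B}_n)x^n/n!$ (for non-connected-only classes the empty graph is included, with weight 1); $\rho(\mathcal{A},\tau)$ is the radius of convergence of $A(x,\tau)$ in $x$. $v(G)$, $\mathrm{aut}(G)$: number of vertices, automorphisms; $\mathcal{U}\mathcal{B}$ is the set of unlabelled graphs of $\mathcal{B}$. $\mathcal{A},\tau$ has growth constant $\gamma$ if $0\le\gamma<\infty$ and $\tau(\mathcal{A}_n)=(\gamma+o(1))^n n!$. $\mathcal{A}$ is bridge-addable if for every $G\in\mathcal{A}$ and vertices $u,v$ in different components of $G$, $G+uv\in\mathcal{A}$. A graph $H$ is freely addable to $\mathcal{A}$ if the disjoint union $G\cup H\in\mathcal{A}$ for all $G\in\mathcal{A}$; $H\in\mathcal{A}$ is limited in $\mathcal{A}$ if the disjoint union of $k$ copies of $H$ is not in $\mathcal{A}$ for some positive integer $k$; $\mathcal{A}$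 is dichotomous if every graph in $\mathcal{A}$ is freely addable to $\mathcal{A}$ or limited in $\mathcal{A}$. $\mathcal{A},\tau$ maintains at least factorial growth if there are $\eta>0$ and a function $g(n)=(1+o(1))^n$ with $\tau(\mathcal{A}_n)\ge\tau(\mathcal{A}_{n-j})(n)_j\eta^j g(n)$ for all $n$ and $1\le j<n$, where $(n)_j=n(n-1)\cdots(n-j+1)$. $\mathcal{A}^{\delta\ge2}$ is the class of graphs in $\mathcal{A}$ of minimum degree at least 2. $\mathcal{A},\tau$ is well-behaved if $\mathcal{A}$ is minor-closed, bridge-addable and dichotomous, $\mathcal{A},\tau$ has a growth constant, and the weighted class $\mathcal{A}^{\delta\ge2},\tau$ either (a) is empty or has radius of convergence at least $\lambda^{-1}$, or (b) maintains at least factorial growth. For a graph $G$, the big component is the lexicographically first component with the most vertices, and $\mathrm{Frag}(G)$ is the subgraph induced on the vertices not in the big component. *)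

(* Defs.v *)
From HB Require Import structures.
From mathcomp Require Import all_boot all_order all_algebra generic_quotient perm.
From mathcomp Require Import all_classical all_reals all_analysis.

Set Implicit Arguments.
Unset Strict Implicit.
Unset Printing Implicit Defensive.

Import Order.TTheory GRing.Theory Num.Theory.
Import numFieldNormedType.Exports.

(** * Finite simple graphs on the vertex set 'I_n *)

Definition simple_adj n (e : {ffun 'I_n * 'I_n -> bool}) : bool :=
  [forall u, ~~ e (u, u)] && [forall u, forall v, e (u, v) == e (v, u)].

Record graph n := Graph {
  adj_fun :> {ffun 'I_n * 'I_n -> bool};
  _ : simple_adj adj_fun }.

HB.instance Definition _ n := [isSub for @adj_fun n].
HB.instance Definition _ n := [Equality of graph n by <:].
HB.instance Definition _ n := [Choice of graph n by <:].
HB.instance Definition _ n := [Countable of graph n by <:].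
HB.instance Definition _ n := [Finite of graph n by <:].

Definition adj n (G : graph n) : rel 'I_n := fun u v => adj_fun G (u, v).

Lemma simple_adj_of_rel n (r : rel 'I_n) :
  simple_adj [ffun p => (p.1 != p.2) && (r p.1 p.2 || r p.2 p.1)].
Proof.
apply/andP; split; first by apply/forallP => u; rewrite ffunE eqxx.
apply/forallP => u; apply/forallP => v.
by apply/eqP; rewrite !ffunE /= eq_sym orbC.
Qed.

(* u ~ v iff u != v and (r u v or r v u): for symmetric irreflexive r, the
   adjacency relation is r itself. *)
Definition graph_of_rel n (r : rel 'I_n) : graph n :=
  Graph (simple_adj_of_rel r).

Lemma adj_graph_of_rel n (r : rel 'I_n) u v :
  adj (graph_of_rel r) u v = (u != v) && (r u v || r v u).
Proof. by rewrite /adj ffunE. Qed.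

Definition num_edges n (G : graph n) : nat :=
  #|[set p : 'I_n * 'I_n | (p.1 < p.2)%N && adj G p.1 p.2]|.

Definition component n (G : graph n) (u : 'I_n) : {set 'I_n} :=
  [set v | connect (adj G) u v].

Definition components n (G : graph n) : {set {set 'I_n}} :=
  [set component G u | u : 'I_n].

Definition num_components n (G : graph n) : nat := #|components G|.

(* The empty graph (n = 0) has no component and is not connected. *)
Definition connected n (G : graph n) : bool := num_components G == 1%N.

Definition min_degree_ge2 n (G : graph n) : bool :=
  [forall v, (2 <= #|[set w | adj G v w]|)%N].

Definition num_aut n (G : graph n) : nat :=
  #|[set s : 'S_n | [forall u, forall v, adj G (s u) (s v) == adj G u v]]|.

Definition isomorphic m n (G : graph m) (H : graph n) : Prop :=
  exists f : 'I_m -> 'I_n,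
    bijective f /\ forall u v, adj H (f u) (f v) = adj G u v.

Definition add_edge n (G : graph n) (u v : 'I_n) : graph n :=
  graph_of_rel [rel x y | adj G x y || ((x == u) && (y == v))].

Definition disjoint_union m n (G : graph m) (H : graph n) : graph (m + n) :=
  graph_of_rel [rel x y | match fintype.split x, fintype.split y with
                          | inl u, inl v => adj G u v
                          | inr u, inr v => adj H u v
                          | _, _ => false
                          end].

Definition empty_graph : graph 0 := graph_of_rel [rel _ _ | false].

Fixpoint copies k n (H : graph n) : graph (k * n) :=
  if k is k'.+1 then disjoint_union H (copies k' H) else empty_graph.

Definition induced n (G : graph n) (S : {set 'I_n}) : graph #|S| :=
  graph_of_rel [rel i j | adj G (enum_val i) (enum_val j)].

(* H is a minor of G: phi sends each vertex of G to the vertex of H whose branch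
   set contains it (None if there is none); branch sets are nonempty and
   connected in G. *)
Definition minor m n (H : graph n) (G : graph m) : Prop :=
  exists phi : 'I_m -> option 'I_n,
    [/\ forall x, exists u, phi u = Some x,
        forall x u v, phi u = Some x -> phi v = Some x ->
          connect [rel a b | [&& adj G a b, phi a == Some x & phi b == Some x]]
            u v
      & forall x y, adj H x y ->
          exists u v, [/\ phi u = Some x, phi v = Some y & adj G u v]].

(* The vertices of C in increasing order, compared lexicographically. *)
Definition vertex_seq n (C : {set 'I_n}) : seqlexi nat :=
  [seq val v | v <- enum C].

(* set0 when n = 0. *)
Definition big_component n (G : graph n) : {set 'I_n} :=
  odflt finset.set0 [pick C in components G |
    [forall C' in components G, (#|C'| < #|C|)%N ||
      ((#|C'| == #|C|) && (vertex_seq C <= vertex_seq C')%O)]].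

Definition frag n (G : graph n) : graph #|~: big_component G| :=
  induced G (~: big_component G).

(** * Unlabelled graphs: isomorphism classes *)

Definition lgraph : Type := {n : nat & graph n}.

HB.instance Definition _ := Choice.on lgraph.

Definition lgraph_iso : rel lgraph :=
  fun G H => `[< isomorphic (tagged G) (tagged H) >].

Lemma lgraph_iso_refl : reflexive lgraph_iso.
Proof. by move=> G; apply/asboolP; exists id; split=> //; exists id. Qed.

Lemma lgraph_iso_sym : symmetric lgraph_iso.
Proof.
suff half G H : lgraph_iso G H -> lgraph_iso H G.
  by move=> G H; apply/idP/idP; apply: half.
move=> /asboolP[f [[g fK gK] fE]]; apply/asboolP; exists g; split.
  by exists f.
by move=> u v; rewrite -fE !gK.
Qed.

Lemma lgraph_iso_trans : transitive lgraph_iso.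
Proof.
move=> H G K /asboolP[f [bf fE]] /asboolP[g [bg gE]]; apply/asboolP.
exists (g \o f); split; first exact: bij_comp.
by move=> u v; rewrite /= gE fE.
Qed.

Canonical lgraph_iso_equiv :=
  EquivRel lgraph_iso lgraph_iso_refl lgraph_iso_sym lgraph_iso_trans.

Definition ugraph : Type := {eq_quot lgraph_iso_equiv}%qT.

HB.instance Definition _ := Choice.on ugraph.
HB.instance Definition _ := EqQuotient.on ugraph.

Definition unlabelled n (G : graph n) : ugraph :=
  (\pi_ugraph (Tagged graph G))%qT.

(* A labelled representative of an unlabelled graph. *)
Definition labelled (H : ugraph) : graph (tag (repr H)) := tagged (repr H).

Definition num_vertices (H : ugraph) : nat := tag (repr H).

(* Both graph n and ugraph carry the discrete sigma-algebra. *)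
HB.instance Definition _ n := isPointed.Build (graph n)
  (graph_of_rel [rel _ _ | false]).
HB.instance Definition _ n := @isMeasurable.Build default_measure_display
  (graph n) discrete_measurable discrete_measurable0
  discrete_measurableC discrete_measurableU.

HB.instance Definition _ := isPointed.Build ugraph (unlabelled empty_graph).
HB.instance Definition _ := @isMeasurable.Build default_measure_display
  ugraph discrete_measurable discrete_measurable0
  discrete_measurableC discrete_measurableU.

(** * Classes of graphs; [A n] is the set of graphs of the class on 'I_n *)

Definition graph_class := forall n, {set graph n}.

Definition iso_closed (A : graph_class) : Prop :=
  forall m n (G : graph m) (H : graph n),
    isomorphic G H -> G \in A m -> H \in A n.

Definition minor_closed (A : graph_class) : Prop :=
  forall m n (G : graph m) (H : graph n),
    minor H G -> G \in A m -> H \in A n.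

Definition bridge_addable (A : graph_class) : Prop :=
  forall n (G : graph n) (u v : 'I_n),
    G \in A n -> ~~ connect (adj G) u v -> add_edge G u v \in A n.

Definition freely_addable (A : graph_class) n (H : graph n) : Prop :=
  forall m (G : graph m), G \in A m -> disjoint_union G H \in A (m + n)%N.

Definition limited (A : graph_class) n (H : graph n) : Prop :=
  exists k, (0 < k)%N /\ copies k H \notin A (k * n)%N.

Definition dichotomous (A : graph_class) : Prop :=
  forall n (H : graph n), H \in A n -> freely_addable A H \/ limited A H.

Definition freely_addable_class (A : graph_class) : graph_class :=
  fun n => [set H : graph n | `[< freely_addable A H >]].

Definition connected_class (B : graph_class) : graph_class :=
  fun n => [set H in B n | connected H].

Definition min_degree_ge2_class (A : graph_class) : graph_class :=
  fun n => [set G in A n | min_degree_ge2 G].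

Definition unlabelled_class (B : graph_class) : set ugraph :=
  fun H => labelled H \in B (num_vertices H).

(** * Weighted classes *)

Local Open Scope ring_scope.

Section Weighted.
Context {R : realType}.

(* f n = (c + o(1))^n as n -> oo *)
Definition power_asymp (c : R) (f : nat -> R) : Prop :=
  exists eps : nat -> R,
    (eps @ \oo --> (0 : R))%classic /\
    (\forall n \near \oo, f n = (c + eps n) ^+ n)%classic.

(* The sum of a power series with nonnegative coefficients at x >= 0. *)
Definition pseries_sum (c : nat -> R) (x : R) : \bar R :=
  (\sum_(0 <= n <oo) (c n * x ^+ n)%:E)%E.

Definition radius_of_convergence (c : nat -> R) : \bar R :=
  ereal_sup [set `|x|%:E | x in [set x : R | cvgn (pseries c x)]]%classic.

Definition total_variation_dist d (T : measurableType d)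
    (P Q : set T -> \bar R) : \bar R :=
  ereal_sup [set `|P S - Q S|%E | S in measurable]%classic.

Variables lam nu : R.

Definition weight n (G : graph n) : R :=
  lam ^+ num_edges G * nu ^+ num_components G.

Definition class_weight n (B : {set graph n}) : R := \sum_(G in B) weight G.

Definition egf_coef (B : graph_class) (n : nat) : R :=
  class_weight (B n) / n`!%:R.

Definition egf (B : graph_class) (x : R) : \bar R :=
  pseries_sum (egf_coef B) x.

(* Term-by-term derivative of the series in x: it makes sense at the radius of
   convergence, where it is the left derivative whenever it is finite. *)
Definition egf_deriv (B : graph_class) (x : R) : \bar R :=
  pseries_sum (pseries_diffs (egf_coef B)) x.

Definition rho (B : graph_class) : \bar R :=
  radius_of_convergence (egf_coef B).

Definition growth_constant (A : graph_class) (gamma : R) : Prop :=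
  0 <= gamma /\ power_asymp gamma (egf_coef A).

Definition maintains_factorial_growth (B : graph_class) : Prop :=
  exists (eta : R) (g : nat -> R),
    [/\ 0 < eta, power_asymp 1 g
      & forall n j, (1 <= j < n)%N ->
          class_weight (B (n - j)%N) * (n ^_ j)%:R * eta ^+ j * g n
            <= class_weight (B n)].

(* The empty graph is disregarded in deciding whether the class of graphs of
   minimum degree at least 2 is empty. *)
Definition well_behaved (A : graph_class) : Prop :=
  [/\ minor_closed A, bridge_addable A, dichotomous A,
      exists gamma, growth_constant A gamma
    & let B := min_degree_ge2_class A in
      [\/ forall n, (0 < n)%N -> B n = finset.set0,
          (lam^-1%:E <= rho B)%E
        | maintains_factorial_growth B]].

(* The random graph X (defined on the probability space (T, P)) satisfies
   X \in_tau A, on n vertices. *)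
Definition sampled_from (A : graph_class) n d (T : measurableType d)
    (P : probability T R) (X : {mfun T >-> graph n}) : Prop :=
  A n != finset.set0 /\
  forall H : graph n, P (X @^-1` [set H])%classic =
    (if H \in A n then weight H / class_weight (A n) else 0)%:E.

Definition frag_weight (r : R) (H : ugraph) : R :=
  r ^+ num_vertices H * lam ^+ num_edges (labelled H)
    * nu ^+ num_components (labelled H) / (num_aut (labelled H))%:R.

End Weighted.

(* Main.v *)
(** Let [C] be the class of connected graphs of [A] and [a_n], [c_n] the exponential
    coefficients of [A] and [C].

    Deleting a leaf of a graph of [C] leaves a graph of [C], and hanging a leaf (K1 is
    freely addable) does not leave [C] either.  So the mean number of leaves of a random
    graph of [C] on n vertices is [lam (n-1) c_(n-1)/c_n], and its second moment is
    about [lam^2 n^2 c_(n-2)/c_n].  The Cauchy-Schwarz inequality then shows that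
    [s_n = c_(n-1)/c_n] satisfies [s_n <= s_(n-1) + 1/(lam (n-1))].  A sequence which
    increases that slowly converges as soon as its geometric means do.  Double counting
    the pairs (graph, new bridge) bounds the mean size of the fragment by [4 nu / lam];
    hence [c_n] is at least a constant times [a_n], has the growth constant of [a_n], and
    [s_n -> rho].

    If H is freely addable, with k < n/2 vertices, then the fragment is H with
    probability [tau(H)/k! c_(n-k)/a_n ~ mu(H) c_n/a_n].  If H is not freely addable, one
    of its components K is limited; joining the copy of K in the fragment to the big
    component in all possible ways, one sees that this probability is O(1/n).  The
    fragment being tight, summing over H gives [c_n/a_n -> 1/F(rho)], and the
    convergence in total variation follows.  The mean is obtained from
    [n f_n = sum_j j d_j f_(n-j)], by splitting off the component of a vertex. *)

From HB Require Import structures.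
Require Import Defs.
From mathcomp Require Import all_boot all_order all_algebra.
From mathcomp Require Import fingroup perm generic_quotient reals zify ring lra.
From mathcomp Require boolp.
Set Implicit Arguments.
Unset Strict Implicit.
Unset Printing Implicit Defensive.
Import Order.TTheory GRing.Theory Num.Theory.

(** * Components, embeddings and unions of components *)

Section Graphs.
Variable n : nat.
Implicit Types (G H : graph n) (u v w : 'I_n) (S : {set 'I_n}).

Lemma adj_sym G : symmetric (adj G).
Proof.
move=> u v; case: G => e /= He; rewrite /adj /=.
by case/andP: (He) => _ /forallP/(_ u)/forallP/(_ v)/eqP.
Qed.

Lemma adj_irr G u : adj G u u = false.
Proof.
case: G => e /= He; rewrite /adj /=.
by case/andP: (He) => /forallP/(_ u)/negbTE.
Qed.

Lemma adj_neq G u v : adj G u v -> u != v.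
Proof. by apply: contraTneq => ->; rewrite adj_irr. Qed.

Lemma graph_eqP G H : adj G =2 adj H -> G = H.
Proof.
by move=> E; apply: val_inj; apply/ffunP => -[u v]; exact: E.
Qed.

Lemma connectC G : connect_sym (adj G).
Proof. by apply: sym_connect_sym; apply: adj_sym. Qed.

Definition splits G S : bool :=
  [forall u, forall v, adj G u v ==> ((u \in S) == (v \in S))].

Lemma splitsP G S :
  reflect (closed (adj G) (mem S)) (splits G S).
Proof.
apply: (iffP idP) => [/forallP h u v|h].
  by move/forallP: (h u) => /(_ v)/implyP huv /huv/eqP.
by apply/forallP => u; apply/forallP => v; apply/implyP => /h/eqP.
Qed.

Lemma splitsC G S : splits G (~: S) = splits G S.
Proof.
apply: eq_forallb => u; apply: eq_forallb => v.
by rewrite !inE (inj_eq negb_inj).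
Qed.

Lemma component_refl G u : u \in component G u.
Proof. by rewrite inE connect0. Qed.

Lemma splits_component G u : splits G (component G u).
Proof.
apply/splitsP => x y xy; rewrite !inE; apply/idP/idP => h.
  by apply: connect_trans h (connect1 xy).
by apply: connect_trans h _; apply: connect1; rewrite adj_sym.
Qed.

Lemma eq_component G u v : connect (adj G) u v -> component G u = component G v.
Proof.
by move=> uv; apply/setP => x; rewrite !inE; apply: same_connect => //; apply: connectC.
Qed.

Lemma component_sub G S u : splits G S -> u \in S -> component G u \subset S.
Proof.
move=> /splitsP cl uS; apply/subsetP => x; rewrite inE => ux.
by rewrite -(closed_connect cl ux).
Qed.

Lemma num_components_n_comp G : num_components G = n_comp (adj G) 'I_n.
Proof.
rewrite /num_components /components /n_comp_mem.
have inj : {in [predI roots (adj G) & 'I_n] &, injective (component G)}.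
  move=> u v; rewrite !inE !andbT => /eqP ru /eqP rv E.
  have : v \in component G u by rewrite E component_refl.
  by rewrite inE => /(fingraph.rootP (@connectC G)); rewrite ru rv.
rewrite -(card_in_imset inj); apply: eq_card => C; apply/imsetP/imsetP.
  case=> u _ ->; exists (fingraph.root (adj G) u).
    by rewrite !inE roots_root //; apply: connectC.
  by apply: eq_component; apply: connect_root.
by case=> u _ ->; exists u.
Qed.

Lemma connectedP G :
  reflect ((0 < n) /\ forall u v, connect (adj G) u v) (Defs.connected G).
Proof.
rewrite /Defs.connected /num_components; apply: (iffP cards1P) => [[C hC]|[n0 h]].
  have hu u : component G u = C.
    by apply/set1P; rewrite -hC; apply: imset_f.
  split=> [|u v].
    case: n G C hC hu => // G C /setP/(_ C); rewrite inE eqxx => /imsetP[] [] //.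
  by have := component_refl G v; rewrite hu -(hu u) inE.
pose x := Ordinal n0; exists (component G x).
apply/setP => C; rewrite inE; apply/imsetP/eqP => [[u _ ->]|->]; last by exists x.
exact: eq_component.
Qed.

Lemma weight_gt0 (R : realType) (lam nu : R) G :
  (0 < lam)%R -> (0 < nu)%R -> (0 < weight lam nu G)%R.
Proof. by move=> l0 n0; rewrite mulr_gt0 // exprn_gt0. Qed.

End Graphs.

Definition hom_embeds m n (H : graph m) (G : graph n) (f : 'I_m -> 'I_n) : Prop :=
  injective f /\ forall u v, adj H u v -> adj G (f u) (f v).

Lemma hom_embeds_minor m n (H : graph m) (G : graph n) f :
  hom_embeds H G f -> minor H G.
Proof.
case=> inj hom.
pose phi (v : 'I_n) := [pick u | f u == v].
have phif u : phi (f u) = Some u.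
  rewrite /phi; case: pickP => [u' /eqP/inj -> //|/(_ u)]; by rewrite eqxx.
have phiK v u : phi v = Some u -> f u = v.
  by rewrite /phi; case: pickP => // u' /eqP <- [->].
exists phi; split.
- by move=> x; exists (f x).
- by move=> x u v /phiK <- /phiK <-; apply: connect0.
- by move=> x y xy; exists (f x), (f y); split=> //; apply: hom.
Qed.

Lemma hom_embeds_in (A : graph_class) m n (H : graph m) (G : graph n) f :
  minor_closed A -> hom_embeds H G f -> G \in A n -> H \in A m.
Proof. by move=> mA /hom_embeds_minor; apply: mA. Qed.

Lemma hom_embeds_comp m n k (H : graph m) (G : graph n) (K : graph k) f g :
  hom_embeds H G f -> hom_embeds G K g -> hom_embeds H K (g \o f).
Proof.
move=> [fi fh] [gi gh]; split; first exact: inj_comp.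
by move=> u v /fh/gh.
Qed.

Lemma adj_disjoint_union m n (G : graph m) (H : graph n) :
  [/\ forall u v, adj (disjoint_union G H) (lshift n u) (lshift n v) = adj G u v,
      forall u v, adj (disjoint_union G H) (rshift m u) (rshift m v) = adj H u v,
      forall u v, adj (disjoint_union G H) (lshift n u) (rshift m v) = false
    & forall u v, adj (disjoint_union G H) (rshift m v) (lshift n u) = false].
Proof.
have sl u : fintype.split (lshift n u : 'I_(m + n)) = inl u by exact: (unsplitK (inl _ u)).
have sr u : fintype.split (rshift m u : 'I_(m + n)) = inr u by exact: (unsplitK (inr _ u)).
split=> u v; rewrite adj_graph_of_rel /= ?sl ?sr ?andbF //.
  rewrite (adj_sym G v u) orbb (inj_eq (@lshift_inj _ _)).
  by case uv: adj; rewrite ?andbF // andbT; apply: adj_neq uv.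
rewrite (adj_sym H v u) orbb (inj_eq (@rshift_inj _ _)).
by case uv: adj; rewrite ?andbF // andbT; apply: adj_neq uv.
Qed.

Lemma hom_embeds_union m1 m2 n (H1 : graph m1) (H2 : graph m2) (G : graph n) f1 f2 :
  hom_embeds H1 G f1 -> hom_embeds H2 G f2 -> (forall u v, f1 u != f2 v) ->
  hom_embeds (disjoint_union H1 H2) G
    (fun x => match fintype.split x with inl u => f1 u | inr v => f2 v end).
Proof.
move=> [i1 h1] [i2 h2] dis; have [ll rr lr rl] := adj_disjoint_union H1 H2.
split=> x y; rewrite -(splitK x) -(splitK y); case: (fintype.split x) => u;
  case: (fintype.split y) => v; rewrite !unsplitK /= ?ll ?rr ?lr ?rl //.
- by move/i1->.
- by move=> E; move: (dis u v); rewrite E eqxx.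
- by move=> E; move: (dis v u); rewrite E eqxx.
- by move/i2->.
- exact: h1.
- exact: h2.
Qed.

Lemma hom_embeds_lshift m n (G : graph m) (H : graph n) :
  hom_embeds G (disjoint_union G H) (@lshift m n).
Proof.
have [ll _ _ _] := adj_disjoint_union G H.
by split=> [|u v]; [apply: lshift_inj | rewrite ll].
Qed.

Lemma hom_embeds_rshift m n (G : graph m) (H : graph n) :
  hom_embeds H (disjoint_union G H) (@rshift m n).
Proof.
have [_ rr _ _] := adj_disjoint_union G H.
by split=> [|u v]; [apply: rshift_inj | rewrite rr].
Qed.

Section Induced.
Variables (n : nat) (G : graph n).
Implicit Types S : {set 'I_n}.

Lemma adj_induced S (i j : 'I_#|S|) :
  adj (induced G S) i j = adj G (enum_val i) (enum_val j).
Proof.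
rewrite adj_graph_of_rel /= (adj_sym G (enum_val j)) orbb -(inj_eq enum_val_inj).
by case ij: adj; rewrite ?andbF // andbT; apply: adj_neq ij.
Qed.

Lemma hom_embeds_induced S : hom_embeds (induced G S) G (@enum_val _ (mem S)).
Proof. by split=> [|i j]; [apply: enum_val_inj | rewrite adj_induced]. Qed.

Lemma induced_adjunction S : splits G S ->
  rel_adjunction (@enum_val _ (mem S)) (adj G) (adj (induced G S)) (mem S).
Proof.
move=> /splitsP cl; apply: strict_adjunction => //.
- exact: connectC.
- exact: enum_val_inj.
- apply/fintype.subsetP => x xS; apply/codomP; exists (enum_rank_in xS x).
  by rewrite enum_rankK_in.
- by move=> i j _; rewrite adj_induced.
Qed.

Lemma num_components_induced S : splits G S ->
  num_components (induced G S) = n_comp (adj G) (mem S).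
Proof.
move=> sep; rewrite num_components_n_comp.
have /splitsP cl := sep.
rewrite (adjunction_n_comp _ _ _ cl (induced_adjunction sep)); first last.
- exact: connectC.
- exact: connectC.
by apply: eq_n_comp_r => i; rewrite !inE enum_valP.
Qed.

Lemma num_componentsU S : splits G S ->
  num_components G = num_components (induced G S) + num_components (induced G (~: S)).
Proof.
move=> sep; rewrite !num_components_induced ?splitsC // num_components_n_comp.
rewrite (n_compC (mem S)); congr (_ + _).
by apply: eq_n_comp_r => x; rewrite !inE.
Qed.

Lemma connect_induced S (i j : 'I_#|S|) : splits G S ->
  connect (adj (induced G S)) i j = connect (adj G) (enum_val i) (enum_val j).
Proof.
move=> sep; have [_ e] := induced_adjunction sep.
by rewrite e // enum_valP.
Qed.

End Induced.

Definition arcs n (G : graph n) : {set 'I_n * 'I_n} := [set p | adj G p.1 p.2].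

Lemma card_arcs n (G : graph n) : #|arcs G| = (num_edges G).*2.
Proof.
pose up := [set p : 'I_n * 'I_n | (p.1 < p.2)%N && adj G p.1 p.2].
rewrite -(cardsID up) -addnn /num_edges -/up; congr (_ + _).
  by apply: eq_card => p; rewrite !inE; case: (adj G); rewrite ?andbF ?andbT.
have swap_inj : injective (fun p : 'I_n * 'I_n => (p.2, p.1)) by move=> [? ?] [? ?] [-> ->].
rewrite -(card_imset (mem up) swap_inj); apply: eq_card => -[u v].
apply/idP/imsetP => [|[[x y] /=]].
  rewrite !inE /= => /andP[]; rewrite negb_and => uv auv; exists (v, u) => //.
  rewrite !inE /= adj_sym auv andbT; move: uv; rewrite auv orbF -leqNgt leq_eqVlt.
  by move: (adj_neq auv); rewrite eq_sym -val_eqE => /negbTE ->.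
by rewrite !inE /= => /andP[lt axy] [-> ->]; rewrite adj_sym axy !andbT -leqNgt ltnW.
Qed.

Section Product.
Variables (n : nat) (S : {set 'I_n}).

Lemma card_arcs_splits (G : graph n) : splits G S ->
  #|arcs G| = (#|arcs (induced G S)| + #|arcs (induced G (~: S))|)%N.
Proof.
move=> spl; have /splitsP cl := spl.
have half (T : {set 'I_n}) : closed (adj G) (mem T) ->
    #|arcs (induced G T)| = #|[set p in arcs G | p.1 \in T]|.
  move=> clT; pose f (p : 'I_#|T| * 'I_#|T|) := (enum_val p.1, enum_val p.2).
  have fi : injective f by move=> [? ?] [? ?] [/enum_val_inj -> /enum_val_inj ->].
  rewrite -(card_imset _ fi); apply: eq_card => -[x y]; apply/imsetP/idP.
    by case=> -[i j]; rewrite !inE /= adj_induced => aij [-> ->]; rewrite aij enum_valP.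
  rewrite !inE /= => /andP[axy xT]; have yT : y \in T by rewrite -(clT _ _ axy).
  exists (enum_rank_in xT x, enum_rank_in yT y); last by rewrite /f /= !enum_rankK_in.
  by rewrite inE /= adj_induced !enum_rankK_in.
rewrite half // half; last by apply/splitsP; rewrite splitsC.
rewrite -(cardsID [set p | p.1 \in S]); congr (_ + _)%N; apply: eq_card => p;
  by rewrite !inE // andbC.
Qed.

Lemma weight_splits (R : realType) (lam nu : R) (G : graph n) : splits G S ->
  weight lam nu G = (weight lam nu (induced G S) * weight lam nu (induced G (~: S)))%R.
Proof.
move=> spl; rewrite /weight (num_componentsU spl).
have -> : num_edges G = (num_edges (induced G S) + num_edges (induced G (~: S)))%N.
  by apply: double_inj; rewrite doubleD -!card_arcs card_arcs_splits.
by rewrite !exprD mulrACA.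
Qed.

Definition glue (H1 : graph #|S|) (H2 : graph #|~: S|) : graph n :=
  graph_of_rel [rel x y |
    [exists i, exists j, [&& enum_val i == x, enum_val j == y & adj H1 i j]]
    || [exists i, exists j, [&& enum_val i == x, enum_val j == y & adj H2 i j]]].

Lemma glue_adjP (H1 : graph #|S|) (H2 : graph #|~: S|) x y :
  reflect ((exists i j, [/\ x = enum_val i, y = enum_val j & adj H1 i j]) \/
           (exists i j, [/\ x = enum_val i, y = enum_val j & adj H2 i j]))
    (adj (glue H1 H2) x y).
Proof.
have E (T : {set 'I_n}) (H : graph #|T|) a b : reflect
    (exists i j, [/\ a = enum_val i, b = enum_val j & adj H i j])
    [exists i, exists j, [&& enum_val i == a, enum_val j == b & adj H i j]].
  apply: (iffP existsP) => [[i /existsP[j /and3P[/eqP <- /eqP <- ij]]]|[i [j [-> -> ij]]]].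
    by exists i, j.
  by exists i; apply/existsP; exists j; rewrite !eqxx.
have sy (T : {set 'I_n}) (H : graph #|T|) a b :
   (exists i j, [/\ a = enum_val i, b = enum_val j & adj H i j]) ->
   exists i j, [/\ b = enum_val i, a = enum_val j & adj H i j].
  by move=> [i [j [? ? ?]]]; exists j, i; split=> //; rewrite adj_sym.
rewrite adj_graph_of_rel /=; apply: (iffP andP) => [[_ /orP[]/orP[]/E]|].
- by left.
- by right.
- by move/sy; left.
- by move/sy; right.
move=> h; split; last by case: h => /E -> //=; rewrite orbT.
by case: h => [[i [j [-> -> ij]]]|[i [j [-> -> ij]]]]; rewrite (inj_eq enum_val_inj);
  apply: adj_neq ij.
Qed.

Lemma splits_glue H1 H2 : splits (glue H1 H2) S.
Proof.
apply/splitsP => x y /glue_adjP[] [i [j [-> -> _]]]; rewrite /= ?enum_valP //.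
by have := enum_valP i; have := enum_valP j; rewrite !inE => /negbTE -> /negbTE ->.
Qed.

Lemma enum_valC (i : 'I_#|S|) (j : 'I_#|~: S|) : enum_val i = enum_val j -> False.
Proof. by move=> E; have := enum_valP j; rewrite -E inE enum_valP. Qed.

Lemma induced_glue1 H1 H2 : induced (glue H1 H2) S = H1.
Proof.
apply: graph_eqP => u v; rewrite adj_induced; apply/glue_adjP/idP => [|uv].
  case=> -[i [j [hu hv]]]; first by rewrite (enum_val_inj hu) (enum_val_inj hv).
  by case: (enum_valC hu).
by left; exists u, v.
Qed.

Lemma induced_glue2 H1 H2 : induced (glue H1 H2) (~: S) = H2.
Proof.
apply: graph_eqP => u v; rewrite adj_induced; apply/glue_adjP/idP => [|uv].
  case=> -[i [j [hu hv]]]; last by rewrite (enum_val_inj hu) (enum_val_inj hv).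
  by case: (enum_valC (esym hu)).
by right; exists u, v.
Qed.

Lemma glue_induced G : splits G S -> glue (induced G S) (induced G (~: S)) = G.
Proof.
move=> /splitsP cl; apply: graph_eqP => x y; apply/glue_adjP/idP => [|xy].
  by case=> -[i [j [-> ->]]]; rewrite adj_induced.
have xyS := cl _ _ xy; have [xS|xS] := boolP (x \in S).
  have yS : y \in S by rewrite -xyS.
  left; exists (enum_rank_in xS x), (enum_rank_in yS y).
  by rewrite adj_induced !enum_rankK_in.
have xS' : x \in ~: S by rewrite inE.
have yS' : y \in ~: S by rewrite inE -xyS.
right; exists (enum_rank_in xS' x), (enum_rank_in yS' y).
by rewrite adj_induced !enum_rankK_in.
Qed.

Lemma sum_splits (R : realType) (lam nu : R) (P : {set graph #|S|}) (Q : {set graph #|~: S|}) :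
  (\sum_(G : graph n | [&& splits G S, induced G S \in P & induced G (~: S) \in Q])
     weight lam nu G = class_weight lam nu P * class_weight lam nu Q)%R.
Proof.
rewrite /class_weight big_distrlr /= pair_big /=.
rewrite (reindex_onto (fun p => glue p.1 p.2) (fun G => (induced G S, induced G (~: S)))) /=.
  apply: eq_big => [[H1 H2]|[H1 H2] _] /=.
    by rewrite splits_glue induced_glue1 induced_glue2 eqxx andbT.
  by rewrite (weight_splits _ _ (splits_glue H1 H2)) induced_glue1 induced_glue2.
by move=> G /and3P[/glue_induced].
Qed.

End Product.

(** * Edges joining two components *)

Section Edges.
Variable n : nat.
Implicit Types (G H : graph n) (u v w : 'I_n).

Lemma adj_add_edge G u v x y : u != v ->
  adj (add_edge G u v) x y =
    [|| adj G x y, (x == u) && (y == v) | (x == v) && (y == u)].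
Proof.
move=> uv; rewrite adj_graph_of_rel /= (adj_sym G y x).
have [->|xy] := eqVneq x y; last first.
  by case: (adj G x y); rewrite //= [(y == u) && _]andbC.
rewrite adj_irr /=; symmetry; apply/negbTE; rewrite negb_or !negb_and.
by have [->|] := eqVneq y u; rewrite ?uv ?orbT.
Qed.

Definition del_edge G u v : graph n :=
  graph_of_rel [rel x y | adj G x y && ~~ ((x == u) && (y == v) || (x == v) && (y == u))].

Lemma adj_del_edge G u v x y :
  adj (del_edge G u v) x y = adj G x y && ~~ ((x == u) && (y == v) || (x == v) && (y == u)).
Proof.
rewrite adj_graph_of_rel /= (adj_sym G y x).
have [->|xy] := eqVneq x y; first by rewrite adj_irr.
by rewrite /= orbC ![(y == _) && _]andbC [X in adj G x y && ~~ X]orbC orbb.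
Qed.

Lemma add_edgeK G u v : ~~ connect (adj G) u v -> del_edge (add_edge G u v) u v = G.
Proof.
move=> nuv; have uv : u != v by apply: contraNneq nuv => ->; apply: connect0.
have nadj : adj G u v = false by apply: contraNF nuv; apply: connect1.
apply: graph_eqP => x y; rewrite adj_del_edge adj_add_edge //.
case: (boolP ((x == u) && (y == v) || _)) => [/orP[]/andP[/eqP-> /eqP->]|]; rewrite ?andbF ?andbT //.
- by rewrite adj_sym nadj.
by rewrite orbF.
Qed.

Lemma del_edgeK G u v : adj G u v -> add_edge (del_edge G u v) u v = G.
Proof.
move=> auv; apply: graph_eqP => x y; rewrite adj_add_edge ?(adj_neq auv) // adj_del_edge.
case: (boolP ((x == u) && (y == v))) => [/andP[/eqP-> /eqP->]|_] /=; first by rewrite auv orbT.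
case: (boolP ((x == v) && (y == u))) => [/andP[/eqP-> /eqP->]|_] /=.
  by rewrite adj_sym auv orbT.
by rewrite andbT orbF.
Qed.

Lemma add_edge_sub G u v : subrel (adj G) (adj (add_edge G u v)).
Proof. by move=> x y xy; rewrite adj_graph_of_rel /= xy andbT (adj_neq xy). Qed.

Lemma del_edge_sub G u v : subrel (adj (del_edge G u v)) (adj G).
Proof. by move=> x y; rewrite adj_del_edge => /andP[]. Qed.

Lemma num_edges_add_edge G u v : ~~ connect (adj G) u v ->
  num_edges (add_edge G u v) = (num_edges G).+1.
Proof.
move=> nuv; have uv : u != v by apply: contraNneq nuv => ->; apply: connect0.
have nadj : adj G u v = false by apply: contraNF nuv; apply: connect1.
apply: double_inj; rewrite -card_arcs doubleS -card_arcs.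
have -> : arcs (add_edge G u v) = (u, v) |: ((v, u) |: arcs G).
  apply/setP => -[x y]; rewrite !inE /= adj_add_edge // !xpair_eqE.
  by case: (adj G x y); rewrite ?orbT ?orbF.
by rewrite !cardsU1 !inE /= xpair_eqE eq_sym (eq_sym v) (negbTE uv) nadj adj_sym nadj.
Qed.

Lemma num_components_add_edge G u v : ~~ connect (adj G) u v ->
  num_components G = (num_components (add_edge G u v)).+1.
Proof.
move=> nuv; have uv : u != v by apply: contraNneq nuv => ->; apply: connect0.
set G' := add_edge G u v; pose a := closure (adj G) (pred2 u v).
have cG := connectC G; have cG' := connectC G'.
have cla : closed (adj G) a by exact: closure_closed.
have aP x : (x \in a) = connect (adj G) u x || connect (adj G) v x.
  apply/idP/orP => [|h].
    move=> /pred0Pn[y /= /andP[]]; rewrite inE cG.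
    by move=> xy /pred2P[] E; rewrite -E; [left | right].
  apply/pred0Pn; case: h => h; [exists u|exists v];
    by rewrite /= !inE eqxx ?orbT andbT cG.
have ua : u \in a by rewrite aP connect0.
have va : v \in a by rewrite aP connect0 orbT.
have cla' : closed (adj G') a.
  move=> x y; rewrite adj_add_edge // => /or3P[/cla //|/andP[/eqP-> /eqP->]|/andP[/eqP-> /eqP->]];
  by rewrite ?ua ?va.
have sub : subrel (connect (adj G)) (connect (adj G')).
  by apply: connect_sub => x y xy; apply: connect1; apply: add_edge_sub.
have cuv : connect (adj G') u v by apply: connect1; rewrite adj_add_edge // !eqxx orbT.
rewrite !num_components_n_comp (n_compC a) (n_compC a (adj G')) n_comp_closure2 // nuv.
have -> : n_comp (adj G') a = 1.
  rewrite -(n_comp_connect cG' u); apply: eq_n_comp_r => x; rewrite aP.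
  apply/orP/idP => [[h|h]|h]; first exact: sub.
    by apply: connect_trans cuv _; apply: sub.
  by apply/orP; rewrite -aP -(closed_connect cla' h).
rewrite add1n; congr _.+2.
have [cA cA'] := (predC_closed cla, predC_closed cla').
rewrite (@adjunction_n_comp _ _ id (adj G) (adj G') cG cG' _ cA) //.
apply: strict_adjunction => //.
  by apply/fintype.subsetP => x _; apply/codomP; exists x.
move=> x y; rewrite /= negbK => xa; rewrite adj_add_edge //.
have -> : x == u = false by apply: contraNF xa => /eqP ->.
have -> : x == v = false by apply: contraNF xa => /eqP ->.
by rewrite /= orbF.
Qed.

Lemma weight_add_edge (R : realType) (lam nu : R) G u v : ~~ connect (adj G) u v ->
  (nu * weight lam nu (add_edge G u v) = lam * weight lam nu G)%R.
Proof.
move=> nuv; rewrite /weight num_edges_add_edge // [in RHS](num_components_add_edge nuv).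
by rewrite !exprS mulrCA -!mulrA mulrCA.
Qed.

End Edges.

Section Bridges.
Variable n : nat.
Implicit Types (G H : graph n) (u v w : 'I_n).

Definition bridge G u v : bool :=
  adj G u v && ~~ connect (adj (del_edge G u v)) u v.

Lemma connect_mono (e e' : rel 'I_n) : subrel e e' -> subrel (connect e) (connect e').
Proof. by move=> s; apply: connect_sub => x y xy; apply: connect1; apply: s. Qed.

Lemma bridge_add_edge G u v : ~~ connect (adj G) u v -> bridge (add_edge G u v) u v.
Proof.
move=> nuv; rewrite /bridge add_edgeK // nuv andbT adj_add_edge ?eqxx ?orbT //.
by apply: contraNneq nuv => ->; apply: connect0.
Qed.

(* Deleting a bridge creates a component and spoils no other bridge. *)
Lemma card_bridges G :
  (#|[set p : 'I_n * 'I_n | bridge G p.1 p.2]| + (num_components G).*2 <= n.*2)%N.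
Proof.
have [m] := ubnP #|arcs G|; elim: m G => // m IH G ltm.
set B := [set p | _].
have [->|[[u v] uvB]] := set_0Vmem B.
  rewrite cards0 add0n leq_double -[n in (_ <= n)%N]card_ord.
  by apply: leq_trans (leq_imset_card _ _) _; rewrite cardT.
have buv : bridge G u v by move: uvB; rewrite inE.
have [auv nuv] := andP buv.
set G' := del_edge G u v.
have GE : add_edge G' u v = G by exact: del_edgeK.
have kE := num_components_add_edge nuv; rewrite -/G' GE in kE.
have eE := num_edges_add_edge nuv; rewrite -/G' GE in eE.
pose B' := [set p : 'I_n * 'I_n | bridge G' p.1 p.2].
have {IH} IH : (#|B'| + (num_components G').*2 <= n.*2)%N.
  by apply: IH; move: ltm; rewrite !card_arcs eE; lia.
have sub : B \subset (u, v) |: ((v, u) |: B').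
  apply/fintype.subsetP => -[x y]; rewrite !inE /= !xpair_eqE => /andP[axy nxy].
  have [//|/norP[n1 n2]] := boolP ((x == u) && (y == v) || (x == v) && (y == u)).
    by case/orP => ->; rewrite ?orbT.
  apply/orP; right; apply/orP; right; apply/andP; split.
    by rewrite adj_del_edge axy negb_or n1 n2.
  apply: contra nxy; apply: connect_mono => a b; rewrite !adj_del_edge.
  by case/andP=> /andP[-> _] ->.
move: (subset_leq_card sub) IH; rewrite !cardsU1 kE.
by case: (_ \notin _); case: (_ \notin _); rewrite ?doubleS; lia.
Qed.

Lemma sum_bridge (R : realType) (lam nu : R) (P : pred (graph n)) u v :
  (nu * (\sum_(G | bridge G u v && P (del_edge G u v)) weight lam nu G)
   = lam * (\sum_(G | ~~ connect (adj G) u v && P G) weight lam nu G))%R.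
Proof.
rewrite !mulr_sumr (reindex_onto (fun G => add_edge G u v) (fun G => del_edge G u v)) /=.
  apply: eq_big => [G|G]; last first.
    case/andP=> /andP[/andP[_ nuv] _] /eqP E; rewrite weight_add_edge //.
    by rewrite -E.
  apply/idP/idP => [/andP[/andP[/andP[_ nuv] PG] /eqP E]|/andP[nuv PG]].
    by rewrite E in nuv PG; rewrite nuv.
  by rewrite add_edgeK // bridge_add_edge // PG eqxx.
by move=> G /andP[/andP[auv _] _]; apply: del_edgeK.
Qed.

End Bridges.

Section BigComponent.
Variables (n : nat) (G : graph n).

Lemma big_componentP : (0 < n)%N ->
  (exists u, big_component G = component G u) /\
  forall u, (#|component G u| <= #|big_component G|)%N.
Proof.
move=> n0; pose x0 := Ordinal n0.
have c0 : component G x0 \in components G by apply: imset_f.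
case: (arg_maxnP (fun C : {set 'I_n} => #|C|) c0) => C1 C1c' C1max.
have C1c : C1 \in components G by [].
have C1P : (C1 \in components G) && (#|C1| == #|C1|) by rewrite C1c eqxx.
case: (@Order.TotalTheory.arg_minP _ (seqlexi nat) _ C1
   (fun C => (C \in components G) && (#|C| == #|C1|)) (@vertex_seq n) C1P).
move=> C2 /andP[C2c /eqP C2E] C2min.
rewrite /big_component; case: pickP => [C /andP[Cc /forallP CP]|/(_ C2)/negP[]] /=; last first.
  rewrite C2c; apply/forallP => C'; apply/implyP => C'c.
  have : (#|C'| <= #|C1|)%N by exact: C1max _ C'c.
  rewrite C2E leq_eqVlt => /orP[E|->] //.
  by rewrite E C2min ?orbT // C'c E.
split; first by case/imsetP: Cc => u _ ->; exists u.
move=> u; have uc : component G u \in components G by apply: imset_f.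
by have /implyP/(_ uc)/orP := CP (component G u); case=> [/ltnW//|/andP[/eqP->]].
Qed.

Lemma big_component_unique u :
  (forall v, ~~ connect (adj G) u v -> (#|component G v| < #|component G u|)%N) ->
  big_component G = component G u.
Proof.
move=> h; have n0 : (0 < n)%N by apply: leq_ltn_trans (ltn_ord u).
have [[v E] max] := big_componentP n0; rewrite E.
case: (boolP (connect (adj G) u v)) => [/eq_component -> //|/h].
by have := max u; rewrite E leqNgt => /negbTE ->.
Qed.

Lemma splits_big_component : splits G (big_component G).
Proof.
have [n0|n0] := posnP n; last first.
  by have [[u ->] _] := big_componentP n0; apply: splits_component.
by apply/splitsP => x; have := ltn_ord x; rewrite {2}n0.
Qed.

Definition num_cross : nat := #|[set p : 'I_n * 'I_n | ~~ connect (adj G) p.1 p.2]|.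

Lemma frag_le_cross : (n * #|~: big_component G| <= num_cross.*2)%N.
Proof.
have [n0|n0] := posnP n; first by rewrite {1}n0.
have [[w E] max] := big_componentP n0.
have -> : num_cross = (\sum_u (n - #|component G u|))%N.
  rewrite /num_cross -[LHS]sum1_card.
  rewrite (eq_bigl (fun p : 'I_n * 'I_n => true && ~~ connect (adj G) p.1 p.2)); last first.
    by move=> p; rewrite inE.
  rewrite -(pair_big_dep xpredT (fun u v => ~~ connect (adj G) u v) (fun _ _ => 1)) /=.
  apply: eq_bigr => u _; rewrite sum1_card -[n in (n - _)%N]card_ord.
  by rewrite -(cardC (mem (component G u))) addKn; apply: eq_card => v; rewrite !inE.
rewrite mulnC -sum_nat_const -mul2n big_distrr /= [leqRHS](bigID (mem (~: big_component G))) /=.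
apply: leq_trans (leq_addr _ _); apply: leq_sum => u; rewrite inE => ub.
have dis : [disjoint component G u & big_component G].
  rewrite E; apply/pred0P => x /=; apply/negbTE; rewrite !inE; apply: contra ub.
  by case/andP=> ux wx; rewrite E inE (connect_trans wx) // connectC.
have le2 : (#|component G u| + #|big_component G| <= n)%N.
  rewrite -[leqRHS]card_ord -cardsUI (disjoint_setI0 dis) cards0 addn0; exact: max_card.
have := max u; move: le2.
by case: #|component G u| => [|a] ; case: #|big_component G| => [|b]; lia.
Qed.

End BigComponent.

Section FragMean.
Variables (R : realType) (lam nu : R) (A : graph_class).
Hypotheses (lam0 : (0 < lam)%R) (nu0 : (0 < nu)%R).
Hypotheses (mA : minor_closed A) (bA : bridge_addable A).
Local Open Scope ring_scope.

Lemma hom_embeds_id m (G H : graph m) : subrel (adj G) (adj H) -> hom_embeds G H id.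
Proof. by move=> s; split. Qed.

Lemma del_edge_in n (G : graph n) u v : G \in A n -> del_edge G u v \in A n.
Proof.
by move=> GA; apply: (hom_embeds_in mA (hom_embeds_id (@del_edge_sub n G u v)) GA).
Qed.

Lemma bridge_in n (G : graph n) u v :
  bridge G u v -> (del_edge G u v \in A n) = (G \in A n).
Proof.
move=> /andP[auv nuv]; apply/idP/idP; last exact: del_edge_in.
by move=> /bA/(_ nuv); rewrite del_edgeK.
Qed.

Lemma mean_cross n :
  lam * \sum_(G in A n) weight lam nu G * (num_cross G)%:R
  <= nu * \sum_(G in A n) weight lam nu G * n.*2%:R.
Proof.
have cardE (Q : graph n -> pred ('I_n * 'I_n)) :
  \sum_(G in A n) weight lam nu G * #|[set p | Q G p]|%:R
  = \sum_(p : 'I_n * 'I_n) \sum_(G in A n | Q G p) weight lam nu G.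
  rewrite (exchange_big_dep (mem (A n))) /=; last by move=> p G _ /andP[].
  apply: eq_bigr => G GA.
  rewrite -sum1_card natr_sum mulr_sumr; apply: eq_big => p; rewrite inE ?GA ?mulr1 //.
apply: (@le_trans _ _ (nu * \sum_(G in A n) weight lam nu G * #|[set p | bridge G p.1 p.2]|%:R)).
  rewrite (cardE (fun G p => ~~ connect (adj G) p.1 p.2)) (cardE (fun G p => bridge G p.1 p.2)).
  rewrite !mulr_sumr le_eqVlt; apply/orP; left; apply/eqP; apply: eq_bigr => -[u v] _ /=.
  have E := sum_bridge lam nu (fun G => G \in A n) u v.
  rewrite (eq_bigl (fun G => ~~ connect (adj G) u v && (G \in A n))) => [|G]; last by rewrite andbC.
  rewrite -E; congr (_ * _)%R; apply: eq_bigl => G.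
  by case: (boolP (bridge G u v)) => b; rewrite ?andbF //= andbT bridge_in.
rewrite ler_pM2l //; apply: ler_sum => G GA; apply: ler_wpM2l; first exact/ltW/weight_gt0.
by rewrite ler_nat; apply: leq_trans (card_bridges G); apply: leq_addr.
Qed.

Lemma mean_frag n :
  lam * \sum_(G in A n) weight lam nu G * #|~: big_component G|%:R
  <= 4 * nu * class_weight lam nu (A n).
Proof.
have [n0|n0] := posnP n.
  rewrite big1 ?mulr0 => [|G _].
    rewrite !mulr_ge0 ?(ltW nu0) //; apply: sumr_ge0 => G _; exact/ltW/weight_gt0.
  have : (#|~: big_component G| <= n)%N by rewrite -[leqRHS]card_ord max_card.
  by move=> h; have := leq_trans h (eq_leq n0); rewrite leqn0 => /eqP ->; rewrite mulr0.
have nR : (0 : R) < n%:R by rewrite ltr0n.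
rewrite -(ler_pM2l nR).
have := mean_cross n; rewrite -mulr_suml -mul2n natrM => h.
have : lam * \sum_(G in A n) weight lam nu G * (n%:R * #|~: big_component G|%:R)
   <= 2 * (lam * \sum_(G in A n) weight lam nu G * (num_cross G)%:R).
  rewrite mulrCA ler_pM2l // mulr_sumr; apply: ler_sum => G _.
rewrite [leRHS]mulrCA ler_pM2l ?weight_gt0 // -!natrM ler_nat.
  by rewrite mul2n frag_le_cross.
rewrite (eq_bigr (fun G => n%:R * (weight lam nu G * #|~: big_component G|%:R))); last first.
  by move=> G _; rewrite mulrCA.
rewrite -mulr_sumr mulrCA => /le_trans; apply.
have := h; rewrite -/(class_weight lam nu (A n)); set s := \sum_(_ in _) _; set a := class_weight _ _ _.
move=> {}h; apply: le_trans (ler_wpM2l _ h) _; first by [].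
by rewrite le_eqVlt; apply/orP; left; apply/eqP; rewrite !mulrA; ring.
Qed.

End FragMean.

(** * Freely addable graphs *)

Definition edgeless n : graph n := graph_of_rel [rel _ _ | false].

Lemma adj_edgeless n u v : adj (edgeless n) u v = false.
Proof. by rewrite adj_graph_of_rel andbF. Qed.

Lemma edgelessP n (G : graph n) : (forall u v, adj G u v = false) -> G = edgeless n.
Proof. by move=> h; apply: graph_eqP => u v; rewrite h adj_edgeless. Qed.

Lemma connect_edgeless n u v : connect (adj (edgeless n)) u v = (u == v).
Proof.
apply/idP/eqP => [/connectP[[|w p] /=]|-> //]; first by move=> _ ->.
by rewrite adj_edgeless.
Qed.

Lemma num_components_edgeless n : num_components (edgeless n) = n.
Proof.
have cE u : component (edgeless n) u = [set u].
  by apply/setP => v; rewrite !inE connect_edgeless eq_sym.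
rewrite /num_components /components card_imset ?card_ord // => u v.
by rewrite !cE => /setP/(_ v); rewrite !inE eqxx => /eqP.
Qed.

Lemma weight_edgeless (R : realType) (lam nu : R) n :
  weight lam nu (edgeless n) = (nu ^+ n)%R.
Proof.
rewrite /weight num_components_edgeless; have -> : num_edges (edgeless n) = 0.
  by apply: eq_card0 => p; rewrite inE adj_edgeless andbF.
by rewrite expr0 mul1r.
Qed.

Lemma hom_embeds_splits n (G : graph n) S : splits G S ->
  exists f, hom_embeds G (disjoint_union (induced G (~: S)) (induced G S)) f.
Proof.
move=> /splitsP cl; pose U := disjoint_union (induced G (~: S)) (induced G S).
have gP := hom_embeds_union (hom_embeds_induced G (~: S)) (hom_embeds_induced G S).
have {gP} [inj _] := gP (fun u v => introN eqP (fun E => enum_valC (esym E))).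
set g := fun x => _ in inj.
have cardE : #|'I_n| = #|'I_(#|~: S| + #|S|)|.
  by rewrite !card_ord addnC cardsC card_ord.
have [h gK hK] : bijective g by apply: inj_card_bij inj _; rewrite -cardE.
exists h; split; first exact: can_inj hK.
suff E x y : adj G (g x) (g y) -> adj U x y.
  by move=> u v uv; apply: E; rewrite !hK.
have [ll rr lr rl] := adj_disjoint_union (induced G (~: S)) (induced G S).
rewrite /U -(splitK x) -(splitK y) /g !unsplitK.
case: (fintype.split x) => a; case: (fintype.split y) => b ab; rewrite /unsplit.
- by rewrite ll adj_induced.
- by have := cl _ _ ab; rewrite /= enum_valP; have := enum_valP a; rewrite inE => /negbTE ->.
- by have := cl _ _ ab; rewrite /= enum_valP; have := enum_valP b; rewrite inE => /negbTE ->.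
- by rewrite rr adj_induced.
Qed.

Section Free.
Variable A : graph_class.
Hypotheses (mA : minor_closed A) (dA : dichotomous A).
Hypothesis (A_nonempty : forall n, exists G : graph n, G \in A n).

Lemma freely_addable_embeds m n (H : graph m) (K : graph n) f :
  hom_embeds H K f -> freely_addable A K -> freely_addable A H.
Proof.
move=> HK fK k G GA; apply: (hom_embeds_in mA _ (fK _ _ GA)).
apply: (hom_embeds_union (hom_embeds_lshift G K) (hom_embeds_comp HK (hom_embeds_rshift G K))).
by move=> u v; rewrite eq_lrshift.
Qed.

Lemma freely_addable_union m n (H : graph m) (K : graph n) :
  freely_addable A H -> freely_addable A K -> freely_addable A (disjoint_union H K).
Proof.
move=> fH fK k G GA; apply: (hom_embeds_in mA _ (fK _ _ (fH _ _ GA))).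
have e1 := hom_embeds_comp (hom_embeds_lshift G H) (hom_embeds_lshift (disjoint_union G H) K).
have e2 := hom_embeds_comp (hom_embeds_rshift G H) (hom_embeds_lshift (disjoint_union G H) K).
have e3 := hom_embeds_rshift (disjoint_union G H) K.
have e4 := hom_embeds_union e2 e3 (fun u v => negbT (eq_lrshift _ _)).
apply: (hom_embeds_union e1 e4) => u v /=.
by case: (fintype.split v) => x; rewrite ?eq_lrshift // (inj_eq (@lshift_inj _ _)) eq_lrshift.
Qed.

Lemma freely_addable_splits n (G : graph n) S : splits G S ->
  freely_addable A (induced G S) -> freely_addable A (induced G (~: S)) ->
  freely_addable A G.
Proof.
move=> /hom_embeds_splits[f fE] f1 f2; apply: freely_addable_embeds fE _.
exact: freely_addable_union.
Qed.

Lemma freely_addable_splits_in n (G : graph n) S : splits G S ->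
  freely_addable A (induced G S) -> induced G (~: S) \in A #|~: S| -> G \in A n.
Proof. by move=> /hom_embeds_splits[f fE] f1 /f1; apply: hom_embeds_in fE. Qed.

Lemma freely_addable1 (H : graph 1) : freely_addable A H.
Proof.
have H0 u v : adj H u v = false by rewrite !ord1 adj_irr.
have [G GA] := A_nonempty 1.
have HA : H \in A 1.
  by apply: (@hom_embeds_in A _ _ H G id mA _ GA); split=> // u v; rewrite H0.
have [//|[k [_]]] := dA HA.
have [K KA] := A_nonempty (k * 1); case/negP.
apply: (@hom_embeds_in A _ _ _ K id mA _ KA); split=> // u v.
suff -> : adj (copies k H) u v = false by [].
elim: k {KA K} u v => [[] //|k IH] u v.
have [ll rr lr rl] := adj_disjoint_union H (copies k H).
rewrite -[u](@splitK 1 (k * 1)) -[v](@splitK 1 (k * 1)).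
by case: (fintype.split u) => a; case: (fintype.split v) => b; rewrite /unsplit ?ll ?rr ?lr ?rl ?H0 ?IH.
Qed.

Lemma freely_addable_edgeless n : freely_addable A (edgeless n).
Proof.
elim: n => [|n IH].
  move=> m G GA; apply: (@hom_embeds_in A _ _ _ G (cast_ord (addn0 m)) mA _ GA).
  split=> [|u v]; first exact: cast_ord_inj.
  have [ll _ _ _] := adj_disjoint_union G (edgeless 0).
  rewrite -[u](@splitK m 0) -[v](@splitK m 0).
  case: (fintype.split u) => [a|[] //]; case: (fintype.split v) => [b|[] //].
  rewrite /unsplit ll; congr adj; exact: val_inj.
have := freely_addable_union (@freely_addable1 (edgeless 1)) IH.
apply: (@freely_addable_embeds _ _ _ _ id); split=> // u v.
by rewrite adj_edgeless.
Qed.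

Lemma freely_addable_classP n (H : graph n) :
  reflect (freely_addable A H) (H \in freely_addable_class A n).
Proof. by rewrite inE; apply: boolp.asboolP. Qed.

End Free.

(** * Leaves of connected graphs *)

Section Leaves.
Variables (R : realType) (lam nu : R) (A : graph_class).
Hypotheses (lam0 : (0 < lam)%R) (nu0 : (0 < nu)%R).
Hypotheses (mA : minor_closed A) (bA : bridge_addable A) (dA : dichotomous A).
Hypothesis (A_nonempty : forall n, exists G : graph n, G \in A n).
Local Notation C := (connected_class A).
Local Open Scope ring_scope.

Definition leaf_at n (G : graph n) (p : 'I_n * 'I_n) : bool :=
  adj G p.1 p.2 && [forall x, adj G p.1 x ==> (x == p.2)].

Lemma leaf_atP n (G : graph n) v w :
  reflect (adj G v w /\ forall x, adj G v x -> x = w) (leaf_at G (v, w)).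
Proof.
apply: (iffP andP) => /= -[vw h]; split=> //.
  by move=> x vx; apply/eqP; have /forallP/(_ x)/implyP := h; apply.
by apply/forallP => x; apply/implyP => /h/eqP.
Qed.

Definition num_leaves n (G : graph n) : nat := #|[set p | leaf_at G p]|.

Lemma num_leaves_le n (G : graph n) : (num_leaves G <= n)%N.
Proof.
rewrite -[leqRHS]card_ord /num_leaves.
rewrite -(@card_in_imset _ _ fst (mem [set p | leaf_at G p]%SET)); first exact: max_card.
move=> [v w] [v' w']; rewrite !inE => /leaf_atP[vw h] /leaf_atP[vw' _] /= E.
by rewrite -E in vw' *; rewrite (h _ vw').
Qed.

Definition isolated_over n (W : {set 'I_n}) (G : graph n) : bool :=
  [&& splits G W, induced G W \in [set edgeless #|W|]%SET & induced G (~: W) \in C #|~: W|].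

Lemma sum_isolated_over n (W : {set 'I_n}) :
  \sum_(G | isolated_over W G) weight lam nu G
  = nu ^+ #|W| * class_weight lam nu (C (n - #|W|)%N).
Proof.
rewrite sum_splits; have -> : #|~: W| = (n - #|W|)%N.
  by apply: (canRL (addKn #|W|)); rewrite cardsC card_ord.
by rewrite /class_weight big_set1 weight_edgeless.
Qed.

Lemma isolated_overP n (W : {set 'I_n}) (G : graph n) :
  (forall v x, v \in W -> adj G v x = false) ->
  isolated_over W G = (G \in A n) && (num_components G == #|W|.+1).
Proof.
move=> iso.
have spl : splits G W.
  apply/splitsP => x y xy; have [xW|xW] := boolP (x \in W); first by rewrite iso in xy.
  by have [yW|//] := boolP (y \in W); rewrite adj_sym iso in xy.
have E : induced G W = edgeless #|W|.
  by apply: edgelessP => u v; rewrite adj_induced iso // enum_valP.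
rewrite /isolated_over spl E inE eqxx /= inE; congr (_ && _).
  apply/idP/idP => [h|]; last exact: hom_embeds_in (hom_embeds_induced _ _).
  apply: (freely_addable_splits_in mA spl _ h); rewrite E.
  exact: freely_addable_edgeless.
by rewrite (num_componentsU spl) E num_components_edgeless -addn1 eqn_add2l.
Qed.

Lemma isolatedP n (W : {set 'I_n}) (G : graph n) v x :
  isolated_over W G -> v \in W -> adj G v x = false.
Proof.
move=> /and3P[/splitsP cl /set1P E _] vW; apply/negbTE/negP => vx.
have xW : x \in W by rewrite -(cl _ _ vx).
have := adj_edgeless (enum_rank_in vW v) (enum_rank_in vW x).
by rewrite -E adj_induced !enum_rankK_in // vx.
Qed.

Lemma leaf_bridge n (G : graph n) v w :
  leaf_at G (v, w) = bridge G v w && [forall x, ~~ adj (del_edge G v w) v x].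
Proof.
apply/leaf_atP/andP => [[vw h]|[/andP[vw nvw] /forallP h]].
  have iso x : ~~ adj (del_edge G v w) v x.
    by rewrite adj_del_edge; apply/negP => /andP[/h->]; rewrite !eqxx.
  split; last exact/forallP.
  rewrite /bridge vw /=; apply/negP => /connectP[[|x p] /= ].
    by move=> _ E; rewrite E adj_irr in vw.
  by rewrite (negbTE (iso x)).
split=> // x vx; apply/eqP; have := h x; rewrite adj_del_edge vx /= negbK eqxx /=.
by case/orP => // /andP[/eqP E _]; rewrite E adj_irr in vw.
Qed.

Lemma bridge_components n (G : graph n) v w : bridge G v w ->
  num_components (del_edge G v w) = (num_components G).+1.
Proof. by case/andP=> vw /num_components_add_edge ->; rewrite del_edgeK. Qed.

Lemma leaf_connected n (G : graph n) v w :
  (G \in C n) && leaf_at G (v, w) = bridge G v w && isolated_over [set v]%SET (del_edge G v w).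
Proof.
rewrite leaf_bridge [LHS]andbCA; case: (boolP (bridge G v w)) => //= b.
case: (boolP [forall x, _]) => [/forallP h|/forallPn[x]]; last first.
  rewrite negbK andbF => vx; symmetry; apply/negbTE/negP => /isolatedP.
  by move=> /(_ v x); rewrite vx inE eqxx => /(_ isT).
rewrite andbT isolated_overP => [|u x]; last by rewrite inE => /eqP ->; apply/negbTE.
by rewrite inE bridge_in // bridge_components // cards1 eqSS.
Qed.

Lemma sum_leaf_at n v w : v != w ->
  \sum_(G in C n | leaf_at G (v, w)) weight lam nu G
  = lam * class_weight lam nu (C n.-1).
Proof.
move=> vw; apply: (mulfI (lt0r_neq0 nu0)).
rewrite (eq_bigl _ _ (fun G => leaf_connected G v w)) sum_bridge mulrCA; congr (_ * _).
rewrite (eq_bigl (isolated_over [set v]%SET)); first by rewrite sum_isolated_over cards1 expr1 subn1.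
move=> G; case: (boolP (isolated_over _ _)) => [h|]; rewrite ?andbF // andbT.
apply/negP => /connectP[[|x p] /=]; first by move=> _ E; rewrite E eqxx in vw.
by rewrite (isolatedP x h) // inE eqxx.
Qed.

Lemma class_weight_ge0 n (B : {set graph n}) : 0 <= class_weight lam nu B.
Proof. by apply: sumr_ge0 => G _; apply/ltW/weight_gt0. Qed.

Lemma ler_sum_sub (I : finType) (P Q : pred I) (F : I -> R) :
  (forall i, P i -> Q i) -> (forall i, Q i -> 0 <= F i) ->
  \sum_(i | P i) F i <= \sum_(i | Q i) F i.
Proof.
move=> PQ F0; rewrite [leLHS]big_mkcond [leRHS]big_mkcond /=; apply: ler_sum => i _.
by case: (boolP (P i)) => [/PQ ->//|_]; case: ifP => // /F0.
Qed.

(* Delete the two leaf edges in turn. *)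
Lemma sum_leaf_at2 n v w v' w' : v' != v -> v' != w -> w' != v ->
  \sum_(G in C n | leaf_at G (v, w) && leaf_at G (v', w')) weight lam nu G
  <= lam ^+ 2 * class_weight lam nu (C n.-2).
Proof.
move=> v'v v'w w'v; have w0 (G : graph n) : 0 <= weight lam nu G by apply/ltW/weight_gt0.
pose P2 := isolated_over [set v'; v]%SET.
pose P1 H := bridge H v' w' && P2 (del_edge H v' w').
have step1 : \sum_(G in C n | leaf_at G (v, w) && leaf_at G (v', w')) weight lam nu G
    <= \sum_(G | bridge G v w && P1 (del_edge G v w)) weight lam nu G.
  apply: ler_sum_sub => [G|//] /and3P[GC l l'].
  have [GA cG] : G \in A n /\ Defs.connected G by move: GC; rewrite inE => /andP[].
  move: (l); rewrite leaf_bridge => /andP[b /forallP iso]; rewrite b /=.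
  have lH : leaf_at (del_edge G v w) (v', w').
    have [a h] := leaf_atP _ _ _ l'; apply/leaf_atP; split=> [|x]; last first.
      by move/del_edge_sub/h.
    by rewrite adj_del_edge a (negbTE v'v) (negbTE v'w).
  move: lH; rewrite leaf_bridge => /andP[b' /forallP iso']; rewrite /P1 b' /= /P2.
  rewrite isolated_overP => [|u x].
    rewrite !del_edge_in //= !bridge_components // (eqP cG) cards2 v'v //.
  rewrite !inE => /orP[]/eqP ->; apply/negbTE => //.
  by apply: contra (iso x) => /del_edge_sub.
have nu2 : 0 < nu ^+ 2 by rewrite exprn_gt0.
apply: le_trans step1 _; rewrite -(ler_pM2l nu2) exprS expr1 -mulrA sum_bridge.
apply: (@le_trans _ _ (lam * (nu * \sum_(H | P1 H) weight lam nu H))).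
  rewrite mulrCA !ler_pM2l //; apply: ler_sum_sub => // G /andP[] //.
rewrite sum_bridge [leRHS]mulrCA -mulrA ler_pM2l //.
rewrite [leRHS](_ : _ = lam * (nu ^+ 2 * class_weight lam nu (C n.-2))); last first.
  by rewrite !exprS !expr0; ring.
rewrite ler_pM2l //.
have -> : nu ^+ 2 * class_weight lam nu (C n.-2) = \sum_(G | P2 G) weight lam nu G.
  by rewrite sum_isolated_over cards2 v'v subn2.
by apply: ler_sum_sub => // G /andP[].
Qed.

Lemma card_neq_pairs n : #|[pred p : 'I_n * 'I_n | p.1 != p.2]| = (n * n.-1)%N.
Proof.
rewrite -sum1_card (eq_bigl (fun p : 'I_n * 'I_n => true && (p.1 != p.2))) //.
rewrite -(pair_big_dep xpredT (fun u v => u != v) (fun _ _ => 1%N)) /=.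
rewrite (eq_bigr (fun=> n.-1)) ?sum_nat_const ?card_ord // => u _.
rewrite sum1_card -[n in RHS]card_ord -(cardC1 u); apply: eq_card => x.
by rewrite !inE eq_sym.
Qed.

Lemma leaf_moment1 n :
  \sum_(G in C n) weight lam nu G * (num_leaves G)%:R
  = lam * (n * n.-1)%:R * class_weight lam nu (C n.-1).
Proof.
have -> : \sum_(G in C n) weight lam nu G * (num_leaves G)%:R
    = \sum_(p : 'I_n * 'I_n) \sum_(G in C n | leaf_at G p) weight lam nu G.
  rewrite (exchange_big_dep (mem (C n))) /=; last by move=> p G _ /andP[].
  apply: eq_bigr => G GA; rewrite /num_leaves.
  by rewrite -sum1_card natr_sum mulr_sumr; apply: eq_big => p; rewrite inE ?GA ?mulr1.
rewrite (bigID (fun p => p.1 != p.2)) /= [X in _ + X]big1 ?addr0; last first.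
  move=> [v w] /=; rewrite negbK => /eqP ->; apply: big1 => G /andP[_ /leaf_atP[]].
  by rewrite adj_irr.
rewrite (eq_bigr (fun=> lam * class_weight lam nu (C n.-1))); last first.
  by move=> [v w] /= vw; apply: sum_leaf_at.
rewrite sumr_const -mulr_natr card_neq_pairs; ring.
Qed.

Lemma leaf_pair_disconnected n (G : graph n) v w : (2 < n)%N ->
  leaf_at G (v, w) -> leaf_at G (w, v) -> ~~ Defs.connected G.
Proof.
move=> n2 /leaf_atP[vw hv] /leaf_atP[_ hw]; apply/negP => /connectedP[_ con].
have spl : splits G [set v; w]%SET.
  apply/splitsP; apply: (intro_closed (connectC G)) => x y xy.
  by rewrite !inE => /orP[]/eqP E; rewrite E in xy; rewrite ?(hv _ xy) ?(hw _ xy) eqxx ?orbT.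
have : [set: 'I_n]%SET \subset [set v; w]%SET.
  apply: subset_trans (component_sub spl (set21 v w)).
  by apply/fintype.subsetP => x _; rewrite inE.
move/subset_leq_card; rewrite cardsT card_ord cards2; case: (_ != _); lia.
Qed.

Definition apart n (p q : 'I_n * 'I_n) : bool :=
  [&& p.1 != p.2, q.1 \notin [set p.1; p.2]%SET & q.2 \notin [set p.1; q.1]%SET].

Lemma leaves_apart n (G : graph n) p q : (2 < n)%N -> Defs.connected G ->
  leaf_at G p -> leaf_at G q -> p != q -> apart p q.
Proof.
case: p q => [v w] [v' w'] n2 cG l l' pq; have [vw h] := leaf_atP _ _ _ l.
have [vw' h'] := leaf_atP _ _ _ l'.
have vv' : v' != v.
  apply: contraNneq pq => E; subst v'; by rewrite (h _ vw').
rewrite /apart /= !inE !negb_or (adj_neq vw) vv' [w' == v']eq_sym (adj_neq vw') andbT /=.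
apply/andP; split; apply: contraTneq cG => E; subst.
  have E : v = w' by apply: h'; rewrite adj_sym.
  by subst; apply: leaf_pair_disconnected l l'.
have E : v' = w by apply: h; rewrite adj_sym.
by subst; apply: leaf_pair_disconnected l l'.
Qed.

Lemma card_apart n (p : 'I_n * 'I_n) : (2 <= n)%N ->
  #|[pred q | apart p q]| = ((p.1 != p.2) * (n - 2) ^ 2)%N.
Proof.
move=> n2; have [E|pn] := eqVneq p.1 p.2.
  by rewrite mul0n; apply: eq_card0 => q; rewrite !inE /apart E eqxx.
have cC (a b : 'I_n) : a != b -> #|[pred x | x \notin [set a; b]%SET]| = (n - 2)%N.
  move=> ab; have := cardsC [set a; b]%SET; rewrite cards2 ab card_ord => E.
  apply: (canRL (addKn 2)); rewrite -[RHS]E; congr addn.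
  by apply: eq_card => x; rewrite !inE.
rewrite mul1n -sum1_card.
rewrite (eq_bigl (fun q : 'I_n * 'I_n => (q.1 \notin [set p.1; p.2]%SET) && (q.2 \notin [set p.1; q.1]%SET))); last first.
  by move=> q; rewrite inE /apart pn.
rewrite -(pair_big_dep (fun a => a \notin [set p.1; p.2]%SET) (fun a b => b \notin [set p.1; a]%SET) (fun _ _ => 1%N)) /=.
rewrite (eq_bigr (fun=> (n - 2)%N)) => [|a]; first by rewrite sum_nat_const (cC _ _ pn).
move=> apn; rewrite sum1_card; apply: cC; move: apn.
by rewrite !inE negb_or eq_sym => /andP[].
Qed.

Lemma leaf_moment2 n : (2 < n)%N ->
  \sum_(G in C n) weight lam nu G * (num_leaves G)%:R ^+ 2
  <= lam * (n * n.-1)%:R * class_weight lam nu (C n.-1)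
     + lam ^+ 2 * (n * n.-1 * (n - 2) ^ 2)%:R * class_weight lam nu (C n.-2).
Proof.
move=> n2; have w0 (G : graph n) : 0 <= weight lam nu G by apply/ltW/weight_gt0.
have sumE (G : graph n) : (num_leaves G)%:R =
   \sum_(p : 'I_n * 'I_n | leaf_at G p) (1 : R).
  by rewrite /num_leaves cardsE -sum1_card natr_sum.
pose T p q := \sum_(G in C n | leaf_at G p && leaf_at G q) weight lam nu G.
have -> : \sum_(G in C n) weight lam nu G * (num_leaves G)%:R ^+ 2 = \sum_p \sum_q T p q.
  rewrite (eq_bigr (fun G => \sum_p \sum_(q | leaf_at G p && leaf_at G q) weight lam nu G)); last first.
    move=> G _; rewrite expr2 {1}sumE mulr_suml mulr_sumr [LHS]big_mkcond; apply: eq_bigr => p _.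
    case: ifP => lp; last by rewrite big_pred0.
    by rewrite mul1r sumE mulr_sumr; apply: eq_bigr => q _; rewrite mulr1.
  rewrite exchange_big; apply: eq_bigr => p _ /=.
  rewrite (exchange_big_dep xpredT) //=; apply: eq_bigr => q _.
set c1 := class_weight _ _ (C n.-1); set c2 := class_weight _ _ (C n.-2).
have bound p q : T p q <= (p == q)%:R * T p p + (apart p q)%:R * (lam ^+ 2 * c2).
  have c20 : 0 <= lam ^+ 2 * c2 by apply: mulr_ge0; [exact/exprn_ge0/ltW | exact: class_weight_ge0].
  have [<-|pq] := eqVneq p q; first by rewrite mul1r lerDl mulr_ge0.
  rewrite mul0r add0r; have [ap|nap] := boolP (apart p q).
    rewrite mul1r; case: p q ap {pq} => [v w] [v' w'].
    rewrite /apart /= !inE !negb_or => /and3P[_ /andP[? ?] /andP[? _]].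
    exact: sum_leaf_at2.
  rewrite mul0r /T big1 // => G /and3P[GC lp lq].
  case/negP: nap; apply: leaves_apart lp lq pq => //.
  by move: GC; rewrite inE => /andP[].
apply: (@le_trans _ _ (\sum_p \sum_q ((p == q)%:R * T p p + (apart p q)%:R * (lam ^+ 2 * c2)))).
  by apply: ler_sum => p _; apply: ler_sum => q _.
rewrite le_eqVlt; apply/orP; left; apply/eqP.
rewrite (eq_bigr (fun p => T p p + (p.1 != p.2)%:R * ((n - 2) ^ 2)%:R * (lam ^+ 2 * c2))) => [|p _]; last first.
  rewrite big_split /= (bigD1 p) //= eqxx mul1r big1 ?addr0 => [|q]; last first.
    by rewrite eq_sym => /negbTE ->; rewrite mul0r.
  congr (_ + _); rewrite -mulr_suml; congr (_ * _).
  rewrite -natrM -card_apart ?(ltnW n2) // -natr_sum -sum1_card big_mkcond /=; congr (_%:R).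
  by rewrite [RHS]big_mkcond /=; apply: eq_bigr => q _; rewrite inE; case: apart.
rewrite big_split /=; congr (_ + _).
  rewrite -leaf_moment1 /T.
  rewrite (eq_bigr (fun p => \sum_(G in C n | leaf_at G p) weight lam nu G)); last first.
    by move=> p _; apply: eq_bigl => G; rewrite andbb.
  rewrite (exchange_big_dep (mem (C n))) /=; last by move=> p G _ /andP[].
  apply: eq_bigr => G GA; rewrite sumE mulr_sumr.
  by apply: eq_big => p; rewrite ?GA ?mulr1.
rewrite -!mulr_suml -natr_sum.
have -> : (\sum_(p : 'I_n * 'I_n) (p.1 != p.2) = n * n.-1)%N.
  rewrite -card_neq_pairs -sum1_card big_mkcond [RHS]big_mkcond /=.
  by apply: eq_bigr => p _; rewrite inE; case: (_ != _).
by rewrite [(n * n.-1 * _)%:R]natrM; ring.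
Qed.

End Leaves.

(** * The law of the fragment *)

Definition same_graph m k (G : graph m) (H : graph k) : bool :=
  (Tagged graph G : lgraph) == Tagged graph H.

Lemma same_graph_tag m k (G : graph m) (H : graph k) : same_graph G H -> m = k.
Proof. by move/eqP/(congr1 tag). Qed.

Lemma same_graphE m (G H : graph m) : same_graph G H = (G == H).
Proof. by rewrite /same_graph eq_Tagged. Qed.

Section FragLaw.
Variables (R : realType) (lam nu : R) (A : graph_class).
Hypotheses (lam0 : (0 < lam)%R) (nu0 : (0 < nu)%R).
Hypotheses (mA : minor_closed A) (bA : bridge_addable A) (dA : dichotomous A).
Hypothesis (A_nonempty : forall n, exists G : graph n, G \in A n).
Local Notation C := (connected_class A).
Local Open Scope ring_scope.

Lemma class_weight_same m k (H : graph k) : m = k ->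
  class_weight lam nu [set H' : graph m | same_graph H' H]%SET = weight lam nu H.
Proof.
move=> E; case: k / E H => H; rewrite /class_weight (big_pred1 H) // => G.
by rewrite inE same_graphE.
Qed.

Lemma big_component_split n (G : graph n) (W : {set 'I_n}) : (#|W|.*2 < n)%N -> splits G W ->
  Defs.connected (induced G (~: W)) -> big_component G = ~: W.
Proof.
move=> Wn spl /connectedP[W0 con].
have splC : splits G (~: W) by rewrite splitsC.
pose i0 := Ordinal W0; pose u := enum_val i0.
have uW : u \in ~: W by apply: enum_valP.
have cE : component G u = ~: W.
  apply/eqP; rewrite finset.eqEsubset component_sub //=.
  apply/fintype.subsetP => x xW; rewrite inE -(enum_rankK_in xW xW).
  by rewrite -connect_induced.
have := cardsC W; rewrite card_ord => cn.
rewrite -cE; apply: big_component_unique => v nuv.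
have : v \notin component G u by rewrite inE.
rewrite cE inE negbK => vW; apply: (@leq_ltn_trans #|W|).
  exact/subset_leq_card/component_sub.
lia.
Qed.

Lemma connected_big n (G : graph n) : (0 < n)%N ->
  Defs.connected (induced G (big_component G)).
Proof.
move=> n0; have [[u E] _] := big_componentP G n0.
apply/connectedP; split.
  by apply/card_gt0P; exists u; rewrite E component_refl.
move=> i j; rewrite connect_induced ?splits_big_component //.
have := enum_valP i; have := enum_valP j; rewrite {2 4}E !inE => uj ui.
by apply: connect_trans uj; rewrite connectC.
Qed.

Definition frag_split n k (H : graph k) (W : {set 'I_n}) (G : graph n) : bool :=
  [&& splits G W, induced G W \in [set H' : graph #|W| | same_graph H' H]%SET
    & induced G (~: W) \in C #|~: W|].

Lemma frag_split_in n k (H : graph k) (W : {set 'I_n}) (G : graph n) :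
  freely_addable A H -> frag_split H W G -> G \in A n.
Proof.
move=> fH /and3P[spl]; rewrite !inE => /eqP E /andP[GA _].
apply: (freely_addable_splits_in mA spl _ GA).
by rewrite -[freely_addable _ _]/((fun L : lgraph => freely_addable A (tagged L)) (Tagged graph (induced G W))) E.
Qed.

Lemma sum_frag_split n k (H : graph k) :
  \sum_(W : {set 'I_n} | #|W| == k) \sum_(G | frag_split H W G) weight lam nu G
  = 'C(n, k)%:R * weight lam nu H * class_weight lam nu (C (n - k)%N).
Proof.
rewrite (eq_bigr (fun=> weight lam nu H * class_weight lam nu (C (n - k)%N))) => [|W /eqP Wk].
  rewrite (eq_bigl (fun W => W \in [set W : {set 'I_n} | #|W| == k]%SET)) => [|W]; last by rewrite inE.
  by rewrite sumr_const card_draws card_ord -[LHS]mulr_natl mulrA.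
rewrite sum_splits class_weight_same //.
suff -> : #|~: W| = (n - k)%N by [].
by apply: (canRL (addKn k)); rewrite -Wk cardsC card_ord.
Qed.

Lemma frag_splitP n k (H : graph k) (W : {set 'I_n}) (G : graph n) : (k.*2 < n)%N -> #|W| = k ->
  (G \in A n) && frag_split H W G = [&& G \in A n, same_graph (frag G) H & ~: big_component G == W].
Proof.
move=> kn Wk; case: (boolP (G \in A n)) => //= GA.
have n0 : (0 < n)%N by apply: leq_ltn_trans kn.
apply/idP/andP => [/and3P[spl]|[sf /eqP E]].
  rewrite !inE => sH /andP[_ cW].
  have bE : big_component G = ~: W by apply: big_component_split; rewrite ?Wk.
  by split; rewrite /frag bE setCK.
rewrite /frag_split -E splitsC splits_big_component /= inE; apply/andP; split=> //.
rewrite setCK inE connected_big // andbT.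
exact: (hom_embeds_in mA (hom_embeds_induced _ _) GA).
Qed.

Lemma sum_fragE n k (H : graph k) : (k.*2 < n)%N ->
  \sum_(G in A n | same_graph (frag G) H) weight lam nu G
  = \sum_(W : {set 'I_n} | #|W| == k) \sum_(G in A n | frag_split H W G) weight lam nu G.
Proof.
move=> kn; rewrite (partition_big (fun G => ~: big_component G) (fun W => #|W| == k)) /=; last first.
  by move=> G /andP[_ /same_graph_tag/eqP].
apply: eq_bigr => W /eqP Wk; apply: eq_bigl => G.
by rewrite frag_splitP // andbA.
Qed.

Lemma sum_frag_le n k (H : graph k) : (k.*2 < n)%N ->
  \sum_(G in A n | same_graph (frag G) H) weight lam nu G
  <= 'C(n, k)%:R * weight lam nu H * class_weight lam nu (C (n - k)%N).
Proof.
move=> kn; rewrite sum_fragE // -sum_frag_split; apply: ler_sum => W _.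
by apply: ler_sum_sub => [G /andP[]//|G _]; apply/ltW/weight_gt0.
Qed.

Lemma sum_frag_free n k (H : graph k) : (k.*2 < n)%N -> freely_addable A H ->
  \sum_(G in A n | same_graph (frag G) H) weight lam nu G
  = 'C(n, k)%:R * weight lam nu H * class_weight lam nu (C (n - k)%N).
Proof.
move=> kn fH; rewrite sum_fragE // -sum_frag_split; apply: eq_bigr => W _.
apply: eq_bigl => G; case: (boolP (frag_split H W G)) => [h|]; rewrite ?andbF //.
by rewrite (frag_split_in fH h).
Qed.

Lemma frag_in n k (H : graph k) (G : graph n) :
  G \in A n -> same_graph (frag G) H -> H \in A k.
Proof.
move=> GA /eqP E.
have : frag G \in A _ by apply: (hom_embeds_in mA (hom_embeds_induced _ _) GA).
by rewrite -[_ \in _]/((fun L : lgraph => tagged L \in A (tag L)) (Tagged graph (frag G))) E.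
Qed.

End FragLaw.

(** * Fragments that are not freely addable *)

Lemma connect_exit (T : finType) (e : rel T) x y (S : {set T}) :
  connect e x y -> x \in S -> y \notin S ->
  exists p q, [/\ e p q, p \in S, q \notin S, connect e x p & connect e x q].
Proof.
move=> /connectP[s es ->]; elim: s x es => [|z s IH] x /=; first by move=> _ ->.
case/andP=> xz es xS lS; have [zS|zS] := boolP (z \in S); last first.
  by exists x, z; rewrite connect0 connect1.
have [p [q [pq pS qS zp zq]]] := IH z es zS lS.
by exists p, q; split=> //; apply: connect_trans (connect1 xz) _.
Qed.

Section Limited.
Variable n : nat.
Implicit Types (G : graph n) (a b : 'I_n).

Lemma crossing_edge G a b x y : ~~ connect (adj G) a b ->
  adj (add_edge G a b) x y -> x \in component G a -> y \notin component G a ->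
  x = a /\ y = b.
Proof.
move=> nab; have ab : a != b by apply: contraNneq nab => ->; apply: connect0.
rewrite adj_add_edge // => /or3P[xy|/andP[/eqP-> /eqP->] //|/andP[/eqP-> _]].
  have /splitsP cl := splits_component G a.
  by move=> xa; rewrite -(cl _ _ xy) xa.
by rewrite inE (negbTE nab).
Qed.

(* A connected set that meets the component of a1 without being contained in it
   has to use the edge a1 b1, the only one leaving that component. *)
Lemma pendant_disjoint G1 G2 a1 a2 b1 b2 x :
  add_edge G1 a1 b1 = add_edge G2 a2 b2 ->
  ~~ connect (adj G1) a1 b1 -> ~~ connect (adj G2) a2 b2 ->
  #|component G1 a1| = #|component G2 a2| ->
  (#|component G2 a2| < #|component G1 b1|)%N ->
  x \in component G1 a1 -> x \in component G2 a2 ->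
  G1 = G2 /\ b1 = b2.
Proof.
move=> E n1 n2 cE lt x1 x2.
set V1 := component G1 a1 in cE x1 *; set V2 := component G2 a2 in cE lt x2 *.
have a1V : a1 \in V1 by apply: component_refl.
have a2V : a2 \in V2 by apply: component_refl.
have b1V : b1 \notin V1 by rewrite inE.
have b2V : b2 \notin V2 by rewrite inE.
have ab1 : a1 != b1 by apply: contraNneq n1 => ->; apply: connect0.
have adj1 : adj (add_edge G1 a1 b1) a1 b1 by rewrite adj_add_edge // !eqxx orbT.
have [s21|/fintype.subsetPn[y y2 y1]] := boolP (V2 \subset V1).
  have VE : V2 = V1 by apply/eqP; rewrite finset.eqEcard s21 cE /=.
  have [aE bE] : a1 = a2 /\ b1 = b2.
    by apply: (crossing_edge n2); rewrite -?E // -/V2 VE.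
  split=> //; rewrite -(add_edgeK n1) E; by rewrite aE bE add_edgeK.
have [z z1 z2] : exists2 z, z \in V1 & z \notin V2.
  apply/fintype.subsetPn/negP => s12.
  have VE : V1 = V2 by apply/eqP; rewrite finset.eqEcard s12 cE /=.
  by rewrite VE y2 in y1.
have inV G a u v : u \in component G a -> v \in component G a -> connect (adj G) u v.
  by rewrite !inE => au av; apply: connect_trans av; rewrite connectC.
have [a12 b12] : a1 \in V2 /\ b1 \in V2.
  have [p [q [pq p1 q1 xp xq]]] := connect_exit (inV _ _ _ _ x2 y2) x1 y1.
  have [pE qE] : p = a1 /\ q = b1.
    by apply: (crossing_edge n1) => //; rewrite E; apply: add_edge_sub.
  have tr u : connect (adj G2) x u -> u \in V2.
    by rewrite !inE in x2 *; apply: connect_trans.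
  by rewrite -pE -qE; split; apply: tr.
have a21 : a2 \in V1.
  have [p [q [pq p2 q2 xp xq]]] := connect_exit (inV _ _ _ _ x1 z1) x2 z2.
  have [pE qE] : p = a2 /\ q = b2.
    by apply: (crossing_edge n2) => //; rewrite -E; apply: add_edge_sub.
  by rewrite -pE; rewrite !inE in x1 *; apply: connect_trans x1 _.
have [y' yB yV] : exists2 y, y \in component G1 b1 & y \notin V2.
  by apply/fintype.subsetPn/negP => /subset_leq_card; rewrite leqNgt lt.
have [p [q [pq p2 q2 bp bq]]] := connect_exit (inV _ _ _ _ (component_refl G1 b1) yB) b12 yV.
have [pE _] : p = a2 /\ q = b2.
  by apply: (crossing_edge n2) => //; rewrite -E; apply: add_edge_sub.
case/negP: n1; apply: (connect_trans (y := a2)); first by rewrite inE in a21.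
by rewrite -pE connectC.
Qed.

Lemma copies_embed h (K : graph h) (G : graph n) k (fs : nat -> 'I_h -> 'I_n) :
  (forall i, (i < k)%N -> hom_embeds K G (fs i)) ->
  (forall i j u v, (i < j < k)%N -> fs i u != fs j v) ->
  exists g, hom_embeds (copies k K) G g /\
    forall x, exists i u, (i < k)%N /\ g x = fs i u.
Proof.
elim: k fs => [|k IH] fs hom dis.
  by exists (fun x : 'I_0 => False_rect _ (notF (ltn_ord x))); split=> [|[] //]; split=> -[].
have [g [gh gx]] := IH (fun i => fs i.+1) (fun i ik => hom i.+1 ik)
   (fun i j u v ij => dis i.+1 j.+1 u v ij).
exists (fun x => match fintype.split x with inl u => fs 0 u | inr v => g v end); split.
  apply: hom_embeds_union (hom 0 _) gh _ => // u v.
  by have [i [w [ik ->]]] := gx v; apply: dis.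
move=> x; case: (fintype.split x) => u; first by exists 0, u.
by have [i [w [ik ->]]] := gx u; exists i.+1, w.
Qed.

End Limited.

Lemma hom_embeds_into_induced m n (K : graph m) (G : graph n) (T : {set 'I_n}) f :
  hom_embeds K G f -> (forall x, f x \in T) -> exists g, hom_embeds K (induced G T) g.
Proof.
move=> [inj hom] fT; pose g x := enum_rank_in (fT x) (f x).
have gE x : enum_val (g x) = f x by rewrite enum_rankK_in.
exists g; split=> [x y /(congr1 enum_val)|x y xy]; first by rewrite !gE => /inj.
by rewrite adj_induced !gE hom.
Qed.

Definition frag_copy n k (H : graph k) (G : graph n) (f : 'I_k -> 'I_n) : Prop :=
  [/\ injective f, forall u, f u \notin big_component G,
      forall x, x \notin big_component G -> exists u, x = f u
    & forall u v, adj G (f u) (f v) = adj H u v].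

Lemma frag_copy_exists n k (H : graph k) (G : graph n) :
  same_graph (frag G) H -> exists f, frag_copy H G f.
Proof.
move=> /eqP E; pose P (L : lgraph) := exists f, frag_copy (tagged L) G f.
rewrite -/(P (Tagged graph H)) -E /P /=; exists enum_val; split.
- exact: enum_val_inj.
- by move=> u; have := enum_valP u; rewrite inE.
- move=> x xb; have xC : x \in ~: big_component G by rewrite inE.
  by exists (enum_rank_in xC x); rewrite enum_rankK_in.
- by move=> u v; rewrite adj_induced.
Qed.

Lemma component_frag_copy n k (H : graph k) (G : graph n) f u : frag_copy H G f ->
  component G (f u) = f @: component H u.
Proof.
move=> [inj nbig onto adjE].
have spl := splits_big_component G; rewrite -splitsC in spl.
have /splitsP cl := spl.
have fC v : f v \in ~: big_component G by rewrite inE.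
have radj : rel_adjunction f (adj G) (adj H) (mem (~: big_component G)).
  apply: strict_adjunction => //; first exact: connectC.
  by apply/fintype.subsetP => x; rewrite inE => /onto[v ->]; apply: codom_f.
apply/setP => x; apply/idP/imsetP => [|[v]].
  move=> ux; have := component_sub spl (fC u) => /fintype.subsetP/(_ x ux).
  rewrite inE => /onto[v E]; exists v => //; rewrite E !inE in ux *.
  by rewrite (rel_functor radj).
by rewrite !inE => uv ->; rewrite -(rel_functor radj).
Qed.

Section LimitedFrag.
Variables (R : realType) (lam nu : R) (A : graph_class).
Hypotheses (lam0 : (0 < lam)%R) (nu0 : (0 < nu)%R).
Hypotheses (mA : minor_closed A) (bA : bridge_addable A) (dA : dichotomous A).
Hypothesis (A_nonempty : forall n, exists G : graph n, G \in A n).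

Lemma nonfree_component k (H : graph k) : ~ freely_addable A H ->
  exists u, ~ freely_addable A (induced H (component H u)).
Proof.
move=> nf; pose P W := splits H W && ~~ boolp.asbool (freely_addable A (induced H W)).
have PT : P [set: 'I_k].
  apply/andP; split; first by apply/splitsP => x y _; rewrite !inE.
  apply/boolp.asboolPn => fT; apply: nf.
  have [g gP] := hom_embeds_into_induced (hom_embeds_id (G := H) (H := H) (fun _ _ h => h)) (in_setT (T := 'I_k)).
  exact: (freely_addable_embeds mA gP fT).
have [W] := minset_exists PT; rewrite -/P => /minsetP[/andP[spl /boolp.asboolPn nW] min] _.
have [W0|[u uW]] := set_0Vmem W.
  case: nW; rewrite (edgelessP (G := induced H W)) => [|x y].
    exact: freely_addable_edgeless.
  by have := enum_valP x; rewrite {2}W0 inE.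
exists u => fu; case: nW.
set T := component H u in fu; have splT : splits H T by apply: splits_component.
have /splitsP clW := spl; have /splitsP clT := splT.
have splD : splits H (W :\: T).
  apply/splitsP => x y xy; rewrite /= !in_setD.
  have -> : (x \in W) = (y \in W) by exact: clW xy.
  by have -> : (x \in T) = (y \in T) by exact: clT xy.
have fD : freely_addable A (induced H (W :\: T)).
  apply: boolp.contrapT => nD; have := min (W :\: T).
  rewrite /P splD /= subsetDl => /(_ _ isT) E.
  have : u \in W :\: T by rewrite E //; apply/boolp.asboolPn.
  by rewrite inE component_refl.
pose S := [set i : 'I_#|W| | enum_val i \in T].
have emb (U : {set 'I_#|W|}) := hom_embeds_comp (hom_embeds_induced (induced H W) U) (hom_embeds_induced H W).
have splS : splits (induced H W) S.
  apply/splitsP => i j; rewrite adj_induced => /clT; rewrite /S /= => E.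
  by rewrite [LHS]in_set [RHS]in_set.
apply: (freely_addable_splits mA splS).
  have [|g gP] := hom_embeds_into_induced (T := T) (emb S).
    by move=> x /=; have := enum_valP x; rewrite /S in_set.
  exact: (freely_addable_embeds mA gP).
have [|g gP] := hom_embeds_into_induced (T := W :\: T) (emb (~: S)).
  by move=> x /=; have := enum_valP x; rewrite in_setC in_set in_setD => ->; apply: enum_valP.
exact: (freely_addable_embeds mA gP).
Qed.

Local Open Scope ring_scope.

(* The copies of K made pendant in the same graph are disjoint, so there are fewer
   than M of them if M disjoint copies of K are not in A. *)
Lemma limited_frag k (H : graph k) : ~ freely_addable A H ->
  exists M : nat, forall n, (k.*2 < n)%N ->
    lam * (n - k)%:R * (\sum_(G in A n | same_graph (frag G) H) weight lam nu G)
    <= nu * M%:R * class_weight lam nu (A n).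
Proof.
move=> nf; have [HA|HA] := boolP (H \in A k); last first.
  exists 0%N => n kn; rewrite big_pred0 ?mulr0 ?mul0r // => G.
  by apply/negP => /andP[GA /(frag_in mA GA)]; apply/negP.
have [u0 nK] := nonfree_component nf; set W := component H u0 in nK.
set K := induced H W in nK.
have KA : K \in A #|W| by apply: (hom_embeds_in mA (hom_embeds_induced _ _) HA).
have [//|[M [M0 MA]]] := dA KA.
exists M => n kn; have n0 : (0 < n)%N by apply: leq_ltn_trans kn.
have [|f fP] := boolp.choice (P := fun (G : graph n) f => same_graph (frag G) H -> frag_copy H G f).
  move=> G; have [/frag_copy_exists[f fP]|_] := boolP (same_graph (frag G) H); first by exists f.
  by exists (fun=> Ordinal n0).
pose phi (p : graph n * 'I_n) := add_edge p.1 (f p.1 u0) p.2.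
pose Q (p : graph n * 'I_n) :=
  [&& p.1 \in A n, same_graph (frag p.1) H & p.2 \in big_component p.1].
have ncon p : Q p -> ~~ connect (adj p.1) (f p.1 u0) p.2.
  move=> /and3P[_ /fP[_ nb _ _] b2]; apply: contra (nb u0) => con.
  by have /splitsP cl := splits_big_component p.1; rewrite (closed_connect cl con).
have phiA p : Q p -> phi p \in A n.
  by move=> Qp; apply: bA (ncon _ Qp); case/and3P: Qp.
have fiber G' : (#|[set p | Q p && (phi p == G')]| <= M)%N.
  rewrite leqNgt; apply/negP => /ltnW le; set s := enum [set p | Q p && (phi p == G')].
  pose d := (G', Ordinal n0).
  have sP i : (i < M)%N -> Q (nth d s i) /\ phi (nth d s i) = G'.
    move=> iM; have : nth d s i \in s by apply: mem_nth; rewrite -cardE (leq_trans iM).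
    by rewrite mem_enum inE => /andP[? /eqP].
  pose fs i (x : 'I_#|W|) := f (nth d s i).1 (enum_val x).
  have hom i : (i < M)%N -> hom_embeds K G' (fs i).
    move=> /sP[/and3P[_ /fP[inj _ _ adjE] _] <-]; split.
      by move=> x y /inj/enum_val_inj.
    by move=> x y; rewrite adj_induced => xy; apply: add_edge_sub; rewrite adjE.
  have comp i x : (i < M)%N -> fs i x \in component (nth d s i).1 (f (nth d s i).1 u0).
    move=> /sP[/and3P[_ /fP cp _] _]; rewrite (component_frag_copy _ cp).
    by apply: imset_f; apply: enum_valP.
  have cardc i : (i < M)%N -> #|component (nth d s i).1 (f (nth d s i).1 u0)| = #|W|.
    move=> /sP[/and3P[_ /fP cp _] _]; rewrite (component_frag_copy _ cp).
    by rewrite card_imset //; case: cp.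
  have [|g [gP _]] := copies_embed hom.
    move=> i j x y /andP[ij jM]; have iM := ltn_trans ij jM; apply/eqP => E.
    have [[Qi phii] [Qj phij]] := (sP _ iM, sP _ jM).
    have cx := comp i x iM; have cy := comp j y jM; rewrite -E in cy.
    have EE : phi (nth d s i) = phi (nth d s j) by rewrite phii.
    have [||G12 b12] := pendant_disjoint EE (ncon _ Qi) (ncon _ Qj) _ _ cx cy.
    - by rewrite !cardc.
    - rewrite cardc //; case/and3P: Qi => _ /same_graph_tag sk bi.
      have [[w bE] _] := big_componentP (nth d s i).1 n0.
      have -> : component (nth d s i).1 (nth d s i).2 = big_component (nth d s i).1.
        by rewrite bE in bi *; apply/esym/eq_component; rewrite inE in bi.
      have := cardsC (big_component (nth d s i).1); rewrite sk card_ord => cn.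
      have Wk : (#|W| <= k)%N by rewrite -[leqRHS]card_ord max_card.
      by move: kn Wk cn; lia.
    have : nth d s i = nth d s j by case: (nth d s i) G12 b12 => ? ? /= -> ->; case: (nth d s j).
    move/eqP; rewrite nth_uniq ?enum_uniq -?cardE ?(leq_trans iM) ?(leq_trans jM) //.
    by rewrite (ltn_eqF ij).
  case/negP: MA; apply: (hom_embeds_in mA gP).
  by have [Q0 <-] := sP 0%N M0; apply: phiA.
rewrite -mulrA; have -> : (n - k)%:R * \sum_(G in A n | same_graph (frag G) H) weight lam nu G
    = \sum_(p | Q p) weight lam nu p.1 :> R.
  rewrite mulr_sumr (eq_bigl (fun p => (p.1 \in A n) && same_graph (frag p.1) H && (p.2 \in big_component p.1))).
    rewrite -(pair_big_dep (fun G => (G \in A n) && same_graph (frag G) H)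
      (fun G b => b \in big_component G) (fun G _ => weight lam nu G)) /=.
    apply: eq_bigr => G /andP[_ /same_graph_tag sk]; rewrite sumr_const -[RHS]mulr_natl.
    congr (_%:R * _); have := cardsC (big_component G); rewrite sk card_ord => cn.
    by apply/esym/(canRL (addnK k)).
  by move=> p; rewrite /Q andbA.
rewrite mulr_sumr.
rewrite (eq_bigr (fun p => nu * weight lam nu (phi p))) => [|p /ncon np]; last first.
  by rewrite weight_add_edge.
rewrite -mulr_sumr -mulrA ler_pM2l // (partition_big phi (mem (A n))) //=.
rewrite /class_weight mulr_sumr; apply: ler_sum => G' _.
rewrite (eq_bigr (fun=> weight lam nu G')) => [|p /andP[_ /eqP ->] //].
rewrite (eq_bigl (fun p => p \in [set p | Q p && (phi p == G')])) => [|p]; last by rewrite inE.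
rewrite sumr_const -[leLHS]mulr_natl; apply: ler_wpM2r; last by rewrite ler_nat.
exact/ltW/weight_gt0.
Qed.

End LimitedFrag.

(** * Rooted decomposition and relabelling *)

Lemma component_splitP n (G : graph n) v (W : {set 'I_n}) : v \in W ->
  (component G v == W) = splits G W && Defs.connected (induced G W).
Proof.
move=> vW; apply/eqP/andP => [<-|[spl /connectedP[_ con]]].
  split; first exact: splits_component.
  apply/connectedP; split; first by apply/card_gt0P; exists v; apply: component_refl.
  move=> i j; rewrite connect_induced ?splits_component //.
  have := enum_valP i; have := enum_valP j; rewrite !inE => vj vi.
  by apply: connect_trans vj; rewrite connectC.
apply/eqP; rewrite finset.eqEsubset component_sub //=.
apply/fintype.subsetP => x xW; rewrite inE -(enum_rankK_in vW vW) -(enum_rankK_in vW xW).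
by rewrite -connect_induced.
Qed.

Lemma in_connected_class (B : graph_class) n (H : graph n) :
  (H \in connected_class B n) = (H \in B n) && Defs.connected H.
Proof. by rewrite in_set. Qed.

Section RootedDecomposition.
Variables (R : realType) (lam nu : R) (A : graph_class).
Hypotheses (mA : minor_closed A).
Local Notation F := (freely_addable_class A).
Local Notation D := (connected_class F).
Local Open Scope ring_scope.

Lemma rooted_decomposition n :
  n%:R * class_weight lam nu (F n)
  = \sum_(j < n.+1) (j * 'C(n, j))%:R * class_weight lam nu (D j) * class_weight lam nu (F (n - j)%N).
Proof.
have -> : n%:R * class_weight lam nu (F n)
    = \sum_(v : 'I_n) \sum_(W : {set 'I_n} | v \in W)
        \sum_(G in F n | component G v == W) weight lam nu G.
  rewrite -[n in n%:R]card_ord mulr_natl -sumr_const; apply: eq_big => // v _.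
  rewrite /class_weight (partition_big (fun G => component G v) (fun W => v \in W)) //.
  by move=> G _; apply: component_refl.
have body v (W : {set 'I_n}) : v \in W ->
    \sum_(G in F n | component G v == W) weight lam nu G
    = class_weight lam nu (D #|W|) * class_weight lam nu (F (n - #|W|)%N).
  move=> vW; have <- : #|~: W| = (n - #|W|)%N.
    by apply: (canRL (addKn #|W|)); rewrite cardsC card_ord.
  rewrite -sum_splits; apply: eq_bigl => G; rewrite (component_splitP G vW) in_connected_class.
  apply/andP/and3P => [[GF /andP[spl con]]|[spl /andP[WF con] CF]].
    have /freely_addable_classP GF' := GF; split=> //; rewrite ?con ?andbT.
      by apply/freely_addable_classP; apply: (freely_addable_embeds mA (hom_embeds_induced _ _) GF').
    by apply/freely_addable_classP; apply: (freely_addable_embeds mA (hom_embeds_induced _ _) GF').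
  split; last by rewrite spl.
  by apply/freely_addable_classP; apply: (freely_addable_splits mA spl); apply/freely_addable_classP.
transitivity (\sum_(W : {set 'I_n}) #|W|%:R * (class_weight lam nu (D #|W|) * class_weight lam nu (F (n - #|W|)%N))).
  rewrite (exchange_big_dep xpredT) //=; apply: eq_bigr => W _.
  rewrite (eq_bigr _ (fun v vW => body v W vW)) sumr_const -[LHS]mulr_natl.
  by congr (_ %:R * _); apply: eq_card => v.
have cardW (W : {set 'I_n}) : (#|W| < n.+1)%N by rewrite ltnS -[leqRHS]card_ord max_card.
rewrite (partition_big (fun W : {set 'I_n} => Ordinal (cardW W)) xpredT) //=.
apply: eq_bigr => j _.
rewrite (eq_bigr (fun=> j%:R * (class_weight lam nu (D j) * class_weight lam nu (F (n - j)%N)))) => [|W /eqP <- //].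
rewrite (eq_bigl (fun W => W \in [set W : {set 'I_n} | #|W| == j]%SET)) => [|W]; last by rewrite inE.
by rewrite sumr_const card_draws card_ord -[LHS]mulr_natl natrM; ring.
Qed.

End RootedDecomposition.

Section Isomorphism.
Variable k : nat.
Implicit Types (G H : graph k) (s t : 'S_k).

Definition relabel H s : graph k := graph_of_rel [rel u v | adj H (s u) (s v)].

Lemma adj_relabel H s u v : adj (relabel H s) u v = adj H (s u) (s v).
Proof.
rewrite adj_graph_of_rel /= (adj_sym H (s v)) orbb -(inj_eq (@perm_inj _ s)).
by case ij: adj; rewrite ?andbF // andbT; apply: adj_neq ij.
Qed.

Lemma isomorphic_relabel G H :
  reflect (isomorphic G H) (G \in [set relabel H s | s : 'S_k]).
Proof.
apply: (iffP imsetP) => [[s _ ->]|[f [[g fK gK] fE]]].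
  exists s; split; last by move=> u v; rewrite adj_relabel.
  by exists (s^-1)%g => x; rewrite ?permK ?permKV.
exists (perm (can_inj fK)) => //; apply: graph_eqP => u v.
by rewrite adj_relabel !permE fE.
Qed.

Lemma card_isomorphic H :
  (#|[set relabel H s | s : 'S_k]| * num_aut H = k`!)%N.
Proof.
have <- : (\sum_(s : 'S_k) 1 = k`!)%N by rewrite sum1_card card_Sn.
rewrite (partition_big (relabel H) (mem [set relabel H s | s : 'S_k])) /=; last first.
  by move=> s _; apply: imset_f.
rewrite -sum_nat_const; apply: eq_bigr => _ /imsetP[s0 _ ->].
rewrite sum1_card /num_aut -[LHS](card_imset _ (mulgI s0)); apply: eq_card => s.
rewrite [RHS](_ : _ = (relabel H s == relabel H s0)) //; apply/idP/idP => [/imsetP[t]|/eqP E].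
  rewrite inE => /forallP tA ->; apply/eqP; apply: graph_eqP => u v; rewrite !adj_relabel !permM.
  by have /forallP/(_ (s0 v))/eqP := tA (s0 u).
apply/imsetP; exists (s0^-1 * s)%g; last by rewrite mulKVg.
rewrite inE; apply/forallP => u; apply/forallP => v; rewrite !permM.
have := congr1 (fun G => adj G ((s0^-1)%g u) ((s0^-1)%g v)) E.
by rewrite !adj_relabel !permKV => ->.
Qed.

Lemma num_edges_iso G H : isomorphic G H -> num_edges G = num_edges H.
Proof.
move=> /isomorphic_relabel/imsetP[s _ ->]; apply: double_inj; rewrite -!card_arcs.
pose f (p : 'I_k * 'I_k) := (s p.1, s p.2).
have fi : injective f by move=> [? ?] [? ?] [/perm_inj -> /perm_inj ->].
rewrite -(card_imset _ fi); apply: eq_card => -[u v]; apply/imsetP/idP.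
  by case=> -[a b]; rewrite !inE /= adj_relabel => ab [-> ->].
rewrite inE /= => uv; exists ((s^-1)%g u, (s^-1)%g v); last by rewrite /f /= !permKV.
by rewrite inE /= adj_relabel !permKV.
Qed.

Lemma num_components_iso G H : isomorphic G H -> num_components G = num_components H.
Proof.
move=> /isomorphic_relabel/imsetP[s _ ->]; rewrite !num_components_n_comp; symmetry.
have cl : closed (adj H) 'I_k by [].
rewrite (@adjunction_n_comp _ _ s (adj H) (adj (relabel H s)) (connectC _) (connectC _) _ cl) //.
apply: strict_adjunction => //; [exact: connectC|exact: perm_inj|idtac|idtac].
  by apply/fintype.subsetP => x _; apply/codomP; exists ((s^-1)%g x); rewrite permKV.
by move=> u v _; rewrite adj_relabel.
Qed.

Lemma weight_iso (R : realType) (lam nu : R) G H : isomorphic G H ->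
  weight lam nu G = weight lam nu H.
Proof. by move=> GH; rewrite /weight (num_edges_iso GH) (num_components_iso GH). Qed.

End Isomorphism.

(** * Coefficients of the generating functions *)

Section Coefficients.
Variables (R : realType) (lam nu : R) (A : graph_class).
Hypotheses (lam0 : (0 < lam)%R) (nu0 : (0 < nu)%R).
Hypotheses (mA : minor_closed A) (bA : bridge_addable A) (dA : dichotomous A).
Hypothesis (A_nonempty : forall n, exists G : graph n, G \in A n).
Local Open Scope ring_scope.
Local Notation C := (connected_class A).
Local Notation F := (freely_addable_class A).
Local Notation a := (egf_coef lam nu A).
Local Notation c := (egf_coef lam nu C).

Lemma fact_neq0 n : n`!%:R != 0 :> R.
Proof. by rewrite pnatr_eq0 -lt0n fact_gt0. Qed.

Lemma fact_pos n : 0 < n`!%:R :> R.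
Proof. by rewrite ltr0n fact_gt0. Qed.

Lemma egf_coefK (B : graph_class) n :
  class_weight lam nu (B n) = n`!%:R * egf_coef lam nu B n.
Proof. by rewrite /egf_coef mulrC divfK ?fact_neq0. Qed.

Lemma egf_coef_ge0 (B : graph_class) n : 0 <= egf_coef lam nu B n.
Proof. by rewrite divr_ge0 ?class_weight_ge0 ?ler0n. Qed.

Lemma class_weight_gt0 n (B : {set graph n}) G : G \in B -> 0 < class_weight lam nu B.
Proof.
move=> GB; rewrite /class_weight (bigD1 G) //=; apply: ltr_wpDr; last exact: weight_gt0.
by apply: sumr_ge0 => H _; apply/ltW/weight_gt0.
Qed.

Lemma egf_coef_gt0 n : 0 < a n.
Proof.
by have [G GA] := A_nonempty n; rewrite divr_gt0 ?fact_pos // (class_weight_gt0 GA).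
Qed.

Lemma connected_coef_le n : c n <= a n.
Proof.
rewrite ler_pM2r ?invr_gt0 ?fact_pos //; apply: ler_sum_sub => [G|G _]; last exact/ltW/weight_gt0.
by rewrite in_connected_class => /andP[].
Qed.

Lemma connected_coef_step n : lam * n%:R * c n <= n.+1%:R * c n.+1.
Proof.
have := leaf_moment1 lam nu0 mA bA dA A_nonempty n.+1; rewrite /= => E.
have le : lam * (n.+1 * n)%:R * class_weight lam nu (C n) <= n.+1%:R * class_weight lam nu (C n.+1).
  rewrite -E /class_weight mulr_sumr; apply: ler_sum => G _.
  rewrite mulrC ler_wpM2r ?ler_nat ?num_leaves_le //; exact/ltW/weight_gt0.
move: le; rewrite !egf_coefK factS !natrM => le.
have p : 0 < n.+1%:R * n`!%:R :> R by rewrite mulr_gt0 ?fact_pos ?ltr0n.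
rewrite -(ler_pM2l p); move: le; congr (_ <= _); ring.
Qed.

Lemma connected_coef_gt0 n : 0 < c n.+1.
Proof.
elim: n => [|n IH].
  have [G GA] := A_nonempty 1; rewrite divr_gt0 ?fact_pos //; apply: (@class_weight_gt0 _ _ G).
  rewrite in_connected_class GA; apply/connectedP; split=> // u v.
  by rewrite !ord1 connect0.
have n2 : 0 < n.+2%:R :> R by rewrite ltr0n.
rewrite -(pmulr_rgt0 _ n2); apply: lt_le_trans (connected_coef_step n.+1).
by apply: mulr_gt0 => //; apply: mulr_gt0; rewrite ?ltr0n.
Qed.

Lemma connected_coef_pow m k : (lam / 2) ^+ k * c m.+1 <= c (m.+1 + k).
Proof.
elim: k => [|k IH]; first by rewrite mul1r addn0.
rewrite exprS -mulrA addnS; apply: (@le_trans _ _ (lam / 2 * c (m.+1 + k))).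
  by rewrite ler_pM2l // divr_gt0.
have := connected_coef_step (m.+1 + k); set x := c _; set y := c _.
have x0 : 0 < x by rewrite /x addSn connected_coef_gt0.
rewrite addSn -[(m + k).+2%:R]natr1 => h.
have m0 : 0 < (m + k).+1%:R :> R by rewrite ltr0n.
have m1 : 1 <= (m + k).+1%:R :> R by rewrite ler1n.
have y0 : 0 <= y by apply: egf_coef_ge0.
rewrite -(ler_pM2l m0); nra.
Qed.

Lemma cauchy_schwarz_sum (I : finType) (P : pred I) (w x : I -> R) :
  (forall i, P i -> 0 <= w i) ->
  (\sum_(i | P i) w i * x i) ^+ 2
  <= (\sum_(i | P i) w i) * (\sum_(i | P i) w i * x i ^+ 2).
Proof.
move=> w0; set W := \sum_(i | P i) w i; set M := \sum_(i | P i) w i * x i.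
have W0 : 0 <= W by apply: sumr_ge0.
have [WE|Wn] := eqVneq W 0.
  have wE i : P i -> w i = 0.
    exact: (psumr_eq0P w0 WE).
  by rewrite WE mul0r /M big1 ?expr0n // => i Pi; rewrite wE ?mul0r.
have : 0 <= \sum_(i | P i) w i * (W * x i - M) ^+ 2.
  by apply: sumr_ge0 => i Pi; rewrite mulr_ge0 ?w0 ?sqr_ge0.
rewrite (eq_bigr (fun i => W ^+ 2 * (w i * x i ^+ 2) - (2 * W * M) * (w i * x i) + M ^+ 2 * w i)); last first.
  by move=> i _; ring.
rewrite !big_split /= sumrN -!mulr_sumr -/M -/W.
have Wp : 0 < W by rewrite lt_def Wn.
move=> h; rewrite -subr_ge0 -(pmulr_rge0 _ Wp); move: h; congr (_ <= _); ring.
Qed.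

(* Cauchy-Schwarz for the number of leaves, after cancelling factorials. *)
Lemma connected_coef_log_concave n :
  lam * n.+2%:R ^+ 2 * c n.+2 ^+ 2
  <= c n.+3 * (n.+2%:R * c n.+2 + lam * n.+1%:R ^+ 2 * c n.+1).
Proof.
have w0 (G : graph n.+3) : G \in C n.+3 -> 0 <= weight lam nu G.
  by move=> _; apply/ltW/weight_gt0.
have := cauchy_schwarz_sum (fun G => (num_leaves G)%:R) w0.
rewrite (leaf_moment1 lam nu0 mA bA dA A_nonempty n.+3) /= => cs.
have m2 := leaf_moment2 lam0 nu0 mA bA dA A_nonempty (isT : (2 < n.+3)%N).
have := le_trans cs (ler_wpM2l _ m2) => /(_ (class_weight_ge0 lam0 nu0 _)) {cs m2}.
rewrite -/(class_weight lam nu (C n.+3)) /= !egf_coefK subSS subn1 /= !factS !natrM.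
set f := n`!%:R; set x1 := c n.+1; set x2 := c n.+2; set x3 := c n.+3.
have f0 : 0 < f :> R by apply: fact_pos.
set u1 : R := n.+1%:R; set u2 : R := n.+2%:R; set u3 : R := n.+3%:R => h.
have u1p : 0 < u1 by rewrite ltr0n.
have u2p : 0 < u2 by rewrite ltr0n.
have u3p : 0 < u3 by rewrite ltr0n.
have p : 0 < lam * (u3 * u2 * u1 * f) ^+ 2 by rewrite !(mulr_gt0, exprn_gt0).
rewrite -(ler_pM2l p); move: h; congr (_ <= _); ring.
Qed.

End Coefficients.

From mathcomp Require Import all_classical all_reals all_analysis.
From mathcomp Require Import measurable_realfun.
Import numFieldNormedType.Exports.

(** * Convergence of the ratios of coefficients *)

Section SlowVariation.
Variable R : realType.
Local Open Scope ring_scope.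

Lemma nat_above (x : R) : exists q : nat, x < q%:R.
Proof.
exists (Num.bound `|x|); apply: le_lt_trans (ler_norm x) _.
exact: archi_boundP.
Qed.

(* [sg n] is the ratio x_(n-1)/x_n and [y n] is ln x_n. *)
Variables (y sg : nat -> R) (K : R).
Hypotheses (K0 : 0 <= K) (sg0 : forall n, 0 < sg n).
Hypothesis y_step : forall n, y n - y n.+1 = ln (sg n.+1).
Hypothesis sg_step : forall n, sg n.+1 <= sg n + K / n.+1%:R.
Hypothesis y_small : forall d : R, 0 < d -> exists N : nat, forall n, (N <= n)%N -> `|y n| <= d * n%:R.

Lemma ratio_steps i j : sg (i + j) <= sg i + j%:R * (K / i.+1%:R).
Proof.
elim: j => [|j IH]; first by rewrite addn0 mul0r addr0.
rewrite addnS; apply: le_trans (sg_step _) _.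
have le1 : K / (i + j).+1%:R <= K / i.+1%:R.
  by rewrite ler_wpM2l // lef_pV2 ?posrE ?ltr0n // ler_nat ltnS leq_addr.
rewrite -[j.+1%:R]natr1 mulrDl mul1r addrA; exact: lerD.
Qed.

Lemma y_drop_ge a m (L : R) : (forall i, (a < i <= a + m)%N -> L <= ln (sg i)) ->
  m%:R * L <= y a - y (a + m)%N.
Proof.
elim: m => [|m IH] h; first by rewrite addn0 mul0r subrr.
have {}IH : m%:R * L <= y a - y (a + m)%N.
  by apply: IH => i /andP[ai im]; apply: h; rewrite ai addnS (leq_trans im).
have := h (a + m).+1; rewrite -y_step addnS leqnn ltnS leq_addr => /(_ isT).
rewrite -[m.+1%:R]natr1 mulrDl mul1r; lra.
Qed.

Lemma y_drop_le a m (L : R) : (forall i, (a < i <= a + m)%N -> ln (sg i) <= L) ->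
  y a - y (a + m)%N <= m%:R * L.
Proof.
elim: m => [|m IH] h; first by rewrite addn0 mul0r subrr.
have {}IH : y a - y (a + m)%N <= m%:R * L.
  by apply: IH => i /andP[ai im]; apply: h; rewrite ai addnS (leq_trans im).
have := h (a + m).+1; rewrite -y_step addnS leqnn ltnS leq_addr => /(_ isT).
rewrite -[m.+1%:R]natr1 mulrDl mul1r; lra.
Qed.

(* If [sg n] were above 1 + e, it would be above 1 + e/2 on a window of length
   proportional to n before n, and y would vary linearly there. *)
Lemma ratio_upper (e : R) : 0 < e -> exists N : nat, forall n, (N <= n)%N -> sg n <= 1 + e.
Proof.
move=> e0; have [q0 q0P] := nat_above (2 * K / e).
pose q := q0.+2.
set L := ln (1 + e / 2).
have L0 : 0 < L by rewrite ln_gt0 // ltrDl divr_gt0.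
have d0 : 0 < L / (8 * q%:R) by rewrite divr_gt0 // mulr_gt0 ?ltr0n.
have [N NP] := y_small d0.
exists (N.*2 + q)%N => n nN; rewrite leNgt; apply/negP => sgn.
pose m := (n %/ q)%N.
have m1 : (1 <= m)%N by rewrite divn_gt0 // (leq_trans _ nN) ?leq_addl.
have mq : (m * q <= n)%N by exact: leq_divM.
have nmq : (n <= (m * q).*2)%N.
  by have := divn_eq n q; have := ltn_pmod n (isT : (0 < q)%N); rewrite -/m; nia.
pose a := (n - m)%N.
have an : (a + m = n)%N by rewrite subnK //; nia.
have aN : (N <= a)%N by rewrite /a; nia.
have mqa : (m * q0.+1 <= a)%N by rewrite /a; nia.
have step i : (a < i <= a + m)%N -> L <= ln (sg i).
  move=> /andP[ai im]; rewrite ler_ln ?posrE //; last by rewrite addr_gt0 ?divr_gt0.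
  have := ratio_steps i (a + m - i); rewrite subnKC // an => h.
  have small : (n - i)%:R * (K / i.+1%:R) <= e / 2.
    apply: (@le_trans _ _ (m%:R * (K / a.+1%:R))).
      apply: ler_pM; rewrite ?divr_ge0 ?ler0n // ?ler_nat; first lia.
      by rewrite ler_wpM2l // lef_pV2 ?posrE ?ltr0n // ler_nat; lia.
    rewrite mulrA ler_pdivrMr ?ltr0n //.
    have h1 : K <= e / 2 * q0.+1%:R.
      rewrite -[q0.+1%:R]natr1 mulrDr mulr1; move: q0P; rewrite ltr_pdivrMr //; lra.
    have h2 : m%:R * q0.+1%:R <= a.+1%:R :> R by rewrite -natrM ler_nat; lia.
    have mp : 0 <= m%:R :> R by rewrite ler0n.
    apply: (@le_trans _ _ (m%:R * (e / 2 * q0.+1%:R))); first by rewrite ler_wpM2l.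
    rewrite mulrCA ler_wpM2l // divr_ge0 // ltW //.
  by move: h small; set z := (n - i)%:R * _ => h small; lra.
have := y_drop_ge step; rewrite an.
have bound k : (N <= k)%N -> (k <= n)%N -> `|y k| <= m%:R * L / 4.
  move=> Nk kn; apply: le_trans (NP k Nk) _.
  rewrite mulrAC ler_pdivrMr ?mulr_gt0 ?ltr0n //.
  have -> : m%:R * L / 4 * (8 * q%:R) = L * (m * q).*2%:R.
    by rewrite -mul2n !natrM; field.
  by rewrite ler_wpM2l ?(ltW L0) // ler_nat (leq_trans kn).
have mL : 0 < m%:R * L by rewrite mulr_gt0 ?ltr0n.
have ya : `|y a| <= m%:R * L / 4 by apply: bound; lia.
have yn : `|y n| <= m%:R * L / 4 by apply: bound; lia.
move: (ler_norm (y a)) (ler_norm (- y n)); rewrite normrN; lra.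
Qed.

Lemma ratio_lower (e : R) : 0 < e -> exists N : nat, forall n, (N <= n)%N -> 1 - e <= sg n.
Proof.
move=> e0; have [e1|e1] := leP 1 e.
  exists 0%N => n _; apply: (@le_trans _ _ 0); [lra | exact: ltW].
have [q0 q0P] := nat_above (2 * K / e).
pose q := q0.+2.
set L := - ln (1 - e / 2).
have L0 : 0 < L by rewrite oppr_gt0 ln_lt0 //; lra.
have d0 : 0 < L / (12 * q%:R) by rewrite divr_gt0 // mulr_gt0 ?ltr0n.
have [N NP] := y_small d0.
exists (N + q)%N => n nN; rewrite leNgt; apply/negP => sgn.
pose m := (n %/ q)%N.
have m1 : (1 <= m)%N by rewrite divn_gt0 // (leq_trans _ nN) ?leq_addl.
have mq : (m * q <= n)%N by exact: leq_divM.
have nmq : (n <= (m * q).*2)%N.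
  by have := divn_eq n q; have := ltn_pmod n (isT : (0 < q)%N); rewrite -/m; nia.
have mqn : (m * q0.+1 <= n)%N by nia.
have step i : (n < i <= n + m)%N -> ln (sg i) <= - L.
  move=> /andP[ni im]; rewrite opprK ler_ln ?posrE //; last lra.
  have := ratio_steps n (i - n); rewrite subnKC ?(ltnW ni) // => h.
  have small : (i - n)%:R * (K / n.+1%:R) <= e / 2.
    apply: (@le_trans _ _ (m%:R * (K / n.+1%:R))).
      by rewrite ler_wpM2r ?divr_ge0 ?ler0n // ler_nat; lia.
    rewrite mulrA ler_pdivrMr ?ltr0n //.
    have h1 : K <= e / 2 * q0.+1%:R.
      rewrite -[q0.+1%:R]natr1 mulrDr mulr1; move: q0P; rewrite ltr_pdivrMr //; lra.
    have h2 : m%:R * q0.+1%:R <= n.+1%:R :> R by rewrite -natrM ler_nat; lia.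
    have mp : 0 <= m%:R :> R by rewrite ler0n.
    apply: (@le_trans _ _ (m%:R * (e / 2 * q0.+1%:R))); first by rewrite ler_wpM2l.
    rewrite mulrCA ler_wpM2l // divr_ge0 // ltW //.
  by move: h small; set z := (i - n)%:R * _ => h small; lra.
have := y_drop_le step.
have bound k : (N <= k)%N -> (k <= n.*2)%N -> `|y k| <= m%:R * L / 3.
  move=> Nk kn; apply: le_trans (NP k Nk) _.
  rewrite mulrAC ler_pdivrMr ?mulr_gt0 ?ltr0n //.
  have -> : m%:R * L / 3 * (12 * q%:R) = L * (m * q).*2.*2%:R.
    by rewrite -!mul2n !natrM; field.
  by rewrite ler_wpM2l ?(ltW L0) // ler_nat (leq_trans kn) // leq_double.
have mL : 0 < m%:R * L by rewrite mulr_gt0 ?ltr0n.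
have mn : (m <= n)%N by rewrite leq_div.
have ya : `|y (n + m)%N| <= m%:R * L / 3 by apply: bound; lia.
have yn : `|y n| <= m%:R * L / 3 by apply: bound; lia.
move: (ler_norm (y (n + m)%N)) (ler_norm (- y n)); rewrite normrN; lra.
Qed.

Lemma ratio_cvg1 : (sg @ \oo --> (1 : R))%classic.
Proof.
apply/cvgrPdist_le => e e0.
have [N1 h1] := ratio_upper e0; have [N2 h2] := ratio_lower e0.
near=> n; rewrite distrC ler_norml.
have n1 : (N1 <= n)%N by near: n; exact: nbhs_infty_ge.
have n2 : (N2 <= n)%N by near: n; exact: nbhs_infty_ge.
by have := h1 n n1; have := h2 n n2; lra.
Unshelve. all: by end_near. Qed.

End SlowVariation.

(** * Limits of the fragment probabilities *)

Section FragmentLaw.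
Variables (R : realType) (lam nu : R) (A : graph_class).
Hypotheses (lam0 : (0 < lam)%R) (nu0 : (0 < nu)%R).
Hypotheses (mA : minor_closed A) (bA : bridge_addable A) (dA : dichotomous A).
Hypothesis (A_nonempty : forall n, exists G : graph n, G \in A n).
Local Open Scope ring_scope.
Local Notation C := (connected_class A).
Local Notation F := (freely_addable_class A).
Local Notation a := (egf_coef lam nu A).
Local Notation c := (egf_coef lam nu C).
Local Notation W n := (class_weight lam nu (A n)).

Definition frag_prob n k (H : graph k) : R :=
  (\sum_(G in A n | same_graph (frag G) H) weight lam nu G) / W n.

Definition frag_size_prob n k : R :=
  (\sum_(G in A n | #|~: big_component G| == k) weight lam nu G) / W n.

Lemma total_weight_gt0 n : 0 < W n.
Proof. by have [G /class_weight_gt0] := A_nonempty n; apply. Qed.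

Lemma frag_prob_ge0 n k (H : graph k) : 0 <= frag_prob n H.
Proof.
apply: divr_ge0; last exact/ltW/total_weight_gt0.
by apply: sumr_ge0 => G _; apply/ltW/weight_gt0.
Qed.

Lemma sum_same_graph m k (G : graph m) (x : R) :
  \sum_(H : graph k | same_graph G H) x = if m == k then x else 0.
Proof.
case: eqVneq => [E|ne]; last first.
  by rewrite big_pred0 // => H; apply: contraNF ne => /same_graph_tag ->.
case: k / E; rewrite (big_pred1 G) // => H; by rewrite same_graphE eq_sym.
Qed.

Lemma frag_size_probE n k : frag_size_prob n k = \sum_(H : graph k) frag_prob n H.
Proof.
rewrite -mulr_suml; congr (_ / _).
rewrite (exchange_big_dep (mem (A n))) /=; last by move=> p G _ /andP[].
rewrite big_mkcondr /=; apply: eq_bigr => G GA.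
rewrite -(sum_same_graph k (frag G)); apply: eq_bigl => H; by rewrite GA.
Qed.

Lemma sum_frag_size n K : \sum_(k < K) frag_size_prob n k =
  (\sum_(G in A n | (#|~: big_component G| < K)%N) weight lam nu G) / W n.
Proof.
rewrite -mulr_suml; congr (_ / _).
rewrite (exchange_big_dep (mem (A n))) /=; last by move=> p G _ /andP[].
rewrite [RHS]big_mkcondr /=; apply: eq_bigr => G GA; case: ifPn => [lt|]; last first.
  rewrite -leqNgt => le; apply: big_pred0 => k; rewrite GA /=.
  by apply/negbTE; rewrite neq_ltn (leq_trans (ltn_ord k) le) orbT.
by rewrite (big_pred1 (Ordinal lt)) // => k; rewrite GA /= -val_eqE /= eq_sym.
Qed.

Lemma sum_frag_size_le1 n K : \sum_(k < K) frag_size_prob n k <= 1.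
Proof.
rewrite sum_frag_size ler_pdivrMr ?total_weight_gt0 // mul1r.
by apply: ler_sum_sub => [G /andP[]//|G _]; apply/ltW/weight_gt0.
Qed.

Lemma frag_tight n K : 1 - (4 * nu / lam) / K.+1%:R <= \sum_(k < K.+1) frag_size_prob n k.
Proof.
rewrite sum_frag_size; have W0 := total_weight_gt0 n.
set s := \sum_(_ in _ | _) _; have Wn0 := lt0r_neq0 W0.
have split : W n = s + \sum_(G in A n | (K < #|~: big_component G|)%N) weight lam nu G.
  rewrite /class_weight (bigID (fun G => (#|~: big_component G| < K.+1)%N)) /=; congr (_ + _).
  by apply: eq_bigl => G; rewrite -leqNgt.
set t := \sum_(_ in _ | _) _ in split.
have mk : K.+1%:R * t <= \sum_(G in A n) weight lam nu G * #|~: big_component G|%:R.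
  rewrite mulr_sumr big_mkcondr /=; apply: ler_sum => G GA.
  have w0 := ltW (weight_gt0 G lam0 nu0).
  by case: ifP => lt; [rewrite mulrC ler_wpM2l // ler_nat | rewrite mulr_ge0 // ler0n].
have mf := mean_frag lam0 nu0 mA bA n.
have K0 : 0 < K.+1%:R :> R by rewrite ltr0n.
have h : lam * (K.+1%:R * t) <= 4 * nu * W n by apply: le_trans mf; rewrite ler_wpM2l // ltW.
rewrite -(ler_pM2r W0) divfK // mulrBl mul1r lerBlDr split lerD2l -split.
by rewrite mulrAC ler_pdivlMr // mulrAC ler_pdivlMr //; move: h; congr (_ <= _); ring.
Qed.

Lemma frag_mean n K : \sum_(k < K) k%:R * frag_size_prob n k <= 4 * nu / lam.
Proof.
have W0 := total_weight_gt0 n; rewrite ler_pdivlMr //.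
have -> : \sum_(k < K) k%:R * frag_size_prob n k
   = (\sum_(G in A n | (#|~: big_component G| < K)%N) weight lam nu G * #|~: big_component G|%:R) / W n.
  rewrite (eq_bigr (fun k : 'I_K => (\sum_(G in A n | #|~: big_component G| == k) weight lam nu G * #|~: big_component G|%:R) / W n)).
    rewrite -mulr_suml; congr (_ / _).
    rewrite (exchange_big_dep (mem (A n))) /=; last by move=> p G _ /andP[].
    rewrite [RHS]big_mkcondr /=; apply: eq_bigr => G GA; case: ifPn => [lt|]; last first.
      rewrite -leqNgt => le; apply: big_pred0 => k; rewrite GA /=.
      by apply/negbTE; rewrite neq_ltn (leq_trans (ltn_ord k) le) orbT.
    by rewrite (big_pred1 (Ordinal lt)) // => k; rewrite GA /= -val_eqE /= eq_sym.
  move=> k _; rewrite mulrA mulr_sumr; congr (_ / _); apply: eq_bigr => G /andP[_ /eqP ->].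
  by rewrite mulrC.
rewrite mulrAC ler_pdivrMr //; apply: le_trans (mean_frag lam0 nu0 mA bA n).
rewrite mulrC ler_wpM2l ?(ltW lam0) //; apply: ler_sum_sub => [G /andP[]//|G _].
by rewrite mulr_ge0 ?ler0n // ltW // weight_gt0.
Qed.

Lemma frag_coef n k (x y : R) : (k <= n)%N ->
  ('C(n, k)%:R * x * ((n - k)`!%:R * y)) / (n`!%:R * a n) = x / k`!%:R * (y / a n).
Proof.
move=> kn; rewrite -(bin_fact kn) !natrM.
have a0 := lt0r_neq0 (egf_coef_gt0 lam0 nu0 A_nonempty n).
by field; rewrite a0 !fact_neq0 /= pnatr_eq0 -lt0n bin_gt0 kn.
Qed.

Lemma frag_prob_le n k (H : graph k) : (k.*2 < n)%N ->
  frag_prob n H <= weight lam nu H / k`!%:R * (c (n - k) / a n).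
Proof.
move=> kn; have kn' : (k <= n)%N by lia.
rewrite -frag_coef // /frag_prob (egf_coefK lam nu A) -[X in _ * X / _](egf_coefK lam nu C).
rewrite ler_pM2r ?invr_gt0 -?egf_coefK ?total_weight_gt0 //.
exact: sum_frag_le.
Qed.

Lemma frag_prob_free n k (H : graph k) : (k.*2 < n)%N -> freely_addable A H ->
  frag_prob n H = weight lam nu H / k`!%:R * (c (n - k) / a n).
Proof.
move=> kn fH; have kn' : (k <= n)%N by lia.
rewrite -frag_coef // /frag_prob -(egf_coefK lam nu A) -[X in _ * X / _](egf_coefK lam nu C).
by rewrite sum_frag_free.
Qed.

Lemma frag_prob_nonfree k (H : graph k) : ~ freely_addable A H ->
  (frag_prob n H @[n --> \oo] --> (0 : R))%classic.
Proof.
move=> nf; have [M MP] := limited_frag lam0 nu0 mA bA dA A_nonempty nf.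
apply/cvgrPdist_le => e e0.
have [N NP] := nat_above (nu * M%:R / lam / e).
near=> n; rewrite sub0r normrN ger0_norm ?frag_prob_ge0 //.
have nk : (k.*2 + k + N < n)%N by near: n; exact: nbhs_infty_gt.
have kn : (k.*2 < n)%N by lia.
have := MP n kn; have W0 := total_weight_gt0 n.
rewrite /frag_prob; set s := \sum_(_ in _ | _) _ => h.
rewrite ler_pdivrMr //.
have Nn : N%:R <= (n - k)%:R :> R by rewrite ler_nat; lia.
have nk0 : 0 < (n - k)%:R :> R by rewrite ltr0n; lia.
have h2 : nu * M%:R <= lam * (n - k)%:R * e.
  have := lt_le_trans NP Nn; rewrite ltr_pdivrMr // ltr_pdivrMr // => /ltW.
  by congr (_ <= _); ring.
rewrite -(ler_pM2l (_ : 0 < lam * (n - k)%:R)) ?mulr_gt0 //; apply: le_trans h _.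
by rewrite mulrA ler_pM2r.
Unshelve. all: by end_near. Qed.

Lemma connected_lower_bound : exists p0 : R, exists N : nat, 0 < p0 /\
  forall n, (N <= n)%N -> p0 * a n <= c n.
Proof.
have [K KP] := nat_above (2 * (4 * nu / lam)).
pose S := \sum_(k < K.+1) a k * (2 / lam) ^+ k.
have S0 : 0 < S.
  rewrite /S big_ord_recl /= mulr1 ltr_wpDr ?egf_coef_gt0 //.
  apply: sumr_ge0 => k _; apply: mulr_ge0; first exact: egf_coef_ge0.
  by apply/exprn_ge0/divr_ge0 => //; apply: ltW.
exists (1 / (2 * S)), (K.*2.+2)%N; split; first by rewrite divr_gt0 // mulr_gt0.
move=> n nK; have a0 := egf_coef_gt0 lam0 nu0 A_nonempty n.
have := frag_tight n K.
have le : \sum_(k < K.+1) frag_size_prob n k <= S * (c n / a n).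
  rewrite mulr_suml; apply: ler_sum => k _.
  have kK := ltn_ord k.
  have kn : (k.*2 < n)%N by lia.
  have cle : c (n - k) <= (2 / lam) ^+ k * c n.
    have := connected_coef_pow lam0 nu0 mA bA dA A_nonempty (n - k).-1 k.
    rewrite prednK ?subn_gt0; last by lia.
    rewrite subnK; last by lia.
    have l2 : 0 < (lam / 2) ^+ k by rewrite exprn_gt0 // divr_gt0.
    by rewrite -ler_pdivlMl // -exprVn invf_div.
  rewrite frag_size_probE; apply: (@le_trans _ _ (\sum_(H in A k) (weight lam nu H / k`!%:R * (c (n - k) / a n)))).
    rewrite [leRHS]big_mkcond /=; apply: ler_sum => H _; case: ifPn => HA; first exact: frag_prob_le.
    rewrite /frag_prob big_pred0 ?mul0r // => G; apply/negP => /andP[GA].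
    by move/(frag_in mA GA); apply/negP.
  rewrite -mulr_suml -mulr_suml -/(class_weight lam nu (A k)) -/(egf_coef lam nu A k).
  rewrite -mulrA ler_pM2l ?egf_coef_gt0 // mulrA ler_pM2r ?invr_gt0 //.
have half : (4 * nu / lam) / K.+1%:R <= 1 / 2.
  rewrite ler_pdivrMr ?ltr0n // -[K.+1%:R]natr1; move: KP; set B := 4 * nu / lam; lra.
move=> h; have : 1 / 2 <= S * (c n / a n) by apply: le_trans le; apply: le_trans h; rewrite lerBrDr addrC -lerBrDr; apply: le_trans half _; lra.
rewrite mulrA ler_pdivlMr // => h2.
rewrite -(ler_pM2l S0); apply: le_trans h2; rewrite le_eqVlt; apply/orP; left; apply/eqP.
by field; apply: lt0r_neq0.
Qed.

End FragmentLaw.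

Section Growth.
Variables (R : realType) (lam nu : R) (A : graph_class).
Hypotheses (lam0 : (0 < lam)%R) (nu0 : (0 < nu)%R).
Hypotheses (mA : minor_closed A) (bA : bridge_addable A) (dA : dichotomous A).
Hypothesis (A_nonempty : forall n, exists G : graph n, G \in A n).
Variable gam : R.
Hypothesis growth : growth_constant lam nu A gam.
Local Open Scope ring_scope.
Local Notation C := (connected_class A).
Local Notation a := (egf_coef lam nu A).
Local Notation c := (egf_coef lam nu C).

Lemma growth_close (d : R) : 0 < d -> exists N : nat, forall n, (N <= n)%N ->
  exists2 x : R, `|x - gam| <= d & a n = x ^+ n.
Proof.
move=> d0; have [_ [eps [/cvgrPdist_le/(_ d d0)[N1 _ h1] [N2 _ h2]]]] := growth.
exists (maxn N1 N2) => n; rewrite geq_max => /andP[n1 n2].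
exists (gam + eps n); last exact: h2.
by rewrite addrC addKr; have := h1 n n1; rewrite /= sub0r normrN.
Qed.

Lemma growth_gt0 : 0 < gam.
Proof.
have [g0 _] := growth; rewrite lt_def g0 andbT; apply/eqP => gE.
have l4 : 0 < lam / 4 by rewrite divr_gt0.
have [N NP] := growth_close l4.
have c1 := connected_coef_gt0 lam0 nu0 mA bA dA A_nonempty 0.
have [q qP] := nat_above (lam / 4 / c 1%N).
pose n := maxn N q; have [x xg aE] := NP n.+1 (leq_trans (leq_maxl _ _) (leqnSn _)).
rewrite gE subr0 in xg.
have : (lam / 2) ^+ n * c 1%N <= (lam / 4) ^+ n.+1.
  apply: (@le_trans _ _ (a n.+1)).
    have := connected_coef_pow lam0 nu0 mA bA dA A_nonempty 0 n; rewrite add1n => h.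
    by apply: le_trans h _; apply: connected_coef_le.
  rewrite aE; apply: le_trans (ler_norm _) _; rewrite normrX.
  by apply: lerXn2r => //; rewrite nnegrE ltW.
have -> : lam / 2 = 2 * (lam / 4) by field.
rewrite exprMn exprS mulrAC ler_pM2r ?exprn_gt0 //.
apply/negP; rewrite -ltNge; move: qP; rewrite ltr_pdivrMr // => /lt_le_trans; apply.
rewrite ler_wpM2r ?(ltW c1) // -natrX ler_nat.
exact: leq_trans (leq_maxr N q) (ltnW (ltn_expl _ _)).
Qed.

Lemma ln_coef_small (d : R) : 0 < d -> exists N : nat, forall n, (N <= n)%N ->
  `|ln (a n) - n%:R * ln gam| <= d * n%:R.
Proof.
move=> d0; have g0 := growth_gt0.
have /cvgrPdist_le/(_ d d0) := @continuous_ln R gam g0.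
case=> e /= e0 eP; have e20 : 0 < Num.min (e / 2) (gam / 2) by rewrite lt_min !divr_gt0.
have [N NP] := growth_close e20; exists N => n /NP[x]; rewrite le_min => /andP[xe xg] ->.
have x0 : 0 < x by move: xg; rewrite ler_norml; lra.
rewrite lnXn // -[ln x *+ n]mulr_natl -mulrBr normrM ger0_norm ?ler0n // mulrC ler_wpM2r ?ler0n //.
rewrite distrC; apply: eP; rewrite /ball /= distrC; apply: le_lt_trans xe _; lra.
Qed.

Lemma ln_connected_small (d : R) : 0 < d -> exists N : nat, forall n, (N <= n)%N ->
  `|ln (c n) - n%:R * ln gam| <= d * n%:R.
Proof.
move=> d0; have d20 : 0 < d / 2 by rewrite divr_gt0.
have [N1 h1] := ln_coef_small d20.
have [p0 [N2 [p00 h2]]] := connected_lower_bound lam0 nu0 mA bA dA A_nonempty.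
have [N3 h3] := nat_above (`|ln p0| / (d / 2)).
exists (maxn (maxn N1 N2) N3).+1 => -[//|n]; rewrite ltnS !geq_max => /andP[/andP[n1 n2] n3].
have a0 := egf_coef_gt0 lam0 nu0 A_nonempty n.+1.
have c0 := connected_coef_gt0 lam0 nu0 mA bA dA A_nonempty n.
have up : ln (c n.+1) <= ln (a n.+1).
  by rewrite ler_ln ?posrE // connected_coef_le.
have lo : ln p0 + ln (a n.+1) <= ln (c n.+1).
  have pa0 : 0 < p0 * a n.+1 by apply: mulr_gt0.
  by rewrite -lnM ?posrE // ler_ln ?posrE //; apply: h2; apply: leqW.
have p3 : `|ln p0| <= d / 2 * n.+1%:R.
  move: h3; rewrite ltr_pdivrMr // => /ltW/le_trans; apply.
  by rewrite mulrC ler_wpM2l ?(ltW d20) // ler_nat leqW.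
have := h1 n.+1 (leqW n1); rewrite ler_norml => /andP[b1 b2].
have := ler_norm (- ln p0); rewrite normrN => b3.
rewrite ler_norml.
set z := n.+1%:R * ln gam in b1 b2 *; set w := n.+1%:R in p3 b1 b2 *.
have dw : 0 <= d / 2 * w by rewrite mulr_ge0 ?(ltW d20) ?ler0n.
have E : d * w = d / 2 * w + d / 2 * w by field.
by rewrite E; move: dw p3 b1 b2; set v := d / 2 * w => *; apply/andP; split; lra.
Qed.

Lemma connected_ratio :
  (c n.+1 / c n.+2 @[n --> \oo] --> gam^-1)%classic.
Proof.
have g0 := growth_gt0; have cp := connected_coef_gt0 lam0 nu0 mA bA dA A_nonempty.
have cn0 n : c n.+1 != 0 by apply: lt0r_neq0.
have gn0 := lt0r_neq0 g0.
pose sg n := if n is m.+1 then gam * (c m.+1 / c m.+2) else gam * (c 1%N / c 2%N).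
pose y n := ln (c n.+1) - n.+1%:R * ln gam.
have K0 : 0 <= gam / lam by rewrite divr_ge0 ?ltW.
have sg0 n : 0 < sg n by case: n => [|n]; apply: mulr_gt0 => //; apply: divr_gt0; apply: cp.
have y_step n : y n - y n.+1 = ln (sg n.+1).
  have cc : 0 < c n.+1 / c n.+2 by apply: divr_gt0; apply: cp.
  rewrite /y /sg [ln (gam * _)]lnM ?posrE // [ln (c n.+1 / _)]ln_div ?posrE //.
  rewrite -[n.+2%:R]natr1; ring.
have sg_step n : sg n.+1 <= sg n + gam / lam / n.+1%:R.
  case: n => [|n]; first by rewrite lerDl divr_ge0.
  rewrite /sg -mulrA -mulrDr ler_pM2l //.
  have := connected_coef_log_concave lam0 nu0 mA bA dA A_nonempty n.
  set x1 := c n.+1; set x2 := c n.+2; set x3 := c n.+3.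
  have [x1p x2p x3p] : [/\ 0 < x1, 0 < x2 & 0 < x3] by split; apply: cp.
  set u1 : R := n.+1%:R; set u2 : R := n.+2%:R => h.
  have u12 : u1 <= u2 by rewrite ler_nat.
  have u1p : 0 < u1 by rewrite ltr0n.
  have u2p : 0 < u2 by rewrite ltr0n.
  have {}h : lam * u2 ^+ 2 * x2 ^+ 2 <= x3 * (u2 * x2 + lam * u2 ^+ 2 * x1).
    apply: le_trans h _; rewrite ler_pM2l // lerD2l ler_pM2r // ler_pM2l //.
    by rewrite lerXn2r // nnegrE ltW.
  have -> : x1 / x2 + lam^-1 / u2 = (u2 * x2 + lam * u2 ^+ 2 * x1) / (lam * u2 ^+ 2 * x2).
    by field; rewrite !lt0r_neq0.
  have den0 : 0 < lam * u2 ^+ 2 * x2 by apply: mulr_gt0 => //; apply: mulr_gt0 => //; apply: exprn_gt0.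
  rewrite ler_pdivlMr // mulrAC ler_pdivrMr //.
  by move: h; congr (_ <= _); ring.
have y_small d : 0 < d -> exists N : nat, forall n, (N <= n)%N -> `|y n| <= d * n%:R.
  move=> d0; have d20 : 0 < d / 2 by rewrite divr_gt0.
  have [N h] := ln_connected_small d20; exists N.+1 => -[//|n] nN.
  apply: le_trans (h _ _) _; first by lia.
  rewrite -mulrA ler_pM2l //; rewrite mulrC ler_pdivrMr // -natrM ler_nat; lia.
have := ratio_cvg1 K0 sg0 y_step sg_step y_small.
rewrite -cvg_shiftS => h.
rewrite (_ : (fun n => c n.+1 / c n.+2) = (fun n => gam^-1 * sg n.+1)); last first.
  by apply/funext => n; rewrite /sg mulKf.
rewrite -[X in (_ --> X)%classic]mulr1; apply: cvgM; [exact: cvg_cst | exact: h].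
Qed.

Lemma connected_ratio_pow k :
  (c n.+1 / c (n.+1 + k) @[n --> \oo] --> gam^-1 ^+ k)%classic.
Proof.
have cn0 n : c n.+1 != 0 by apply/lt0r_neq0/connected_coef_gt0.
elim: k => [|k IH].
  rewrite expr0; apply: cvg_near_cst; near=> n.
  by rewrite addn0 divff.
have sh := connected_ratio; rewrite -(cvg_shiftn k) in sh.
rewrite exprSr (_ : (fun n => _) = (fun n => c n.+1 / c (n.+1 + k) * (c (n + k).+1 / c (n + k).+2))).
  by apply: cvgM.
by apply/funext => n; rewrite addnS !addSn mulrA divfK.
Unshelve. all: by end_near. Qed.

Lemma rho_growth : rho lam nu A = (gam^-1)%:E.
Proof.
have g0 := growth_gt0; rewrite /rho /radius_of_convergence; apply/eqP; rewrite eq_le; apply/andP; split.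
  apply: ge_ereal_sup => _ /= [x cx <-]; rewrite lee_fin leNgt; apply/negP => xg.
  have x0 : 0 < `|x| by apply: lt_trans xg; rewrite invr_gt0.
  have d0 : 0 < gam - `|x|^-1.
    by rewrite subr_gt0 invf_plt ?posrE.
  have [N1 NP] := growth_close d0.
  have /cvgrPdist_lt/(_ 1 ltr01)[N2 _ h] := cvg_series_cvg_0 cx.
  pose n := maxn N1 N2; have [z zg aE] := NP n (leq_maxl _ _).
  have := h n (leq_maxr _ _); rewrite /= sub0r normrN aE -exprMn normrX normrM.
  apply/negP; rewrite -leNgt; apply: exprn_ege1.
  rewrite -ler_pdivrMr // mul1r; move: (ler_norm z) zg; rewrite ler_norml; lra.
apply/lee_addgt0Pr => e e0; have gi0 : 0 < gam^-1 by rewrite invr_gt0.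
pose t := gam^-1 - Num.min e (gam^-1 / 2).
have m0 : 0 < Num.min e (gam^-1 / 2) by rewrite lt_min e0 divr_gt0.
have t0 : 0 < t.
  have : Num.min e (gam^-1 / 2) <= gam^-1 / 2 by rewrite ge_min lexx orbT.
  by rewrite /t; lra.
have tg : t < gam^-1 by rewrite /t; lra.
have te : gam^-1 <= t + e.
  have : Num.min e (gam^-1 / 2) <= e by rewrite ge_min lexx.
  by rewrite /t; lra.
suff ct : cvgn (pseries a t).
  apply: (@le_trans _ _ (t%:E + e%:E)%E); first by rewrite -EFinD lee_fin.
  apply: leeD => //; apply: ereal_sup_ubound; exists t => //.
  by rewrite ger0_norm // ltW.
have d0 : 0 < (t^-1 - gam) / 2 by rewrite divr_gt0 // subr_gt0 invf_pgt ?posrE.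
have [N NP] := growth_close d0.
pose q := (gam + (t^-1 - gam) / 2) * t.
have q0 : 0 < q by rewrite mulr_gt0 //; lra.
have q1 : q < 1 by rewrite -ltr_pdivlMr // mul1r; lra.
pose M := 1 + \sum_(i < N) a i * t ^+ i / q ^+ i.
have u0 i : 0 <= a i * t ^+ i by apply: mulr_ge0; [exact: egf_coef_ge0 | apply/exprn_ge0/ltW].
have v0 i : 0 <= a i * t ^+ i / q ^+ i by rewrite divr_ge0 // exprn_ge0 // ltW.
have M1 : 1 <= M by rewrite lerDl sumr_ge0.
apply: (@series_le_cvg _ _ (geometric M q)) => // [i|i|].
- by rewrite /geometric /= mulr_ge0 ?exprn_ge0 ?(ltW q0) // (le_trans ler01).
- rewrite /geometric /=; have [iN|Ni] := ltnP i N.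
    rewrite -ler_pdivrMr ?exprn_gt0 // /M (bigD1 (Ordinal iN)) //= addrCA lerDl.
    by rewrite addr_ge0 // sumr_ge0.
  have [z zg ->] := NP i Ni; rewrite -exprMn.
  apply: (@le_trans _ _ (q ^+ i)); last by rewrite ler_peMl // exprn_ge0 // ltW.
  apply: le_trans (ler_norm _) _; rewrite normrX lerXn2r ?nnegrE ?(ltW q0) //.
  rewrite normrM (ger0_norm (ltW t0)) ler_pM2r //.
  by move: zg; rewrite !ler_norml => /andP[? ?]; apply/andP; split; lra.
- by apply: is_cvg_geometric_series; rewrite ger0_norm // ltW.
Qed.

End Growth.

Section Limit.
Variables (R : realType) (lam nu : R) (A : graph_class).
Hypotheses (lam0 : (0 < lam)%R) (nu0 : (0 < nu)%R).
Hypotheses (mA : minor_closed A) (bA : bridge_addable A) (dA : dichotomous A).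
Hypothesis (A_nonempty : forall n, exists G : graph n, G \in A n).
Variable gam : R.
Hypothesis growth : growth_constant lam nu A gam.
Local Open Scope classical_set_scope.
Local Open Scope ring_scope.
Local Notation C := (connected_class A).
Local Notation F := (freely_addable_class A).
Local Notation a := (egf_coef lam nu A).
Local Notation c := (egf_coef lam nu C).
Local Notation r := gam^-1.
Local Notation p n := (c n / a n).
Local Notation P n H := (frag_prob lam nu A n H).
Local Notation V n k := (frag_size_prob lam nu A n k).

Lemma cvg_sum0 (I : finType) (f : I -> nat -> R) :
  (forall i, f i @ \oo --> (0 : R)) -> (fun n => \sum_i f i n) @ \oo --> (0 : R).
Proof.
move=> h; have : (fun n => \sum_i f i n) @ \oo --> \sum_(i : I) (0 : R).
  by apply: cvg_big => [|i _]; [exact: add_continuous | exact: h].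
by rewrite big1_eq.
Qed.

Definition limit_weight (x : R) k (H : graph k) : R :=
  if H \in F k then weight lam nu H * x ^+ k / k`!%:R else 0.

Local Notation mu := (limit_weight r).

Lemma growth_inv_gt0 : 0 < r.
Proof. by rewrite invr_gt0 (growth_gt0 lam0 nu0 mA bA dA A_nonempty growth). Qed.

Lemma limit_weight_ge0 x k (H : graph k) : 0 <= x -> 0 <= limit_weight x H.
Proof.
move=> x0; rewrite /limit_weight; case: ifP => // _.
by rewrite divr_ge0 ?ler0n // mulr_ge0 ?exprn_ge0 // ltW // weight_gt0.
Qed.

Lemma sum_limit_weight x k :
  \sum_(H : graph k) limit_weight x H = egf_coef lam nu F k * x ^+ k.
Proof.
rewrite /limit_weight -big_mkcond /= /egf_coef /class_weight !mulr_suml.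
by apply: eq_bigr => H _; rewrite mulrAC.
Qed.

Lemma conn_prob_bounds n : 0 <= p n <= 1.
Proof.
have a0 := egf_coef_gt0 lam0 nu0 A_nonempty n.
by rewrite divr_ge0 ?egf_coef_ge0 ?(ltW a0) //= ler_pdivrMr // mul1r connected_coef_le.
Qed.

Lemma connected_ratio_sub k : (fun n => c (n - k) / c n) @ \oo --> r ^+ k.
Proof.
have h := connected_ratio_pow lam0 nu0 mA bA dA A_nonempty growth (k := k).
rewrite -(cvg_shiftn k.+1); apply: cvg_trans h; apply: near_eq_cvg; near=> n.
have e1 : (n + k.+1 - k = n.+1)%N by rewrite addnS subSn ?leq_addl // addnK.
change (c n.+1 / c (n.+1 + k)%N = c (n + k.+1 - k)%N / c (n + k.+1)%N).
by rewrite e1 addnS addSn.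
Unshelve. all: by end_near. Qed.

Lemma frag_prob_limit k (H : graph k) : (fun n => P n H - p n * mu H) @ \oo --> (0 : R).
Proof.
rewrite /limit_weight; case: ifPn => HF; last first.
  apply: cvg_trans (frag_prob_nonfree lam0 nu0 mA bA dA A_nonempty (H := H) _).
    by apply: near_eq_cvg; near=> n; rewrite mulr0 subr0.
  by move=> fH; case/negP: HF; apply/freely_addable_classP.
have fH : freely_addable A H by apply/freely_addable_classP.
set w := weight lam nu H / k`!%:R.
have w0 : 0 <= w by rewrite divr_ge0 ?ler0n // ltW // weight_gt0.
have h := connected_ratio_sub (k := k).
have {}h : (fun n => w * `|c (n - k) / c n - r ^+ k|) @ \oo --> (0 : R).
  rewrite -[X in _ --> X](mulr0 w); apply: cvgM; first exact: cvg_cst.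
  rewrite -[X in _ --> X](normr0 R); apply: cvg_norm.
  rewrite -[X in _ --> X](subrr (r ^+ k)); apply: cvgB h _; exact: cvg_cst.
apply/cvgrPdist_le => e e0; move/cvgrPdist_le/(_ e e0): h => [N _ NP].
near=> n; have nk : (k.*2 + N < n)%N by near: n; exact: nbhs_infty_gt.
have nN : (N <= n)%N by lia.
have nk2 : (k.*2 < n)%N by lia.
apply: le_trans (NP n nN); rewrite !sub0r !normrN frag_prob_free //.
have /andP[p0 p1] := conn_prob_bounds n.
rewrite normrM normr_id (ger0_norm w0) -/w.
have cn0 : c n != 0.
  have n0 : (0 < n)%N by lia.
  by rewrite -(prednK n0); apply/lt0r_neq0/connected_coef_gt0.
have -> : w * (c (n - k) / a n) - p n * (weight lam nu H * r ^+ k / k`!%:R)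
   = p n * (w * (c (n - k) / c n - r ^+ k)).
  rewrite /w; have a0 := lt0r_neq0 (egf_coef_gt0 lam0 nu0 A_nonempty n).
  by field; rewrite a0 cn0 fact_neq0.
rewrite normrM (ger0_norm p0) normrM (ger0_norm w0).
by rewrite ler_piMl // mulr_ge0.
Unshelve. all: by end_near. Qed.

Local Notation phi k := (egf_coef lam nu F k * r ^+ k).

Lemma phi_ge0 k : 0 <= phi k.
Proof. by rewrite mulr_ge0 ?egf_coef_ge0 // exprn_ge0 // ltW // growth_inv_gt0. Qed.

Lemma size_prob_limit k : (fun n => V n k - p n * phi k) @ \oo --> (0 : R).
Proof.
have -> : (fun n => V n k - p n * phi k) = (fun n => \sum_(H : graph k) (P n H - p n * mu H)).
  apply/funext => n.
  by rewrite frag_size_probE -sum_limit_weight mulr_sumr -sumrB.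
by apply: cvg_sum0 => H; exact: frag_prob_limit.
Qed.

Lemma weighted_size_limit (w : nat -> R) K :
  (fun n => \sum_(k < K) w k * V n k - p n * \sum_(k < K) w k * phi k) @ \oo --> (0 : R).
Proof.
have -> : (fun n => \sum_(k < K) w k * V n k - p n * \sum_(k < K) w k * phi k)
   = (fun n => \sum_(k < K) w k * (V n k - p n * phi k)).
  apply/funext => n; rewrite mulr_sumr -sumrB; apply: eq_bigr => k _.
  by rewrite mulrBr; congr (_ - _); rewrite mulrCA.
apply: cvg_sum0 => k; rewrite -[X in _ --> X](mulr0 (w k)).
by apply: cvgM; [exact: cvg_cst | exact: size_prob_limit].
Qed.

Lemma weighted_phi_bounded (w : nat -> R) B : (forall k, 0 <= w k) ->
  (forall n K, \sum_(k < K) w k * V n k <= B) ->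
  exists M, forall K, \sum_(k < K) w k * phi k <= M.
Proof.
move=> w0 VB; have [p0 [N0 [p00 p0P]]] := connected_lower_bound lam0 nu0 mA bA dA A_nonempty.
exists ((B + 1) / p0) => K; rewrite ler_pdivlMr //.
have /cvgrPdist_le/(_ 1 ltr01)[N1 _ h] := weighted_size_limit w K.
pose n := maxn N0 N1; have := h n (leq_maxr _ _); rewrite /= sub0r normrN.
set S := \sum_(k < K) w k * phi k.
have S0 : 0 <= S by apply: sumr_ge0 => k _; rewrite mulr_ge0 // phi_ge0.
have pn : p0 <= p n.
  by rewrite ler_pdivlMr ?egf_coef_gt0 //; apply: p0P; apply: leq_maxl.
have pS : p0 * S <= p n * S by rewrite ler_wpM2r.
move: (VB n K) pS; rewrite [S * p0]mulrC.
set u := \sum_(k < K) _; set v := p n * S; set z := p0 * S.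
by rewrite ler_norml => ? ? /andP[? ?]; lra.
Qed.

Lemma phi_bounded : exists M, forall K, \sum_(k < K) phi k <= M.
Proof.
have [|n K|M MP] := @weighted_phi_bounded (fun=> 1) 1.
- by move=> k; exact: ler01.
- rewrite (eq_bigr (fun k : 'I_K => V n k)) ?sum_frag_size_le1 // => k _; by rewrite mul1r.
by exists M => K; have := MP K; rewrite (eq_bigr (fun k : 'I_K => phi k)) // => k _; rewrite mul1r.
Qed.

Lemma phi_mean_bounded : exists M, forall K, \sum_(k < K) k%:R * phi k <= M.
Proof.
have [k|n K|M MP] := @weighted_phi_bounded (fun k => k%:R) (4 * nu / lam).
- exact: ler0n.
- exact: frag_mean.
by exists M.
Qed.

Lemma series_phi_cvg : cvgn (series (fun k => phi k)).
Proof.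
have [M MP] := phi_bounded; apply: nondecreasing_is_cvgn.
  by apply: nondecreasing_series => k _ _; exact: phi_ge0.
by exists M => _ [n _ <-]; rewrite /series /= big_mkord.
Qed.

Definition fragment_gf : R := limn (series (fun k => phi k)).

Local Notation Phi := fragment_gf.

Lemma series_phi_le n : \sum_(k < n) phi k <= Phi.
Proof.
have := nondecreasing_cvgn_le (nondecreasing_series (fun k _ _ => phi_ge0 k)) series_phi_cvg n.
by rewrite /series /= big_mkord.
Qed.

Lemma fragment_gf_gt0 : 0 < Phi.
Proof.
apply: lt_le_trans (series_phi_le 1); rewrite big_ord1 expr0 mulr1.
apply: divr_gt0; last exact: fact_pos.
apply: (@class_weight_gt0 _ _ _ lam0 nu0 0 _ (edgeless 0)).
exact/freely_addable_classP/freely_addable_edgeless.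
Qed.

Lemma tail_small (e : R) : 0 < e -> exists K : nat,
  (forall n, 1 - \sum_(k < K) V n k <= e) /\ Phi - \sum_(k < K) phi k <= e.
Proof.
move=> e0; have /cvgrPdist_le/(_ e e0)[N _ NP] := series_phi_cvg.
have [q qP] := nat_above (4 * nu / lam / e).
exists (maxn N q).+1; split=> [n|].
  have := frag_tight lam0 nu0 mA bA A_nonempty n (maxn N q).
  have : 4 * nu / lam / (maxn N q).+1%:R <= e.
    rewrite ler_pdivrMr ?ltr0n // [leRHS]mulrC -ler_pdivrMr //; apply: le_trans (ltW qP) _.
    by rewrite ler_nat leqW // leq_maxr.
  set z := _ / (maxn N q).+1%:R; lra.
have := NP (maxn N q).+1 (leqW (leq_maxl _ _)); rewrite /= /series /= big_mkord.
by apply: le_trans; exact: ler_norm.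
Qed.

Lemma conn_prob_limit : (fun n => p n) @ \oo --> Phi^-1.
Proof.
have Phi0 := fragment_gf_gt0.
suff h : (fun n => p n * Phi) @ \oo --> (1 : R).
  have -> : (fun n => p n) = (fun n => p n * Phi * Phi^-1).
    by apply/funext => n; rewrite mulfK ?lt0r_neq0.
  by rewrite -[X in _ --> X]mul1r; apply: cvgM h _; exact: cvg_cst.
apply/cvgrPdist_le => e e0; have e3 : 0 < e / 3 by rewrite divr_gt0.
have [K [tV tphi]] := tail_small e3.
have /cvgrPdist_le/(_ _ e3)[N _ NP] := weighted_size_limit (fun=> 1) K.
near=> n; have nN : (N <= n)%N by near: n; exact: nbhs_infty_ge.
have := NP n nN; rewrite /= sub0r normrN.
rewrite (eq_bigr (fun k : 'I_K => V n k)); last by move=> k _; rewrite mul1r.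
rewrite [X in _ * X](eq_bigr (fun k : 'I_K => phi k)); last by move=> k _; rewrite mul1r.
have := tV n; have := sum_frag_size_le1 lam0 nu0 A_nonempty n K.
have /andP[p0 p1] := conn_prob_bounds n.
have pl := series_phi_le K.
have : p n * (Phi - \sum_(k < K) phi k) <= e / 3.
  by apply: le_trans tphi; rewrite ler_piMl // subr_ge0.
have : 0 <= p n * (Phi - \sum_(k < K) phi k) by rewrite mulr_ge0 // subr_ge0.
rewrite mulrBr !ler_norml; set u := \sum_(_ < _) _; set v := p n * \sum_(_ < _) _; lra.
Unshelve. all: by end_near. Qed.

Lemma frag_prob_cvg k (H : graph k) : (fun n => P n H) @ \oo --> mu H / Phi.
Proof.
have -> : (fun n => P n H) = (fun n => (P n H - p n * mu H) + p n * mu H).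
  by apply/funext => n; rewrite subrK.
rewrite -[X in _ --> X]add0r; apply: cvgD; first exact: frag_prob_limit.
by rewrite mulrC; apply: cvgM; [exact: conn_prob_limit | exact: cvg_cst].
Qed.

Lemma total_variation_bound (e : R) : 0 < e -> exists K N : nat, forall n, (N <= n)%N ->
  [/\ \sum_(k < K) \sum_(H : graph k) `|P n H - mu H / Phi| <= e,
      1 - \sum_(k < K) V n k <= e & 1 - \sum_(k < K) phi k / Phi <= e].
Proof.
move=> e0; have Phi0 := fragment_gf_gt0.
have e1 : 0 < Num.min e (e * Phi) by rewrite lt_min e0 mulr_gt0.
have [K [tV tphi]] := tail_small e1.
have h : (fun n => \sum_(k < K) \sum_(H : graph k) `|P n H - mu H / Phi|) @ \oo --> (0 : R).
  apply: cvg_sum0 => k; apply: cvg_sum0 => H; rewrite -[X in _ --> X](normr0 R); apply: cvg_norm.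
  rewrite -[X in _ --> X](subrr (mu H / Phi)); apply: cvgB; last exact: cvg_cst.
  exact: frag_prob_cvg.
move/cvgrPdist_le/(_ e e0): h => [N _ NP]; exists K, N => n nN; split.
- by apply: le_trans (NP n nN); rewrite sub0r normrN ler_norm.
- by apply: le_trans (tV n) _; rewrite ge_min lexx.
- rewrite -mulr_suml -(ler_pM2r Phi0) mulrBl mul1r divfK ?lt0r_neq0 //.
  by apply: le_trans tphi _; rewrite ge_min lexx orbT.
Qed.

End Limit.

Local Open Scope classical_set_scope.
Local Open Scope ring_scope.
Local Open Scope ereal_scope.

(** * The limit law on unlabelled graphs *)

Section Mixture.
Context d (T : measurableType d) (R : realType).
Variables (x : forall k, graph k -> T) (w : forall k, graph k -> {nonneg R}).

(* [msum] is indexed by nat, hence the enumeration with a default value. *)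
Definition mixture_layer k : {measure set T -> \bar R} :=
  msum (fun i => mscale (w (nth (edgeless k) (enum {: graph k}) i))
                        (dirac (x (nth (edgeless k) (enum {: graph k}) i)))) #|{: graph k}|.

Definition mixture : set T -> \bar R := mseries mixture_layer 0.

HB.instance Definition _ := Measure.on mixture.

Lemma sum_enum_graph (f : forall k, graph k -> \bar R) k :
  \sum_(i < #|{: graph k}|) f k (nth (edgeless k) (enum {: graph k}) i)
  = \sum_(H : graph k) f k H.
Proof.
rewrite [RHS](eq_bigl (mem (enum {: graph k}))) => [|H]; last by rewrite /= mem_enum.
rewrite -big_uniq ?enum_uniq //= (big_nth (edgeless k)) big_mkord.
by rewrite -cardE.
Qed.

Lemma mixtureE S : mixture S =
  \sum_(0 <= k <oo) (\sum_(H : graph k) (w H)%:num * (x H \in S)%:R)%:E.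
Proof.
rewrite /mixture /mseries; apply: eq_eseriesr => k _.
rewrite /mixture_layer /= /msum.
rewrite (sum_enum_graph (fun k (H : graph k) => mscale (w H) (dirac (x H)) S)) -sumEFin.
by apply: eq_bigr => H _; rewrite /mscale /= diracE.
Qed.

Lemma integral_mixture (f : T -> R) : measurable_fun setT f -> (forall t, (0 <= f t)%R) ->
  \int[mixture]_t (f t)%:E =
  \sum_(0 <= k <oo) (\sum_(H : graph k) (w H)%:num * f (x H))%:E.
Proof.
move=> mf f0; have mf' : measurable_fun setT (fun t => (f t)%:E) by exact/measurable_EFinP.
have f0' t : setT t -> 0 <= (f t)%:E by rewrite lee_fin.
rewrite ge0_integral_measure_series //; apply: eq_eseriesr => k _.
rewrite ge0_integral_measure_sum //.
under eq_bigr => i _.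
  rewrite ge0_integral_mscale // integral_dirac // diracT mul1e -EFinM; over.
rewrite (sum_enum_graph (fun k (H : graph k) => ((w H)%:num * f (x H))%:E)).
by rewrite sumEFin.
Qed.

End Mixture.

Section MassOne.
Context d (T : measurableType d) (R : realType).
Variables (m : {measure set T -> \bar R}) (m1 : m setT = 1).

(* The proof is an argument so that the probability instance can be inferred. *)
Definition mass_one (_ : m setT = 1) : set T -> \bar R := m.

HB.instance Definition _ := Measure.on (mass_one m1).

Let mass_one_setT : mass_one m1 setT = 1.
Proof. exact: m1. Qed.

HB.instance Definition _ := Measure_isProbability.Build _ _ R (mass_one m1) mass_one_setT.

End MassOne.

Lemma isomorphic_size m k (G : graph m) (H : graph k) : isomorphic G H -> m = k.
Proof. by case=> f [/bij_eq_card]; rewrite !card_ord. Qed.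

Lemma unlabelledP m k (G : graph m) (H : graph k) :
  unlabelled G = unlabelled H <-> isomorphic G H.
Proof.
split=> [/eqP|iso].
  by rewrite /unlabelled piE => /asboolP.
by apply/eqP; rewrite /unlabelled piE; apply/asboolP.
Qed.

Lemma unlabelledK (H : ugraph) : unlabelled (labelled H) = H.
Proof.
rewrite /unlabelled /labelled -[RHS]reprK; congr (\pi_ugraph _)%qT.
by case: (repr H).
Qed.

Lemma num_vertices_unlabelled k (H : graph k) : num_vertices (unlabelled H) = k.
Proof.
exact: isomorphic_size (iffLR (unlabelledP _ _) (unlabelledK (unlabelled H))).
Qed.

Section SeriesLemmas.
Variable R : realType.

Lemma eseries_EFin (u : nat -> R) : cvgn (series u) ->
  \sum_(0 <= k <oo) (u k)%:E = (limn (series u))%:E.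
Proof.
move=> cu; rewrite -EFin_lim //; congr (limn _); apply/funext => n.
by rewrite /series /= sumEFin.
Qed.

Lemma eseries_single (u : nat -> R) h : (forall k, k != h -> u k = 0%R) ->
  \sum_(0 <= k <oo) (u k)%:E = (u h)%:E.
Proof.
move=> u0; apply: cvg_lim => //; apply: cvg_near_cst; near=> n.
have hn : (h < n)%N by near: n; exact: nbhs_infty_gt.
rewrite sumEFin big_mkord (bigD1 (Ordinal hn)) //= big1 ?addr0 // => k kh.
by apply: u0; apply: contraNneq kh => E; apply/eqP/val_inj.
Unshelve. all: by end_near. Qed.

Lemma eseries_convolution (al ph : nat -> R) (P : R) :
  (forall k, 0 <= al k)%R -> (forall k, 0 <= ph k)%R ->
  \sum_(0 <= i <oo) (ph i)%:E = P%:E ->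
  \sum_(0 <= k <oo) (\sum_(j < k.+1) al j * ph (k - j)%N)%:E
  = (\sum_(0 <= j <oo) (al j)%:E) * (\sum_(0 <= i <oo) (ph i)%:E).
Proof.
move=> al0 ph0 phP.
pose t j k : \bar R := if (j <= k)%N then (al j * ph (k - j)%N)%:E else 0.
have t0 j k : 0 <= t j k by rewrite /t; case: ifP => // _; rewrite lee_fin mulr_ge0.
transitivity (\sum_(0 <= k <oo) \sum_(0 <= j <oo) t j k).
  apply: eq_eseriesr => k _.
  rewrite (nneseries_split 0 k.+1) // add0n eseries0 ?adde0; last first.
    by move=> j kj _; rewrite /t leqNgt kj.
  rewrite big_mkord -sumEFin; apply: eq_bigr => j _.
  by rewrite /t -ltnS ltn_ord.
rewrite nneseries_interchange //.
rewrite phP muleC -nneseriesZl; last by move=> j _; rewrite lee_fin.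
apply: eq_eseriesr => j _; rewrite muleC -phP -nneseriesZl; last by move=> i _; rewrite lee_fin.
rewrite (nneseries_split 0 j) // add0n big1_seq ?add0e; last first.
  move=> k; rewrite mem_index_iota => /andP[_ /andP[_ kj]].
  by rewrite /t leqNgt kj.
rewrite -(nneseries_addn j) //.
by apply: eq_eseriesr => i _; rewrite /t leq_addl addnK EFinM.
Qed.

End SeriesLemmas.

Section Law.
Variables (R : realType) (lam nu : R) (A : graph_class).
Hypotheses (lam0 : (0 < lam)%R) (nu0 : (0 < nu)%R).
Hypotheses (mA : minor_closed A) (bA : bridge_addable A) (dA : dichotomous A).
Hypothesis (A_nonempty : forall n, exists G : graph n, G \in A n).
Variable gam : R.
Hypothesis growth : growth_constant lam nu A gam.
Local Notation F := (freely_addable_class A).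
Local Notation D := (connected_class F).
Local Notation r := (gam^-1)%R.
Local Notation W n := (class_weight lam nu (A n)).
Local Notation mu := (limit_weight lam nu A r).
Local Notation phi k := (egf_coef lam nu F k * r ^+ k)%R.
Local Notation Phi := (fragment_gf lam nu A gam).

Let Phi0 : (0 < Phi)%R := fragment_gf_gt0 lam0 nu0 mA bA dA A_nonempty growth.
Let r0 : (0 < r)%R := growth_inv_gt0 lam0 nu0 mA bA dA A_nonempty growth.
Let phi0 k : (0 <= phi k)%R := phi_ge0 lam0 nu0 mA bA dA A_nonempty growth k.

Lemma egf_free_fragment : egf lam nu F r = Phi%:E.
Proof. exact: eseries_EFin (series_phi_cvg lam0 nu0 mA bA dA A_nonempty growth). Qed.

Lemma law_weight_ge0 k (H : graph k) : (0 <= mu H / Phi)%R.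
Proof. by rewrite divr_ge0 ?(ltW Phi0) ?limit_weight_ge0 ?(ltW r0). Qed.

Definition law_weight k (H : graph k) : {nonneg R} := NngNum (law_weight_ge0 H).

Definition limit_measure := mixture (fun k (H : graph k) => unlabelled H) law_weight.

Lemma limit_measureE S : limit_measure S =
  \sum_(0 <= k <oo) (\sum_(H : graph k) mu H / Phi * (unlabelled H \in S)%:R)%R%:E.
Proof. exact: mixtureE. Qed.

Lemma limit_measure_setT : limit_measure setT = 1.
Proof.
rewrite limit_measureE.
transitivity (\sum_(0 <= k <oo) (Phi^-1)%:E * (phi k)%:E).
  apply: eq_eseriesr => k _; rewrite -EFinM -sum_limit_weight mulr_sumr; congr EFin.
  by apply: eq_bigr => H _; rewrite in_setT mulr1 mulrC.
rewrite nneseriesZl; last by move=> k _; rewrite lee_fin.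
rewrite -[X in _ * X]/(egf lam nu F r) egf_free_fragment -EFinM.
by rewrite mulVf // lt0r_neq0.
Qed.

Definition limit_law := mass_one limit_measure_setT.

Lemma limit_law_free : limit_law (unlabelled_class F) = 1.
Proof.
rewrite -[RHS]limit_measure_setT -[LHS]/(limit_measure _) !limit_measureE.
apply: eq_eseriesr => k _. congr EFin; apply: eq_bigr => H _.
rewrite in_setT; case: (boolP (H \in F k)) => [HF|nF]; last first.
  by rewrite /limit_weight (negbTE nF) !mul0r.
congr (_ * _)%R; rewrite mem_set //.
rewrite /unlabelled_class; have := unlabelledK (unlabelled H).
move/unlabelledP => [f [bf fE]]; apply/freely_addable_classP.
have fH : freely_addable A H by apply/freely_addable_classP.
by apply: (freely_addable_embeds mA _ fH); split; [exact: bij_inj bf | move=> u v; rewrite fE].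
Qed.

Lemma limit_law1 (H : ugraph) : unlabelled_class F H ->
  limit_law [set H] = (frag_weight lam nu r H / Phi)%:E.
Proof.
move=> HF; rewrite -[LHS]/(limit_measure _) limit_measureE (@eseries_single _ _ (num_vertices H)); last first.
  move=> k kH; apply: big1 => G _; rewrite memNset ?mulr0 // => /= E.
  by case/eqP: kH; rewrite -E num_vertices_unlabelled.
congr EFin; set k := num_vertices H; pose H0 : graph k := labelled H.
rewrite (bigID (fun G : graph k => G \in [set relabel H0 s | s : 'S_k]%SET)) /= [X in (_ + X)%R]big1 ?addr0; last first.
  move=> G nG; rewrite memNset ?mulr0 // => /= E; case/negP: nG.
  by apply/isomorphic_relabel/unlabelledP; rewrite E unlabelledK.
rewrite (eq_bigr (fun=> mu H0 / Phi)%R); last first.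
  move=> G /isomorphic_relabel iso; have GE : unlabelled G = H.
    by rewrite -[RHS]unlabelledK; apply/unlabelledP.
  rewrite mem_set ?mulr1 //; congr (_ / _)%R; rewrite /limit_weight (weight_iso lam nu iso).
  congr (if _ then _ else _); apply/idP/idP => /freely_addable_classP fG; apply/freely_addable_classP.
    have [f [[g fK gK] fE]] := iso.
    apply: (freely_addable_embeds mA (f := g) _ fG); split; first exact: can_inj gK.
    by move=> u v; rewrite -fE !gK.
  have [f [bf fE]] := iso; apply: (freely_addable_embeds mA (f := f) _ fG).
  by split; [exact: bij_inj | move=> u v; rewrite fE].
have card := card_isomorphic H0.
have aut0 : (num_aut H0)%:R != 0%R :> R.
  by rewrite pnatr_eq0; apply/eqP => E; move: card; rewrite E muln0; have := fact_gt0 k => /[swap] <-.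
rewrite sumr_const -mulr_natl mulrA; congr (_ / _)%R.
rewrite /limit_weight -/H0 HF /frag_weight -/H0 -/k -card natrM /weight.
have card0 : #|[set relabel H0 s | s : 'S_k]%SET|%:R != 0%R :> R.
  by rewrite pnatr_eq0; apply/eqP => E; move: card; rewrite E mul0n; have := fact_gt0 k => /[swap] <-.
move: aut0 card0; move: (num_aut H0)%:R (#|_|%:R : R) (lam ^+ _)%R (nu ^+ _)%R (r ^+ k)%R.
by move=> a b x y z a0 b0; field; rewrite a0 b0.
Qed.

End Law.

Section Convergence.
Variables (R : realType) (lam nu : R) (A : graph_class).
Hypotheses (lam0 : (0 < lam)%R) (nu0 : (0 < nu)%R).
Hypotheses (mA : minor_closed A) (bA : bridge_addable A) (dA : dichotomous A).
Hypothesis (A_nonempty : forall n, exists G : graph n, G \in A n).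
Variable gam : R.
Hypothesis growth : growth_constant lam nu A gam.
Local Notation F := (freely_addable_class A).
Local Notation D := (connected_class F).
Local Notation r := (gam^-1)%R.
Local Notation W n := (class_weight lam nu (A n)).
Local Notation mu := (limit_weight lam nu A r).
Local Notation phi k := (egf_coef lam nu F k * r ^+ k)%R.
Local Notation Phi := (fragment_gf lam nu A gam).

Let Phi0 : (0 < Phi)%R := fragment_gf_gt0 lam0 nu0 mA bA dA A_nonempty growth.
Let r0 : (0 < r)%R := growth_inv_gt0 lam0 nu0 mA bA dA A_nonempty growth.
Let phi0 k : (0 <= phi k)%R := phi_ge0 lam0 nu0 mA bA dA A_nonempty growth k.

Local Notation P n H := (frag_prob lam nu A n H).
Local Notation V n k := (frag_size_prob lam nu A n k).
Let FE : egf lam nu F r = Phi%:E :=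
  egf_free_fragment lam0 nu0 mA bA dA A_nonempty growth.
Local Notation limlaw := (limit_law lam0 nu0 mA bA dA A_nonempty growth).
Implicit Type S : set ugraph.

Definition frag_law n S : R :=
  ((\sum_(G in A n | unlabelled (frag G) \in S) weight lam nu G) / W n)%R.

Lemma same_graph_unlabelled m k (G : graph m) (H : graph k) :
  same_graph G H -> unlabelled G = unlabelled H.
Proof. by move=> /eqP E; rewrite /unlabelled E. Qed.

Lemma frag_law_ge n K S :
  (\sum_(k < K) \sum_(H : graph k) P n H * (unlabelled H \in S)%:R <= frag_law n S)%R.
Proof.
have w0 (G : graph n) : (0 <= weight lam nu G)%R by apply/ltW/weight_gt0.
rewrite [leLHS](_ : _ = (\sum_(k < K) \sum_(G in A n | unlabelled (frag G) \in S)
    (if #|~: big_component G| == k then weight lam nu G else 0)) / W n)%R; last first.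
  rewrite mulr_suml; apply: eq_bigr => k _; rewrite /frag_prob.
  under eq_bigr => H _ do rewrite mulrAC.
  rewrite -mulr_suml; congr (_ / _)%R.
  under eq_bigr => H _ do rewrite mulr_suml.
  rewrite (exchange_big_dep (mem (A n))) /=; last by move=> H G _ /andP[].
  rewrite [RHS]big_mkcondr /=; apply: eq_bigr => G GA.
  rewrite (eq_bigl (fun H : graph k => same_graph (frag G) H)) => [|H]; last by rewrite GA.
  rewrite (eq_bigr (fun=> weight lam nu G * (unlabelled (frag G) \in S)%:R)%R); last first.
    by move=> H /same_graph_unlabelled ->.
  rewrite sum_same_graph; case: ifP => _; last by rewrite if_same.
  by case: ifP => _; rewrite ?mulr1 ?mulr0.
rewrite /frag_law ler_pM2r ?invr_gt0 ?total_weight_gt0 // exchange_big /=.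
apply: ler_sum => G _; rewrite -big_mkcond /=.
have [lt|le] := ltnP #|~: big_component G| K.
  by rewrite (big_pred1 (Ordinal lt)) // => k; rewrite /= -val_eqE /= eq_sym.
rewrite big_pred0 // => k; apply/negbTE.
by rewrite neq_ltn (leq_trans (ltn_ord k) le) orbT.
Qed.

Lemma frag_lawC n S : (frag_law n S + frag_law n (~` S) = 1)%R.
Proof.
rewrite -mulrDl; apply: (canLR (mulfK (lt0r_neq0 (total_weight_gt0 lam0 nu0 A_nonempty n)))).
rewrite mul1r /class_weight [RHS](bigID (fun G => unlabelled (frag G) \in S)) /=.
by congr (_ + _)%R; apply: eq_bigl => G; rewrite in_setC.
Qed.

Lemma frag_law_sample n d (T : measurableType d) (Pr : probability T R)
    (X : {mfun T >-> graph n}) S : sampled_from lam nu A Pr X ->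
  pushforward Pr (fun t => unlabelled (frag (X t))) S = (frag_law n S)%:E.
Proof.
move=> [_ XP].
pose B := [set G : graph n | unlabelled (frag G) \in S].
have -> : pushforward Pr (fun t => unlabelled (frag (X t))) S =
    Pr (\bigcup_(G in B) (X @^-1` [set G])).
  rewrite /pushforward; congr (Pr _); apply/seteqP; split=> t /=.
    by move=> St; exists (X t) => //; rewrite /B /= mem_set.
  by move=> [G /= GB E]; move: GB; rewrite /B /= -E => /set_mem.
rewrite measure_fin_bigcup //; [|exact: finite_finset|by move=> G H _ _ [t [/= <- <-]]|].
  rewrite fsbig_mkcond (fsbig_fwiden (index_enum (graph n))); first last.
  - by move=> G [_ nG]; case: nG.
  - exact: index_enum_uniq.
  - by move=> G _; rewrite /= mem_index_enum.
  rewrite /frag_law mulr_suml -sumEFin [RHS]big_mkcond /=.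
  apply: eq_bigr => G _; rewrite /patch.
  case: (boolP (G \in B)) => [/set_mem GB|GB].
    by have /= := XP G => ->; rewrite GB andbT; case: ifP.
  have -> : (unlabelled (frag G) \in S) = false by apply: contraNF GB => h; apply/mem_set.
  by rewrite andbF.
move=> G _; rewrite -[X in measurable X]setTI; exact: measurable_funP.
Qed.

Lemma limit_law_ge K S :
  (\sum_(k < K) \sum_(H : graph k) mu H / Phi * (unlabelled H \in S)%:R)%R%:E <= limlaw S.
Proof.
rewrite -[leRHS]/(limit_measure _ _ _ _ _ _ _ S) limit_measureE -sumEFin.
rewrite -(big_mkord xpredT (fun k => (\sum_(H : graph k) mu H / Phi * (unlabelled H \in S)%:R)%R%:E)).
apply: nneseries_lim_ge => k _ _; rewrite lee_fin; apply: sumr_ge0 => H _.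
by rewrite mulr_ge0 ?ler0n // law_weight_ge0.
Qed.

Lemma total_variation_cvg d (T : forall n, measurableType (d n))
    (Pr : forall n, probability (T n) R) (X : forall n, {mfun T n >-> graph n}) :
  (forall n, sampled_from lam nu A (Pr n) (X n)) ->
  (fun n => total_variation_dist
     (pushforward (Pr n) (fun t => unlabelled (frag (X n t)))) limlaw) @ \oo --> 0.
Proof.
move=> sX.
have TV n : total_variation_dist (pushforward (Pr n) (fun t => unlabelled (frag (X n t)))) limlaw
   = ereal_sup [set (`|frag_law n S - fine (limlaw S)|%R)%:E | S in measurable].
  have E S : `|pushforward (Pr n) (fun t => unlabelled (frag (X n t))) S - limlaw S|
      = (`|frag_law n S - fine (limlaw S)|%R)%:E.
    by rewrite (frag_law_sample _ (sX n)) -[X in `|_ - X|]fineK ?fin_num_measure.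
  by rewrite /total_variation_dist; congr ereal_sup; apply/seteqP; split=> _ [S mS <-]; exists S.
have bound (e : R) : (0 < e)%R -> exists N : nat, forall n, (N <= n)%N -> forall S,
    (`|frag_law n S - fine (limlaw S)| <= 2 * e)%R.
  move=> e0; have [K [N KN]] := total_variation_bound lam0 nu0 mA bA dA A_nonempty growth e0.
  exists N => n nN S; have [dist tV tphi] := KN n nN.
  pose u (S' : set ugraph) := (\sum_(k < K) \sum_(H : graph k) mu H / Phi * (unlabelled H \in S')%:R)%R.
  pose v (S' : set ugraph) := (\sum_(k < K) \sum_(H : graph k) P n H * (unlabelled H \in S')%:R)%R.
  have split01 S' (f : forall k, graph k -> R) : 
    (\sum_(k < K) \sum_(H : graph k) f k H * (unlabelled H \in S')%:R +
     \sum_(k < K) \sum_(H : graph k) f k H * (unlabelled H \in ~` S')%:R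
     = \sum_(k < K) \sum_(H : graph k) f k H)%R.
    rewrite -big_split /=; apply: eq_bigr => k _; rewrite -big_split /=.
    apply: eq_bigr => H _; rewrite in_setC; case: (_ \in S'); rewrite /= ?mulr1 ?mulr0 ?addr0 ?add0r //.
  have us : (u S + u (~` S) = \sum_(k < K) phi k / Phi)%R.
    rewrite /u (split01 S (fun k H => mu H / Phi)%R); apply: eq_bigr => k _.
    by rewrite -mulr_suml sum_limit_weight.
  have vs : (v S + v (~` S) = \sum_(k < K) V n k)%R.
    by rewrite /v (split01 S (fun k H => P n H)); apply: eq_bigr => k _; rewrite frag_size_probE.
  have vu S' : (`|v S' - u S'| <= e)%R.
    apply: le_trans dist; rewrite /v /u -sumrB; apply: le_trans (ler_norm_sum _ _ _) _.
    apply: ler_sum => k _; rewrite -sumrB; apply: le_trans (ler_norm_sum _ _ _) _.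
    apply: ler_sum => H _; rewrite -mulrBl normrM; case: (_ \in S').
      by rewrite normr1 mulr1.
    by rewrite normr0 mulr0.
  have fS S' : limlaw S' = (fine (limlaw S'))%:E by rewrite fineK // fin_num_measure.
  have lu S' : (u S' <= fine (limlaw S'))%R by rewrite -lee_fin -fS; exact: limit_law_ge.
  have lC : (fine (limlaw S) + fine (limlaw (~` S)) = 1)%R.
    have -> : limlaw (~` S) = 1 - limlaw S by exact: probability_setC.
    by rewrite (fS S) /= addrCA subrr addr0.
  have fv S' : (v S' <= frag_law n S')%R by exact: frag_law_ge.
  have fC := frag_lawC n S.
  have := vu S; have := vu (~` S); have := lu S; have := lu (~` S).
  have := fv S; have := fv (~` S); rewrite !ler_norml.
  move: us vs lC fC tV tphi.
  move: (u S) (u (~` S)) (v S) (v (~` S)) (fine (limlaw S)) (fine (limlaw (~` S)))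
    (frag_law n S) (frag_law n (~` S)) (\sum_(k < K) V n k)%R (\sum_(k < K) phi k / Phi)%R.
  move=> *; apply/andP; split; lra.
have TVbound (e : R) : (0 < e)%R -> exists N : nat, forall n, (N <= n)%N ->
    exists2 t : R, total_variation_dist (pushforward (Pr n) (fun t => unlabelled (frag (X n t)))) limlaw = t%:E
      & (0 <= t <= 2 * e)%R.
  move=> e0; have [N NP] := bound e e0; exists N => n nN; rewrite TV.
  set E := [set _ | _ in _].
  have up : ereal_sup E <= (2 * e)%:E.
    by apply: ge_ereal_sup => _ [S _ <-]; rewrite lee_fin NP.
  have lo : 0 <= ereal_sup E.
    apply: (@le_trans _ _ (`|frag_law n setT - fine (limlaw setT)|%R)%:E); first by rewrite lee_fin.
    by apply: ereal_sup_ubound; exists setT.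
  have fin : ereal_sup E \is a fin_num.
    by rewrite fin_numElt (lt_le_trans _ lo) ?ltNyr // (le_lt_trans up) ?ltry.
  exists (fine (ereal_sup E)); first by rewrite fineK.
  by rewrite -!lee_fin fineK // lo up.
apply/fine_cvgP; split.
  by have [N NP] := TVbound 1%R ltr01; exists N => // n /= /NP[t -> _].
apply/cvgrPdist_le => e e0; have e20 : (0 < e / 2)%R by rewrite divr_gt0.
have [N NP] := TVbound _ e20; exists N => // n /= /NP[t -> /andP[t0 te]] /=.
by rewrite sub0r normrN ger0_norm //; apply: le_trans te _; rewrite mulrC divfK.
Qed.

(* F' = D' F, coefficientwise. *)
Lemma mean_fragment : \sum_(0 <= k <oo) (k%:R * phi k)%:E =
  r%:E * egf_deriv lam nu D r * Phi%:E.
Proof.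
pose al j := (j%:R * (egf_coef lam nu D j * r ^+ j))%R.
have al0 j : (0 <= al j)%R.
  by rewrite mulr_ge0 ?ler0n // mulr_ge0 ?egf_coef_ge0 // exprn_ge0 // ltW.
have -> : r%:E * egf_deriv lam nu D r = \sum_(0 <= j <oo) (al j)%:E.
  rewrite /egf_deriv /pseries_sum -nneseriesZl; last first.
    move=> n _; rewrite lee_fin /pseries_diffs mulr_ge0 ?exprn_ge0 ?(ltW r0) //.
    by rewrite mulr_ge0 ?ler0n // egf_coef_ge0.
  rewrite [RHS]nneseries_recl //; last by move=> k _; rewrite lee_fin.
  rewrite {1}/al mul0r add0e -(nneseries_addn 1); last by move=> k; rewrite lee_fin.
  apply: eq_eseriesr => n _; rewrite -EFinM addn1 /al /pseries_diffs exprS; congr EFin.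
  by rewrite mulrCA !mulrA.
have conv := @eseries_convolution R al (fun k => phi k) Phi al0 phi0 FE.
have -> : Phi%:E = \sum_(0 <= i <oo) (phi i)%:E by rewrite -FE.
rewrite -conv; apply: eq_eseriesr => k _; congr EFin.
have := rooted_decomposition lam nu mA k.
rewrite (egf_coefK lam nu F k) => E.
apply: (mulfI (fact_neq0 R k)).
transitivity (r ^+ k * (k%:R * (k`!%:R * egf_coef lam nu F k)))%R.
  by move: (r ^+ k)%R (k`!%:R : R)%R => x y; ring.
rewrite E !mulr_sumr; apply: eq_bigr => j _; have jk : (j <= k)%N by rewrite -ltnS.
rewrite (egf_coefK lam nu D j) (egf_coefK lam nu F (k - j)) -(bin_fact jk) !natrM /al.
rewrite -{1}(subnKC jk) exprD.
move: (r ^+ j)%R (r ^+ (k - j))%R (j`!%:R : R)%R ((k - j)`!%:R : R)%R => x y f1 f2.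
by ring.
Qed.

Lemma limit_law_mean :
  'E_limlaw[fun H => (num_vertices H)%:R] = r%:E * egf_deriv lam nu D r.
Proof.
have mf : measurable_fun setT (fun H : ugraph => (num_vertices H)%:R : R) by [].
rewrite unlock -[LHS]/(\int[limit_measure _ _ _ _ _ _ _]_H _) integral_mixture //.
transitivity (\sum_(0 <= k <oo) (Phi^-1)%:E * (k%:R * phi k)%:E).
  apply: eq_eseriesr => k _; rewrite -EFinM -sum_limit_weight !mulr_sumr; congr EFin.
  by apply: eq_bigr => H _; rewrite num_vertices_unlabelled /=; ring.
rewrite nneseriesZl; last by move=> k _; rewrite lee_fin mulr_ge0 ?ler0n // phi0.
rewrite mean_fragment muleC -muleA -EFinM mulfV ?mule1 //; exact: lt0r_neq0.
Qed.

Lemma limit_law_mean_finite : r%:E * egf_deriv lam nu D r < +oo.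
Proof.
have [M MP] := phi_mean_bounded lam0 nu0 mA bA dA A_nonempty growth.
have : \sum_(0 <= k <oo) (k%:R * phi k)%:E < +oo.
  apply: (@le_lt_trans _ _ M%:E); last exact: ltry.
  apply: lime_le; first by apply: is_cvg_nneseries => k _; rewrite lee_fin mulr_ge0 ?ler0n // phi0.
  by near=> n; rewrite sumEFin big_mkord lee_fin.
rewrite mean_fragment => h; rewrite -(@lte_pmul2r _ Phi%:E) ?lte_fin // .
by rewrite mulyr gtr0_sg ?mul1e.
Unshelve. all: by end_near. Qed.

End Convergence.

Theorem theorem2p2 (R : realType) (lam nu : R) (A : graph_class)
  (lam_gt0 : (0 < lam)%R) (nu_gt0 : (0 < nu)%R)
  (A_iso : iso_closed A)
  (A_nonempty : forall n, exists G : graph n, G \in A n)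
  (A_wb : well_behaved lam nu A) :
  let F := freely_addable_class A in
  let D := connected_class F in
  let r := fine (rho lam nu A) in
  [/\ 0 < rho lam nu A < +oo,
      egf lam nu F r \is a fin_num
    & exists PR : probability ugraph R,
      [/\ PR (unlabelled_class F) = 1,
          forall H : ugraph, unlabelled_class F H ->
            PR [set H] = (frag_weight lam nu r H / fine (egf lam nu F r))%:E,
          forall (d : nat -> measure_display)
              (T : forall n, measurableType (d n))
              (P : forall n, probability (T n) R)
              (X : forall n, {mfun T n >-> graph n}),
            (forall n, sampled_from lam nu A (P n) (X n)) ->
            (fun n => total_variation_dist
              (pushforward (P n) (fun t => unlabelled (frag (X n t)))) PR)
              @ \oo --> 0,
          'E_PR[fun H => (num_vertices H)%:R] = r%:E * egf_deriv lam nu D r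
        & r%:E * egf_deriv lam nu D r < +oo]].
Proof.
move: A_wb => [mA bA dA [gam growth] _] F D r.
have rE : r = gam^-1%R by rewrite /r (rho_growth lam_gt0 nu_gt0 mA bA dA A_nonempty growth).
have FE := egf_free_fragment lam_gt0 nu_gt0 mA bA dA A_nonempty growth.
rewrite rE; split.
- rewrite (rho_growth lam_gt0 nu_gt0 mA bA dA A_nonempty growth) ltry andbT lte_fin.
  by apply: growth_inv_gt0 growth.
- by rewrite FE.
exists (limit_law lam_gt0 nu_gt0 mA bA dA A_nonempty growth); split.
- exact: limit_law_free.
- by move=> H HF; rewrite FE; apply: limit_law1.
- by move=> d T P X sX; apply: total_variation_cvg.
- exact: limit_law_mean.
- exact: limit_law_mean_finite.
Qed.
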